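(* There exist positive constants $c_1, c_2, c_3, c_4$ such that the following hold. (a) Let $G$ be an $n$-vertex graph with minimum degree $\delta(G) \geq \delta n$ for some $\delta := \delta(n) \geq c_1 n^{-1/3}$. If $\alpha(G) \leq c_2 \delta^2 n$ and $p := p(n) \geq \max\left\{\omega(n^{-2}), \frac{c_3 \log(1/\delta)}{\delta n^2}\right\}$, then $G \cup \mathbb{G}(n,p)$ is a.a.s. pancyclic. (b) There exists an $n$-vertex graph $H$ with minimum degree $\lfloor n/2 \rfloor - 1$ and independence number $\alpha(H) = 2$ such that if $H \cup \mathbb{G}(n,p)$ is a.a.s. Hamiltonian, then $p := p(n) = \omega(n^{-2})$. (c) For every $\delta := \delta(n)$ with $\delta = \Omega(n^{-1/3})$ and $\delta = o(1)$, there exists an $n$-vertex graph $H$ with minimum degree at least $\delta n$ satisfying $\alpha(H) = O(\delta^2 n)$ such that a.a.s. $H \cup \mathbb{G}(n,p)$ is not Hamiltonian whenever $p := p(n) \leq \frac{c_4 \log(1/\delta)}{\delta n^2}$.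
   Context: For an $n$-vertex graph $G$, $G \cup \mathbb{G}(n,p)$ denotes the union $G \cup R$ where $R$ is the binomial random graph on the vertex set $V(G)$ in which each pair of vertices is an edge independently with probability $p$. ''A.a.s.'' (asymptotically almost surely) means with probability tending to $1$ as $n \to \infty$. $\alpha(G)$ is the independence number and $\delta(G)$ the minimum degree. A graph on $n$ vertices is Hamiltonian if it has a cycle through all vertices, and pancyclic if it contains a cycle of length $\ell$ for every $3 \leq \ell \leq n$. Asymptotic notation ($\omega$, $o$, $O$, $\Omega$) is with respect to $n \to \infty$; e.g. $p = \omega(n^{-2})$ means $p n^2 \to \infty$. *)

(* Defs.v *)
From HB Require Import structures.
From mathcomp Require Import all_boot all_order all_algebra.
From mathcomp Require Import all_classical all_reals all_analysis.
Set Implicit Arguments. Unset Strict Implicit. Unset Printing Implicit Defensive.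
Import Order.TTheory GRing.Theory Num.Theory.
Local Open Scope ring_scope.

Definition pairs (n : nat) : {set {set 'I_n}} := [set e : {set 'I_n} | #|e| == 2%N].
Definition is_graph (n : nat) (E : {set {set 'I_n}}) : bool := E \subset pairs n.

Definition adj (n : nat) (E : {set {set 'I_n}}) (u v : 'I_n) : bool :=
  [set u; v] \in E.

Definition deg (n : nat) (E : {set {set 'I_n}}) (v : 'I_n) : nat :=
  #|[set u : 'I_n | adj E v u]|.

(* minimum degree (for n > 0 the default value n is never attained) *)
Definition mindeg (n : nat) (E : {set {set 'I_n}}) : nat :=
  \big[minn/n]_(v : 'I_n) deg E v.

Definition independent (n : nat) (E : {set {set 'I_n}}) (S : {set 'I_n}) : bool :=
  [forall u in S, forall v in S, ~~ adj E u v].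

Definition alpha (n : nat) (E : {set {set 'I_n}}) : nat :=
  \max_(S : {set 'I_n} | independent E S) #|S|.

(* E contains a cycle of length l (meaningful for l >= 3): an injective
   cyclic sequence of l vertices with consecutive ones adjacent. *)
Definition has_cycle (n : nat) (E : {set {set 'I_n}}) (l : nat) : bool :=
  [exists f : {ffun 'I_l -> 'I_n},
     injectiveb f && [forall i : 'I_l, adj E (f i) (f (ordS i))]].

Definition hamiltonian (n : nat) (E : {set {set 'I_n}}) : bool :=
  (3 <= n)%N && has_cycle E n.

Definition pancyclic (n : nat) (E : {set {set 'I_n}}) : bool :=
  [forall l : 'I_n.+1, (3 <= l)%N ==> has_cycle E l].

(* Probability that (G ∪ G(n,p)) has property P, where G(n,p) includes each
   pair independently with probability p. *)
Definition prob_union (R : realType) (n : nat) (G : {set {set 'I_n}}) (p : R)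
    (P : {set {set 'I_n}} -> bool) : R :=
  \sum_(E : {set {set 'I_n}} | E \subset pairs n)
     p ^+ #|E| * (1 - p) ^+ (#|pairs n| - #|E|) * (P (G :|: E))%:R.

(* Main.v *)
(** For part (a), let [G] have [n] vertices, minimum degree [d >= delta n] and
    [alpha(G) <= c2 delta^2 n], and put [s := c delta^2 n], which is much larger than both
    [alpha(G)] and [1 / delta].

    - Robust pieces.  [V(G)] splits into [O(1/delta)] pieces that stay connected after the
      deletion of any [s] vertices: repeatedly cut along small separators to find such a subset
      of minimum degree [d / 4], take disjoint ones greedily, and attach each leftover vertex to
      a piece in which it has more than [s] neighbours.
    - Hubs.  Double counting paths of length two gives a vertex [v] such that nearly all pairs of
      neighbours of [v] have more than [s] common neighbours.  After pruning, any two of these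
      neighbours are joined by a path with three interior vertices that avoids any prescribed set
      of size [s].  Disjoint hubs of size [Omega(d)] cover half of [V(G)], with one inside every
      piece.
    - Random edges.  With high probability the random edges, thinned so as to form a matching,
      cross every bipartition of the hubs, inside each of two disjoint zones.  The first zone
      yields a spanning tree on the hubs, the second one a set of edges correcting its degree
      parities, and an Euler tour of their union passes through every hub.  Its passages through
      the hubs are completed by hub links.
    - Ladder.  One passage also contains a chain of [2 alpha + 2] triangles, which can be
      traversed with any number of vertices in an interval of length [2 alpha + 2].
    - Rotation.  A longest cycle through the ladder that meets every piece more than
      [alpha + 1] times is Hamiltonian, by the crossing argument of Chvatal and Erdos.
      A chord between vertices at even positions shortens it by at most [2 alpha + 1], and the
      ladder fills in the missing lengths; closed ladders give the short cycles.

    For (b) and (c), take the disjoint cliques on the residue classes modulo [k], with [k = 2] and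
    [k ~ 1 / delta]: a clique without random edges leaving it excludes a Hamilton cycle.  In (c) such a
    clique exists by the second moment method. *)
Require Import Defs.
From HB Require Import structures.
From mathcomp Require Import all_boot all_order all_algebra.
From mathcomp Require Import all_classical all_reals all_analysis.
From mathcomp Require Import zify ring lra.
From mathcomp Require Import seq path fintype fingraph finset.
Set Implicit Arguments. Unset Strict Implicit. Unset Printing Implicit Defensive.
Import Order.TTheory GRing.Theory Num.Theory numFieldNormedType.Exports.

(** * Robustly connected pieces *)

Section RobustPieces.
Variables (T : finType) (g : rel T).
Hypotheses (gsym : symmetric g) (girr : irreflexive g).

Definition nbr (x : T) : {set T} := [set y | g x y].

Definition within (W : {set T}) : rel T :=
  [rel x y | [&& x \in W, y \in W & g x y]].

Definition robust (s : nat) (W : {set T}) : Prop :=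
  forall F : {set T}, #|F| <= s ->
  {in W :\: F &, forall x y, connect (within (W :\: F)) x y}.

Lemma in_nbr x y : (y \in nbr x) = g x y.
Proof. by rewrite inE. Qed.

Lemma within_sym W : symmetric (within W).
Proof. by move=> x y; rewrite /within /= gsym andbCA. Qed.

Lemma connect_within_in (W : {set T}) x y :
  x \in W -> connect (within W) x y -> y \in W.
Proof.
move=> xW /connectP[p]; elim: p x xW => [|z p IH] x xW /=; first by move=> _ ->.
by case/andP=> /and3P[_ zW _]; exact: IH.
Qed.

Lemma connect_within_path (W : {set T}) x y :
  x \in W -> connect (within W) x y ->
  exists p, [/\ path g x p, last x p = y, uniq (x :: p) & {subset x :: p <= W}].
Proof.
move=> xW /connectP[p0 p0P ->]; case/shortenP: p0P => p pP pU _.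
exists p; split=> //.
  by apply: sub_path pP => u v /and3P[].
elim: p x xW pP {pU} => [|z p IH] x xW /=; first by move=> _ u; rewrite inE => /eqP->.
case/andP=> /and3P[_ zW _] /(IH _ zW) sub u; rewrite inE => /predU1P[->//|]; exact: sub.
Qed.

(* A smallest [U] with [e * deg_U >= e^2 + s * #|U|] works: a component left by a separator of
   size [s] loses [s] in degree, but also at least [e] vertices. *)
Lemma robust_core (B : {set T}) (e s : nat) :
  0 < e -> s * #|T| <= e * e -> B != set0 ->
  (forall u, u \in B -> 2 * e <= #|nbr u :&: B|) ->
  exists2 U : {set T}, U \subset B &
    [/\ U != set0, robust s U & forall u, u \in U -> e <= #|nbr u :&: U|].
Proof.
move=> e0 hs B0 hB.
pose ok (U : {set T}) := [&& U \subset B, U != set0 &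
  [forall u in U, e * e + s * #|U| <= e * #|nbr u :&: U|]].
(* [B] qualifies: [s * #|T| <= e * e] bounds [e * e + s * #|B|] by [e * (2 * e)]. *)
have okB : ok B.
  apply/and3P; split=> //; apply/forall_inP => u uB.
  have := hB u uB; have : #|B| <= #|T| by exact: max_card.
  move: #|B| #|T| #|nbr u :&: B| hs => b n x hs bn ex.
  have : s * b <= s * n by rewrite leq_mul2l bn orbT.
  have : e * (2 * e) <= e * x by rewrite leq_mul2l ex orbT.
  by clear -hs; lia.
case: (arg_minnP (fun U : {set T} => #|U|) okB) => U /and3P[UB U0 /forall_inP hU] Umin.
exists U => //; split=> //; last first.
  move=> u /hU; move: #|_ :&: _| => x h; rewrite -(leq_pmul2l e0).
  exact: leq_trans (leq_addr _ _) h.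
move=> F Fs x y /setDP[xU xF] /setDP[yU yF]; apply: contraT => nxy.
set W := U :\: F.
have xW : x \in W by rewrite inE xF.
have yW : y \in W by rewrite inE yF.
pose A := [set z | connect (within W) x z].
have AW : A \subset W by apply/subsetP=> z; rewrite inE; exact: connect_within_in.
have AU : A \subset U by apply: subset_trans AW (subsetDl _ _).
have xA : x \in A by rewrite inE connect0.
have nbA u v : u \in A -> v \in W -> g u v -> v \in A.
  move=> uA vW uv; move: (uA); rewrite [u \in A]inE [v \in A]inE => xu.
  by apply: connect_trans xu (connect1 _); rewrite /within /= vW uv (subsetP AW).
have yA : y \notin A by rewrite inE.
have dA u : u \in A -> #|nbr u :&: U| <= #|nbr u :&: A| + s.
  move=> uA; have : nbr u :&: U \subset (nbr u :&: A) :|: F.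
    apply/subsetP=> v /setIP[uv vU]; rewrite inE; case vF: (v \in F); first by rewrite orbT.
    rewrite inE uv /= orbF; apply: nbA uA _ _; first by rewrite inE vF.
    by rewrite in_nbr in uv.
  by move/subset_leq_card; move: (cardsU (nbr u :&: A) F) Fs; clear; lia.
(* A neighbour of [y] in [A] would pull [y] into [A]. So [A] misses at least [e] vertices of [U],
   and [s * #|U|] drops by at least [s * e], which pays for the [s] lost neighbours. *)
have cA : #|A| + #|nbr y :&: U| <= #|U|.
  have dis : [disjoint A & nbr y :&: U].
    rewrite -setI_eq0; apply/eqP/setP=> z; rewrite in_set0; apply/negbTE/negP.
    case/setIP=> zA /setIP[yz _]; case/negP: yA; apply: nbA zA yW _.
    by rewrite gsym -in_nbr.
  have : A :|: (nbr y :&: U) \subset U by rewrite subUset AU subsetIr.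
  by move/subset_leq_card; rewrite cardsU; move: dis; rewrite -setI_eq0 => /eqP->; rewrite cards0; clear; lia.
have okA : ok A.
  apply/and3P; split; first exact: subset_trans AU UB.
    by apply/set0Pn; exists x.
  apply/forall_inP => u uA.
  have uU := subsetP AU _ uA.
  have := hU _ uU; have := hU _ yU; have := dA _ uA; move: cA.
  move: #|A| #|U| #|nbr u :&: U| #|nbr u :&: A| #|nbr y :&: U| => ca cu du da dy.
  move=> h1 h2 h3 h4.
  have h5 : e <= dy by rewrite -(leq_pmul2l e0); apply: leq_trans (leq_addr _ _) h3.
  have : s * ca + s * dy <= s * cu by rewrite -mulnDr leq_mul2l h1 orbT.
  have : s * e <= s * dy by rewrite leq_mul2l h5 orbT.
  have : e * du <= e * da + e * s by rewrite -mulnDr leq_mul2l h2 orbT.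
  by clear -h4; lia.
have := Umin _ okA.
have : e <= #|nbr y :&: U|.
  by rewrite -(leq_pmul2l e0); apply: leq_trans (leq_addr _ _) (hU _ yU).
by move: cA e0; clear; lia.
Qed.

(** More neighbours of [u] lie in [Q] than can be deleted; a surviving one joins [u] to the rest of
    [Q], which is still connected. *)
Lemma robust_setU1 (s : nat) (Q : {set T}) u :
  robust s Q -> s < #|nbr u :&: Q| -> robust s (u |: Q).
Proof.
move=> rQ hu F Fs.
have mono x y : connect (within (Q :\: F)) x y -> connect (within ((u |: Q) :\: F)) x y.
  apply: connect_sub => a b /and3P[aQ bQ ab]; apply: connect1; rewrite /within /= ab.
  move: aQ bQ; rewrite !inE => /andP[-> ->] /andP[-> ->]; by rewrite !orbT.
have hx x : x \in (u |: Q) :\: F -> exists2 z, z \in Q :\: F &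
    connect (within ((u |: Q) :\: F)) x z.
  move=> /[dup] xW; rewrite !inE => /andP[xF /predU1P[xu|xQ]]; last first.
    by exists x => //; rewrite inE xF.
  have [z /setIP[uz zQ] zF] : exists2 z, z \in nbr u :&: Q & z \notin F.
    apply/subsetPn/negP => /subset_leq_card; move: hu Fs; clear; lia.
  exists z; first by rewrite inE zF.
  by apply: connect1; rewrite /within /= xW !inE zF zQ xu -in_nbr uz orbT.
move=> x y /hx[x' x'W xx'] /hx[y' y'W yy'].
apply: connect_trans xx' _; apply: connect_trans (mono _ _ (rQ _ Fs _ _ x'W y'W)) _.
by rewrite (sym_connect_sym (within_sym _)).
Qed.

(** Otherwise deleting the at most [s] neighbours of [u] in [Q] would cut [u] off from the remaining
    vertices of [Q]; [s.+1 < #|Q|] provides one. *)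
Lemma robust_deg (s : nat) (Q : {set T}) u :
  robust s Q -> s.+1 < #|Q| -> u \in Q -> s < #|nbr u :&: Q|.
Proof.
move=> rQ cQ uQ; rewrite ltnNge; apply/negP => Fs.
set F := nbr u :&: Q in Fs.
have uF : u \notin F by rewrite !inE girr.
have [y yQ] : exists2 y, y \in Q & y \notin u |: F.
  apply/subsetPn/negP => /subset_leq_card; rewrite cardsU1 uF; move: cQ Fs; clear; lia.
rewrite in_setU1 negb_or => /andP[yu yF].
have uW : u \in Q :\: F by rewrite in_setD uF.
have yW : y \in Q :\: F by rewrite in_setD yF.
case: (connect_within_path uW (rQ _ Fs _ _ uW yW)) => -[|z p] [] /=.
  by move=> _ /esym/eqP; rewrite (negPf yu).
case/andP=> uz _ _ _ /(_ z); rewrite !inE eqxx orbT => /(_ isT).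
by rewrite uz /= andNb.
Qed.

(** Unlike a bound on all degrees in [Q], this survives attaching vertices to [Q]. It limits the
    number of pieces, and the core [U] is where a hub of the piece is found. *)
Definition core_in (e : nat) (Q : {set T}) : Prop :=
  exists U : {set T}, [/\ U \subset Q, U != set0 & forall u, u \in U -> e <= #|nbr u :&: U|].

Lemma core_in_card e Q : core_in e Q -> e <= #|Q|.
Proof.
case=> U [UQ /set0Pn[u uU] hU]; apply: leq_trans (hU u uU) _.
by apply: subset_leq_card; apply: subset_trans (subsetIr _ _) UQ.
Qed.

(** Take disjoint good sets with the largest union. If the uncovered part [B] has minimum degree
    [2 * e], [robust_core] finds another set in it. Otherwise some [u] in [B] has more than [2 * e]
    neighbours in the union of at most [#|T| / e] sets, hence more than [s] in one of them, and
    joins it. *)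
Lemma robust_partition (e s : nat) :
  0 < e -> s * #|T| <= e * e -> (forall u, 4 * e <= #|nbr u|) ->
  exists P : {set {set T}}, [/\ trivIset P, cover P = [set: T] &
    forall Q, Q \in P -> robust s Q /\ core_in e Q].
Proof.
move=> e0 hs hdeg.
pose ok (P : {set {set T}}) :=
  trivIset P && [forall Q in P, `[< robust s Q /\ core_in e Q >]].
have ok0 : ok set0.
  apply/andP; split; first by apply/trivIsetP => A B; rewrite inE.
  by apply/forall_inP => Q; rewrite inE.
case: (arg_maxnP (fun P : {set {set T}} => #|cover P|) ok0) => P /andP[tP /forall_inP gP] Pmax.
have {}gP Q : Q \in P -> robust s Q /\ core_in e Q by move=> /gP/asboolP.
exists P; split=> //; apply/eqP; rewrite -subTset; apply/negP => ncov.
have cP : #|P| * e <= #|T|.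
  apply: leq_trans (max_card (cover P)); rewrite -(eqP tP) -sum_nat_const.
  by apply: leq_sum => Q /gP[_ /core_in_card].
set B := ~: cover P.
have B0 : B != set0.
  by apply/eqP => B0; apply: ncov; rewrite -[cover P]setCK -/B B0 setC0.
have B_Q Q : Q \in P -> [disjoint B & Q].
  by move=> QP; rewrite disjoint_sym -subsets_disjoint; exact: bigcup_sup.
have [hB|] := boolP [forall u in B, 2 * e <= #|nbr u :&: B|].
  have [U UB [U0 rU dU]] := robust_core e0 hs B0 (fun u => forall_inP hB u).
  have UP : U \notin P.
    apply/negP => /B_Q; rewrite disjoint_sym => dis.
    case/set0Pn: U0 => u uU; have := disjointFr dis uU; by rewrite (subsetP UB).
  have okU : ok (U |: P).
    apply/andP; split.
      apply/trivIsetP => X Y /setU1P[->|XP] /setU1P[->|YP] XY.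
      - by rewrite eqxx in XY.
      - exact: disjointWl UB (B_Q _ YP).
      - rewrite disjoint_sym; exact: disjointWl UB (B_Q _ XP).
      - by apply: (trivIsetP tP).
    apply/forall_inP => Q /setU1P[->|/gP gQ]; apply/asboolP => //.
    by split=> //; exists U.
  have := Pmax _ okU; rewrite /cover big_setU1 //= leqNgt => /negP; apply.
  rewrite cardsU; have /eqP-> : U :&: \bigcup_(A in P) A == set0.
    rewrite setI_eq0; apply: disjointWl UB _.
    by rewrite disjoint_sym -subsets_disjoint.
  rewrite cards0; case/set0Pn: U0 => u uU.
  have : 0 < #|U| by apply/card_gt0P; exists u.
  by clear; lia.
rewrite negb_forall_in => /exists_inP[u uB]; rewrite -ltnNge => du.
have [Q QP hQ] : exists2 Q, Q \in P & s < #|nbr u :&: Q|.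
  apply/exists_inP; apply: contraT; rewrite negb_exists_in => /forall_inP hQ.
  have h1 : #|nbr u :&: cover P| <= #|P| * s.
    rewrite -sum_nat_const /cover; apply: leq_trans (_ : \sum_(Q in P) #|nbr u :&: Q| <= _).
      rewrite (big_morph _ (setIUr (nbr u)) (setI0 _)).
      elim/big_ind2: _ => // [|m X k Y hX hY]; first by rewrite cards0.
      by rewrite cardsU; move: hX hY; clear; lia.
    by apply: leq_sum => Q /hQ; rewrite -leqNgt.
  have h2 : 4 * e <= #|nbr u :&: B| + #|nbr u :&: cover P|.
    apply: leq_trans (hdeg u) _; rewrite -(cardsID (cover P) (nbr u)) addnC.
    by rewrite setDE.
  have : e * (2 * e) < e * (#|P| * s) by rewrite ltn_pmul2l //; move: du h1 h2; clear; lia.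
  have : #|P| * e * s <= #|T| * s by rewrite leq_mul2r cP orbT.
  by move: hs; clear; nia.
have uQ : u \notin Q by have := B_Q _ QP => /disjointFr->.
have okQ : ok ((u |: Q) |: (P :\ Q)).
  apply/andP; split.
    have dis Y : Y \in P -> Y != Q -> [disjoint u |: Q & Y].
      move=> YP YQ; rewrite -setI_eq0 setIUl setU_eq0 !setI_eq0 disjoints1.
      rewrite (disjointFr (B_Q _ YP) uB) /=.
      by apply: (trivIsetP tP) => //; rewrite eq_sym.
    apply/trivIsetP => X Y /setU1P[->|/setD1P[XQ XP]] /setU1P[->|/setD1P[YQ YP]] XY.
    - by rewrite eqxx in XY.
    - exact: dis.
    - by rewrite disjoint_sym; exact: dis.
    - by apply: (trivIsetP tP).
  apply/forall_inP => X /setU1P[->|/setD1P[_ /gP gX]]; apply/asboolP => //.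
  have [rQ [U [UQ U0 dU]]] := gP _ QP.
  split; first exact: robust_setU1.
  by exists U; split=> //; apply: subset_trans UQ (subsetUr _ _).
have /= := Pmax _ okQ; rewrite leqNgt => /negP; apply; apply: proper_card.
apply/properP; split.
  apply/subsetP => x /bigcupP[X XP xX]; apply/bigcupP.
  have [XQ|XQ] := eqVneq X Q.
    by exists (u |: Q); rewrite ?setU11 // -XQ setU1r.
  by exists X => //; rewrite setU1r // in_setD1 XQ.
exists u; last by rewrite inE in uB.
by apply/bigcupP; exists (u |: Q); rewrite setU11.
Qed.

End RobustPieces.

(** * Hubs *)

Section Hubs.
Variables (T : finType) (g : rel T).
Hypotheses (gsym : symmetric g) (girr : irreflexive g).
Local Notation nbr := (nbr g).

(** Links may leave [Z] but stay in [U]. Their fixed number of interior vertices makes the lengths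
    of ladder paths exact. *)
Definition hub (s : nat) (U Z : {set T}) : Prop :=
  Z \subset U /\
  forall F : {set T}, #|F| <= s -> forall z z', z \in Z -> z' \in Z -> z != z' ->
  exists w m w', [/\ uniq [:: z; w; m; w'; z'],
    {subset [:: w; m; w'] <= U :\: F} & path g z [:: w; m; w'; z']].

Lemma hub_sub s (U U' Z : {set T}) : U \subset U' -> hub s U Z -> hub s U' Z.
Proof.
move=> UU' [ZU h]; split; first exact: subset_trans ZU UU'.
move=> F Fs z z' zZ z'Z zz'; case: (h F Fs z z' zZ z'Z zz') => w [m [w' [u sub p]]].
exists w, m, w'; split=> // x /sub; rewrite !inE => /andP[-> xU].
by rewrite (subsetP UU').
Qed.

Lemma sum_card_setI (A B : {set T}) :
  \sum_(v in A) #|nbr v :&: B| = \sum_(u in B) #|nbr u :&: A|.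
Proof.
have card_sum (X : {set T}) v : #|nbr v :&: X| = \sum_(u in X) g v u.
  by rewrite -sum1dep_card big_mkcond [RHS]big_mkcond; apply: eq_bigr => u _; rewrite !inE; case: (u \in X); case: (g v u).
under eq_bigr do rewrite card_sum; rewrite exchange_big /=.
by apply: eq_bigr => u _; rewrite card_sum; apply: eq_bigr => v _; rewrite gsym.
Qed.

(* The hub is taken inside the neighbourhood of a vertex [v] for which few pairs of neighbours
   are [bad]; averaging over [v] works because a bad pair has few common neighbours. *)
Lemma exists_hub (U Rest : {set T}) (e s : nat) :
  U != set0 -> Rest \subset U -> #|U| <= 2 * #|Rest| ->
  (forall u, u \in U -> e <= #|nbr u :&: U|) ->
  32 * (s + 4) * #|U| <= e * e ->
  exists2 Z : {set T}, Z \subset Rest & hub s U Z /\ e <= 8 * #|Z|.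
Proof.
move=> U0 RU hR hdeg he.
have mge : e <= #|U|.
  by case/set0Pn: U0 => u /hdeg h; apply: leq_trans h (subset_leq_card (subsetIr _ _)).
have m0 : 0 < #|U| by rewrite card_gt0.
have r0 : 0 < #|Rest| by move: m0 hR; clear; lia.
pose codeg z z' := #|nbr z :&: nbr z' :&: U|.
(* [s + 2] counts what the vertex [w'], chosen last on a link, has to avoid: [F], [z] and [w]. *)
pose bad z z' := codeg z z' <= s + 2.
pose Zv v := nbr v :&: Rest.
pose badv v := \sum_(z in Zv v) #|[set z' in Zv v | bad z z']|.
have S1 : e * #|Rest| <= \sum_(v in U) #|Zv v|.
  rewrite /Zv sum_card_setI mulnC -sum_nat_const.
  by apply: leq_sum => u uR; apply: hdeg; exact: (subsetP RU).
have S2 : \sum_(v in U) badv v <= (s + 2) * (#|Rest| * #|Rest|).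
  have -> : \sum_(v in U) badv v =
      \sum_(z in Rest) \sum_(z' in Rest | bad z z') codeg z z'.
    rewrite /badv.
    transitivity (\sum_(v in U) \sum_(z in Rest) \sum_(z' in Rest | bad z z')
        ((z \in nbr v) && (z' \in nbr v) : nat)).
      apply: eq_bigr => v _; rewrite /Zv big_mkcond [RHS]big_mkcond /=.
      apply: eq_bigr => z _; rewrite !inE; case zR: (z \in Rest); last by rewrite andbF.
      rewrite andbT; case: (g v z); last by rewrite big1.
      rewrite -sum1dep_card big_mkcond [RHS]big_mkcond; apply: eq_bigr => z' _; rewrite !inE.
      by case: (g v z'); case: (z' \in Rest); case: (bad z z').
    rewrite exchange_big; apply: eq_bigr => z _ /=.
    rewrite exchange_big; apply: eq_bigr => z' _ /=.
    rewrite /codeg -sum1dep_card big_mkcond [RHS]big_mkcond; apply: eq_bigr => v _.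
    by rewrite !inE (gsym v) (gsym v); case: (v \in U); case: (g z v); case: (g z' v).
  rewrite mulnC -mulnA -sum_nat_const; apply: leq_sum => z _.
  rewrite -sum_nat_const big_mkcondr /=; apply: leq_sum => z' _.
  by case: ifP.
have [v vU /andP[hb hz]] : exists2 v, v \in U &
    (16 * badv v <= #|Zv v| * #|Zv v|) && (e * e <= 16 * (#|Zv v| * #|Zv v|)).
  apply/exists_inP; apply: contraT; rewrite negb_exists_in => /forall_inP hn.
  pose SZ := \sum_(v in U) #|Zv v| * #|Zv v|.
  (* A failing [v] has [16 * #|Zv v| ^ 2] below [256 * badv v] or below [e * e], hence below their
     sum. *)
  have h1 : 16 * SZ + #|U| <= 256 * \sum_(v in U) badv v + #|U| * (e * e).
    rewrite /SZ !big_distrr /= -[X in _ + X <= _]muln1 -!sum_nat_const -!big_split /=.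
    apply: leq_sum => v /hn; rewrite negb_and -!ltnNge.
    by move: (badv v) (_ * _) (e * e) => b z x; clear; case/orP; lia.
  (* Cauchy-Schwarz, from [2 * x * y <= x ^ 2 + y ^ 2] for each [v], combined with [S1]. *)
  have h2 : (e * #|Rest|) * (e * #|Rest|) <= #|U| * SZ.
    have : \sum_(v in U) 2 * (#|U| * #|Zv v| * (e * #|Rest|)) <=
        \sum_(v in U) (#|U| * #|Zv v| * (#|U| * #|Zv v|) + e * #|Rest| * (e * #|Rest|)).
      apply: leq_sum => v _; have := (nat_Cauchy (#|U| * #|Zv v|) (e * #|Rest|)).
      by rewrite -!mulnn => -[].
    rewrite [X in _ <= X]big_split /= sum_nat_const.
    have -> : \sum_(v in U) #|U| * #|Zv v| * (#|U| * #|Zv v|) = #|U| * (#|U| * SZ).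
      by rewrite /SZ !big_distrr; apply: eq_bigr => v _ /=; move: #|U| #|Zv v| => x y; clear; lia.
    have -> : \sum_(v in U) 2 * (#|U| * #|Zv v| * (e * #|Rest|)) =
      #|U| * (2 * ((\sum_(v in U) #|Zv v|) * (e * #|Rest|))).
      rewrite big_distrl !big_distrr; apply: eq_bigr => v _ /=.
      move: #|U| #|Zv v| (e * _) => x y z; clear; lia.
    rewrite -mulnDr leq_pmul2l //.
    move: S1; move: (e * _) (\sum_(v in U) #|Zv v|) (_ * SZ) => x S y; clear; nia.
  move: h1 h2 S2 he hR r0 m0; move: SZ (\sum_(v in U) badv v) #|U| #|Rest| => SZ b m r; clear.
  move=> h1 h2 h3 he mr r0 m0.
  have h4 : 16 * (m * SZ) + m * m <= 256 * (m * b) + m * (m * (e * e)).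
    by have := leq_mul (leqnn m) h1; clear; lia.
  have h5 : m * b <= m * ((s + 2) * (r * r)) by rewrite leq_mul2l h3 orbT.
  have h6 : m * (m * (e * e)) <= 4 * (r * r * (e * e)).
    have : m * m <= 4 * (r * r) by have := leq_mul mr mr; clear; lia.
    move=> h; have := leq_mul h (leqnn (e * e)); clear; lia.
  have h7 : 32 * (s + 4) * m * (r * r) <= e * e * (r * r) by rewrite leq_mul2r he orbT.
  have h8 : e * r * (e * r) = e * e * (r * r) by rewrite mulnACA.
  have h9 : 0 < m * m by rewrite muln_gt0 m0.
  have h10 : 32 * (s + 4) * m * (r * r) = 32 * (m * ((s + 2) * (r * r))) + 64 * (m * (r * r)) by clear; lia.
  rewrite h8 in h2; move: h2 h4 h5 h6 h7 h9; rewrite h10.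
  rewrite (mulnC (e * e)); clear.
  move: (m * ((s + 2) * (r * r))) (m * (r * r)) (r * r * (e * e)) (m * m).
  by move: (m * (m * (e * e))) (m * SZ) (m * b) => *; lia.
set zt := #|Zv v| in hb hz.
have zt4 : e <= 4 * zt.
  by rewrite -leq_sqr -!mulnn; move: hz; clear; lia.
have zts : 8 * (s + 4) <= zt.
  suff : 32 * (s + 4) <= e by move: zt4; clear; lia.
  have : 32 * (s + 4) * #|U| <= e * #|U| by apply: leq_trans he _; rewrite leq_mul2l mge orbT.
  by rewrite leq_pmul2r.
(* Pruning: bad pairs number at most a sixteenth of [zt * zt], so at most a quarter of [Zv v] is bad
   with more than a quarter of it. *)
pose Z := [set z in Zv v | 4 * #|[set z' in Zv v | bad z z']| <= zt].
have cZ : 3 * zt <= 4 * #|Z|.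
  pose N := Zv v :\: Z.
  have hN : #|N| * zt <= 4 * badv v.
    rewrite -sum_nat_const /badv big_distrr /= [X in _ <= X](big_setID N) /=.
    have -> : Zv v :&: N = N by apply/setIidPr; exact: subsetDl.
    apply: leq_trans (leq_addr _ _); apply: leq_sum => z /setDP[zZ].
    by rewrite inE zZ /= -ltnNge => /ltnW.
  have : #|N| * 4 <= zt.
    have zt0 : 0 < zt by move: zts; clear; lia.
    rewrite -(leq_pmul2r zt0); move: hN hb; clear; lia.
  have : zt = #|N| + #|Z|.
    rewrite /zt -(cardsID Z (Zv v)) addnC; congr (_ + _).
    by congr #|pred_of_set _|; apply/setIidPr; apply/subsetP=> z; rewrite inE => /andP[].
  by clear; lia.
have ZR : Z \subset Rest.
  by apply/subsetP => z; rewrite !inE => /andP[/andP[]].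
exists Z => //; split; last by move: zt4 cZ; clear; lia.
split; first exact: subset_trans ZR RU.
move=> F Fs z z' zZ z'Z zz'.
have bz y : y \in Z -> 4 * #|[set y' in Zv v | bad y y']| <= zt by rewrite inE => /andP[].
(* After pruning, the vertices bad with [z] or with [z'] fill at most half of [Zv v]; the other
   half, of size at least [4 * (s + 4)], cannot be exhausted by [F], [z] and [z']. *)
have [m mZ] : exists2 m, m \in Zv v & m \notin F :|: [set z; z'] :|:
   ([set y in Zv v | bad z y] :|: [set y in Zv v | bad z' y]).
  apply/subsetPn/negP => /subset_leq_card; rewrite -/zt => h.
  have := leq_trans h (leq_of_leqif (leq_card_setU _ _)).
  have := leq_of_leqif (leq_card_setU F [set z; z']); rewrite cards2.
  have := leq_of_leqif (leq_card_setU [set y in Zv v | bad z y] [set y in Zv v | bad z' y]).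
  have := bz _ zZ; have := bz _ z'Z; move: zts Fs; clear; case: (z != z'); lia.
rewrite !in_setU !in_set1 !negb_or => /andP[/andP[mF /andP[mz mz']]].
rewrite [m \in [set y in Zv v | bad z y]]inE [m \in [set y in Zv v | bad z' y]]inE.
rewrite mZ /= => /andP[bzm bz'm].
have [w wC] : exists2 w, w \in nbr z :&: nbr m :&: U & w \notin z' |: F.
  apply/subsetPn/negP => /subset_leq_card h.
  move: bzm; rewrite /bad /codeg => /negP; apply; apply: leq_trans h _.
  by rewrite cardsU1; move: Fs; clear; case: (_ \notin _); lia.
rewrite in_setU1 negb_or => /andP[wz' wF].
have [w' w'C] : exists2 w', w' \in nbr z' :&: nbr m :&: U & w' \notin z |: (w |: F).
  apply/subsetPn/negP => /subset_leq_card h.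
  move: bz'm; rewrite /bad /codeg => /negP; apply; apply: leq_trans h _.
  by rewrite !cardsU1; move: Fs; clear; case: (_ \notin _); case: (_ \notin _); lia.
rewrite !in_setU1 !negb_or => /andP[w'z /andP[w'w w'F]].
move: wC w'C; rewrite !inE => /andP[/andP[zw mw] wU] /andP[/andP[z'w' mw'] w'U].
have mU : m \in U by rewrite (subsetP RU) //; move: mZ; rewrite inE => /andP[].
have neq x y : g x y -> x != y by apply: contraTneq => ->; rewrite girr.
exists w, m, w'; split.
- rewrite /= !inE !negb_or zz' wz' mz' (neq _ _ zw) (eq_sym z m) mz (eq_sym z w') w'z.
  by rewrite (eq_sym w m) (neq _ _ mw) (eq_sym w w') w'w (neq _ _ mw') (eq_sym w' z') (neq _ _ z'w').
- move=> x; rewrite !inE => /or3P[] /eqP->; by rewrite ?wF ?mF ?w'F.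
- by rewrite /= zw (gsym w) mw mw' gsym z'w'.
Qed.

(** Among the disjoint families of hubs with one inside every piece, take one with the largest
    union. If it covered less than half, [exists_hub] with [U] everything and [Rest] the uncovered
    part would add another hub. *)
Lemma hub_family (e s : nat) (P : {set {set T}}) :
  0 < e -> 32 * (s + 4) * #|T| <= e * e -> (forall u, e <= #|nbr u|) ->
  trivIset P -> (forall Q, Q \in P -> core_in g e Q) ->
  exists H : {set {set T}}, [/\ trivIset H,
    forall Z, Z \in H -> hub s setT Z /\ e <= 8 * #|Z|,
    forall Q, Q \in P -> exists2 Z, Z \in H & hub s Q Z &
    #|T| <= 2 * #|cover H|].
Proof.
move=> e0 he hdeg tP gP.
have hubQ Q : Q \in P -> exists Z, hub s Q Z /\ e <= 8 * #|Z|.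
  move=> /gP[U [UQ U0 dU]].
  have [||Z ZU [hZ cZ]] := exists_hub U0 (subxx U) _ dU (s := s).
  - by clear; lia.
  - by apply: leq_trans he; rewrite leq_mul2l max_card orbT.
  by exists Z; split=> //; exact: hub_sub UQ hZ.
pose f Q := odflt set0 [pick Z | `[< hub s Q Z /\ e <= 8 * #|Z| >] ].
have fP Q : Q \in P -> hub s Q (f Q) /\ e <= 8 * #|f Q|.
  move=> QP; rewrite /f; case: pickP => [Z /asboolP//|nZ].
  by have [Z /asboolP] := hubQ _ QP; rewrite nZ.
pose ok (H : {set {set T}}) := [&& trivIset H,
  [forall Z in H, `[< hub s setT Z /\ e <= 8 * #|Z| >] ] &
  [forall Q in P, exists Z in H, `[< hub s Q Z >] ] ].
have ok0 : ok (f @: P).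
  apply/and3P; split.
  - apply/trivIsetP => A B /imsetP[Q QP ->] /imsetP[Q' Q'P ->] ff'.
    have QQ' : Q != Q' by apply: contra_neq ff' => ->.
    apply: disjointWl (proj1 (proj1 (fP _ QP))) _.
    apply: disjointWr (proj1 (proj1 (fP _ Q'P))) _.
    exact: (trivIsetP tP).
  - apply/forall_inP => Z /imsetP[Q QP ->]; apply/asboolP.
    by have [hQ cQ] := fP _ QP; split=> //; exact: hub_sub (subsetT _) hQ.
  - apply/forall_inP => Q QP; apply/exists_inP; exists (f Q); first exact: imset_f.
    by apply/asboolP; have [] := fP _ QP.
case: (arg_maxnP (fun H : {set {set T}} => #|cover H|) ok0) =>
  H /and3P[tH /forall_inP hH /forall_inP hP] Hmax.
exists H; split=> //.
- by move=> Z /hH/asboolP.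
- by move=> Q /hP/exists_inP[Z ZH /asboolP hZ]; exists Z.
rewrite leqNgt; apply/negP => hlt.
set R := ~: cover H.
have cR : #|cover H| + #|R| = #|T| by rewrite cardsC.
have T0 : [set: T] != set0 by rewrite -card_gt0 cardsT; move: hlt; clear; lia.
have [|||Z ZR [hZ cZ]] := exists_hub T0 (subsetT R) (e := e) (s := s).
- by rewrite cardsT; move: hlt cR; clear; lia.
- by move=> u _; rewrite setIT.
- by rewrite cardsT.
have Zc : [disjoint Z & cover H] by rewrite disjoints_subset.
have Z0 : 0 < #|Z| by move: e0 cZ; clear; lia.
have ZH X : X \in H -> [disjoint Z & X].
  by move=> XH; apply: disjointWr Zc; exact: bigcup_sup.
have okZ : ok (Z |: H).
  apply/and3P; split.
  - apply/trivIsetP => X Y /setU1P[->|XH] /setU1P[->|YH] XY.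
    + by rewrite eqxx in XY.
    + exact: ZH.
    + by rewrite disjoint_sym; exact: ZH.
    + exact: (trivIsetP tH).
  - by apply/forall_inP => X /setU1P[->|/hH//]; apply/asboolP.
  - apply/forall_inP => Q /hP/exists_inP[X XH hX]; apply/exists_inP; exists X => //.
    by rewrite setU1r.
have /= := Hmax _ okZ; rewrite leqNgt => /negP; apply; apply: proper_card.
apply/properP; split.
  by apply/subsetP => x /bigcupP[X XH xX]; apply/bigcupP; exists X => //; rewrite setU1r.
case/card_gt0P: Z0 => z zZ; exists z; last by rewrite (disjointFr Zc zZ).
by apply/bigcupP; exists Z => //; rewrite setU11.
Qed.

End Hubs.

(** * Ladders and short cycles *)

Section Ladders.
Variables (T : finType) (g : rel T).
Hypotheses (gsym : symmetric g) (girr : irreflexive g).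
Local Notation nbr := (nbr g).

Definition alpha_le (a : nat) : Prop :=
  forall S : {set T}, a < #|S| -> exists x y, [/\ x \in S, y \in S & g x y].

Definition cycle_of_length (h : rel T) (l : nat) : Prop :=
  exists c : seq T, [/\ cycle h c, uniq c & size c = l].

Lemma exists_longest (ok : seq T -> Prop) :
  (forall c, ok c -> uniq c) -> (exists c, ok c) ->
  exists2 c, ok c & forall c', ok c' -> size c' <= size c.
Proof.
move=> okU [c0 ok0].
pose has_size m := `[< exists2 c, ok c & size c = m >].
have ex : exists m, has_size m by exists (size c0); apply/asboolP; exists c0.
have bnd m : has_size m -> m <= #|T|.
  by case/asboolP => c /okU /card_uniqP <- <-; exact: max_card.
case: (ex_maxnP ex bnd) => m /asboolP[c okc <-] cmax.
by exists c => // c' okc'; apply: cmax; apply/asboolP; exists c'.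
Qed.

(** Remove a longest path, which has at most [k] vertices unless the first alternative holds. Its
    first vertex has no neighbour in what remains, so it can be added to the independent set found
    there by induction. *)
Lemma indep_or_path (k : nat) (S : {set T}) :
  (exists x q, [/\ path g x q, uniq (x :: q), {subset x :: q <= S} & size q = k]) \/
  exists I : {set T}, [/\ I \subset S, {in I &, forall x y, ~~ g x y} & #|S| <= k * #|I|].
Proof.
have [m] := ubnP #|S|; elim: m S => // m IH S Sm.
have [->|[x xS]] := set_0Vmem S.
  by right; exists set0; rewrite sub0set cards0; split=> // x y; rewrite inE.
pose ok c := if c is y :: q then [&& path g y q, uniq c & all (mem S) c] else false.
have [||[//|y q] /and3P[pq uq /allP sq] cmax] := @exists_longest ok.
- by case=> // y q /and3P[].
- by exists [:: x]; rewrite /= xS.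
have {}sq : {subset y :: q <= S} by move=> z /sq.
have [kq|qk] := leqP k (size q).
  left; exists y, (take k q); split.
  - exact: take_path.
  - have -> : y :: take k q = take k.+1 (y :: q) by []. exact: take_uniq.
  - by move=> z; rewrite inE => /predU1P[->|/mem_take zq]; apply: sq; rewrite inE ?eqxx ?zq ?orbT.
  - by rewrite size_takel.
set C := [set z in y :: q].
have CS : C \subset S by apply/subsetP => z; rewrite inE; exact: sq.
have cC : #|C| = (size q).+1 by rewrite cardsE; exact/card_uniqP.
have [|[x' [q' [? ? sq' ?]]]|[I [IS Ii cI]]] := IH (S :\: C).
- have := cardsD S C; have := subset_leq_card CS; rewrite (setIidPr CS) cC.
  by move: Sm; clear; lia.
- left; exists x', q'; split=> // z /sq'; by rewrite inE => /andP[].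
right; exists (y |: I); split.
- by rewrite subUset sub1set (sq y) ?mem_head //= (subset_trans IS) // subsetDl.
- have hy z : z \in I -> ~~ g y z.
    move=> zI; have := subsetP IS _ zI; rewrite !inE => /andP[/norP[zy zq] zS].
    apply/negP => yz; suff /cmax : ok (z :: y :: q) by rewrite /= ltnn.
    rewrite /ok /= gsym yz pq /= inE (negPf zy) (negPf zq) /=.
    have := uq; rewrite /= => -> /=; by rewrite zS (sq y) ?mem_head //=; apply/allP => u uq'; apply: sq; rewrite inE uq' orbT.
  move=> u v /setU1P[->|uI] /setU1P[->|vI]; rewrite ?girr ?hy // 1?gsym ?hy //.
  exact: Ii.
- have yI : y \notin I by apply/negP => /(subsetP IS); rewrite !inE eqxx.
  rewrite cardsU1 yI /= mulnDr muln1.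
  have := cardsD S C; rewrite (setIidPr CS) cC.
  by have := subset_leq_card CS; rewrite cC; move: cI qk; clear; lia.
Qed.

Lemma long_path (a k : nat) (S : {set T}) : alpha_le a -> k * a < #|S| ->
  exists x q, [/\ path g x q, uniq (x :: q), {subset x :: q <= S} & size q = k].
Proof.
move=> ha hS; case: (indep_or_path k S) => // -[I [_ Ii cI]].
have [/ha [x [y [xI yI xy]]]|Ia] := ltnP a #|I|; first by have := Ii x y xI yI; rewrite xy.
have : k * #|I| <= k * a by rewrite leq_mul2l Ia orbT.
by move: cI hS; clear; lia.
Qed.

(** A path on [l.+1] vertices inside the neighbourhood of [v] closes up through [v]. *)
Lemma fan_cycle (a l : nat) (v : T) : alpha_le a -> l * a < #|nbr v| ->
  cycle_of_length g l.+2.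
Proof.
move=> ha /(long_path ha)[x [q [pq uq sq <-]]].
exists (v :: x :: q); split=> //; last first.
  rewrite cons_uniq uq andbT.
  by apply/negP => /sq; rewrite in_nbr girr.
rewrite /cycle rcons_path; apply/andP; split.
  by rewrite /= pq andbT -in_nbr sq ?mem_head.
by rewrite gsym -in_nbr sq //= mem_last.
Qed.

Section InHub.
Variables (a e s : nat) (Z : {set T}).
Hypotheses (ha : alpha_le a) (e0 : 0 < e) (as_ : a <= s).
Hypothesis he : 32 * (s + 4) * #|T| <= e * e.
Hypothesis hdeg : forall u, 4 * e <= #|nbr u|.
Hypotheses (hZ : hub g s setT Z) (cZ : e <= 8 * #|Z|).

(** Counting edges between [Z] and the complement of [F] gives a [w] outside [F] with more than
    [a + s] neighbours in [Z]; more than [a] of them avoid [F], and these span an edge. *)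
Lemma triangle_in_hub (F : {set T}) : #|F| <= s ->
  exists w x y, [/\ w \notin F, x \in Z :\: F, y \in Z :\: F & [&& g w x, g w y & g x y]].
Proof.
move=> Fs.
have Z0 : 0 < #|Z| by move: e0 cZ; clear; lia.
have se : 32 * (s + 4) <= e.
  have n0 : 0 < #|T| by apply: leq_trans Z0 (max_card _).
  have en : e <= #|T|.
    case/card_gt0P: n0 => u _; apply: leq_trans (_ : #|nbr u| <= _); last exact: max_card.
    by move: (hdeg u); clear; lia.
  rewrite -(leq_pmul2r n0); apply: leq_trans he _; by rewrite leq_mul2l en orbT.
have [w wF hw] : exists2 w, w \in ~: F & a + s < #|nbr w :&: Z|.
  apply/exists_inP; apply: contraT; rewrite negb_exists_in => /forall_inP hn.
  have h1 : \sum_(w in ~: F) #|nbr w :&: Z| <= #|T| * (a + s).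
    apply: leq_trans (_ : \sum_(w in ~: F) (a + s) <= _).
      by apply: leq_sum => w /hn; rewrite -leqNgt.
    by rewrite sum_nat_const leq_mul2r max_card orbT.
  have h2 : #|Z| * (3 * e) <= #|T| * (a + s).
    apply: leq_trans h1; rewrite sum_card_setI // -sum_nat_const; apply: leq_sum => z _.
    rewrite -setDE; have := cardsID F (nbr z); have := hdeg z.
    by have := subset_leq_card (subsetIr (nbr z) F); move: Fs se; clear; lia.
  have h3 : e * (3 * e) <= 8 * #|Z| * (3 * e) by rewrite leq_mul2r cZ orbT.
  have h4 : #|T| * (a + s) <= #|T| * (2 * s) by rewrite leq_mul2l; move: as_; clear; lia.
  have h5 : 0 < e * e by rewrite muln_gt0 e0.
  by move: he h2 h3 h4 h5; clear; lia.
have [|x [y [xS yS xy]]] := ha (S := (nbr w :&: Z) :\: F).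
  have := cardsID F (nbr w :&: Z); have := subset_leq_card (subsetIr (nbr w :&: Z) F).
  by move: hw Fs; clear; lia.
exists w, x, y; move: wF xS yS; rewrite !inE => -> /and3P[-> -> ->] /and3P[-> -> ->].
by rewrite xy.
Qed.

(** The ladder has [r.+1] triangles joined by [r] links of three vertices, hence [6 * r + 3]
    vertices. A path crosses each triangle along one edge or by way of its third vertex [w]; [t]
    counts these detours. *)
Lemma ladder (r : nat) (F : {set T}) : #|F| + 6 * r.+1 <= s ->
  exists x y (D : {set T}), [/\ x \in Z, y \in Z, [disjoint D & F], #|D| = 6 * r + 3 &
    forall t, t <= r.+1 -> exists q, [/\ path g x q, last x q = y, uniq (x :: q),
      {subset x :: q <= D} & size (x :: q) = 5 * r + 2 + t]].
Proof.
elim: r => [|r IH] hF.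
  have [|w [x [y [wF xZ yZ /and3P[wx wy xy]]]]] := triangle_in_hub (F := F).
    by move: hF; clear; lia.
  move: xZ yZ; rewrite !inE => /andP[xF xZ] /andP[yF yZ].
  have neq u v : g u v -> u != v by apply: contraTneq => ->; rewrite girr.
  have xw : x != w by rewrite eq_sym neq.
  have U : uniq [:: x; w; y] by rewrite /= !inE negb_or xw !neq.
  exists x, y, [set z in [:: x; w; y]]; split=> //.
  - rewrite disjoint_subset; apply/subsetP => z; rewrite !inE.
    by case/or3P => /eqP->.
  - by rewrite cardsE; exact/card_uniqP.
  case=> [|[|//]] _.
    exists [:: y]; split=> //=; rewrite ?xy ?inE ?neq //.
    by move=> z; rewrite !inE => /orP[] /eqP->; rewrite eqxx ?orbT.
  exists [:: w; y]; split=> //=; first by rewrite gsym wx wy.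
  by move=> z; rewrite !inE.
have [|x [y [D [xZ yZ DF cD hq]]]] := IH; first by move: hF; clear; lia.
have yD : y \in D.
  have [//|q [_ <- _ sq _]] := hq 0; exact: sq (mem_last _ _).
have [|w [b [c [wF bZ cZ' /and3P[wb wc bc]]]]] := triangle_in_hub (F := F :|: D).
  by rewrite cardsU cD; move: hF; clear; lia.
move: wF bZ cZ'; rewrite !inE !negb_or => /andP[wF wD] /andP[/andP[bF bD] bZ] /andP[/andP[cF cD'] cZ'].
have yb : y != b by apply: contraNneq bD => <-.
pose F' := F :|: D :|: [set z in [:: b; w; c]].
have F's : #|F'| <= s.
  have h1 : #|[set z in [:: b; w; c]]| <= 3 by rewrite cardsE; exact: card_size.
  have h2 : #|F :|: D| <= #|F| + #|D| by rewrite cardsU; clear; lia.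
  rewrite /F' cardsU; move: h1 h2 hF; rewrite cD; clear; lia.
have [l1 [l2 [l3 [lu ls lp]]]] := (proj2 hZ) F' F's y b yZ bZ yb.
have neq u v : g u v -> u != v by apply: contraTneq => ->; rewrite girr.
have lF z : z \in [:: l1; l2; l3] -> [&& z \notin F, z \notin D & z \notin [:: b; w; c]].
  move/ls/setDP => [_]; rewrite /F' !in_setU !negb_or -andbA => /and3P[-> ->].
  by rewrite in_set !inE !negb_or andbT.
pose N := [:: l1; l2; l3; b; w; c].
have Nu : uniq N.
  have -> : N = [:: l1; l2; l3] ++ [:: b; w; c] by [].
  rewrite cat_uniq; apply/and3P; split.
  - by move: lu; rewrite /= !inE !negb_or => /andP[_ /andP[/and3P[-> -> _]]] /andP[/andP[-> _] _].
  - by apply/hasPn => z zb; apply: contraTN zb => /lF/and3P[].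
  - by rewrite /= !inE negb_or (neq b c) // (neq w c) // eq_sym neq.
have ND z : z \in N -> (z \notin F) && (z \notin D).
  have -> : N = [:: l1; l2; l3] ++ [:: b; w; c] by [].
  rewrite mem_cat => /orP[/lF/and3P[-> ->] //|].
  by rewrite !inE => /or3P[] /eqP->; rewrite ?bF ?bD ?wF ?wD ?cF ?cD'.
exists x, c, (D :|: [set z in N]); split=> //.
- rewrite disjoints_subset subUset -disjoints_subset DF /=.
  by apply/subsetP => z; rewrite !in_set => /ND/andP[].
- rewrite cardsU (_ : D :&: _ = set0) ?cards0; last first.
    apply/setP => z; rewrite in_setI in_set0; apply/negP => /andP[zD].
    by rewrite inE => /ND/andP[_]; rewrite zD.
  by rewrite cD cardsE (card_uniqP Nu) /=; clear; lia.
have ext q ms : path g x q -> last x q = y -> uniq (x :: q) -> {subset x :: q <= D} ->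
    subseq ms N -> path g y ms -> last y ms = c ->
    exists q', [/\ path g x q', last x q' = c, uniq (x :: q'),
      {subset x :: q' <= D :|: [set z in N]} & size (x :: q') = size (x :: q) + size ms].
  move=> pq lq uq sq sub pm lm; exists (q ++ ms); split.
  - by rewrite cat_path pq lq.
  - by rewrite last_cat lq.
  - rewrite -cat_cons cat_uniq uq (subseq_uniq sub Nu) andbT /=.
    apply/hasPn => z /(mem_subseq sub)/ND/andP[_ zD]; by apply: contra zD => /sq.
  - move=> z; rewrite -cat_cons mem_cat in_setU => /orP[/sq->//|/(mem_subseq sub)].
    by rewrite [in X in _ || X]inE => ->; rewrite orbT.
  - by rewrite /= size_cat.
move: lp; rewrite [path _ _ _]/= andbT => /and4P[yl1 l12 l23 l3b].
move=> t ht; have [tr|rt] := leqP t r.+1.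
  have [q [pq lq uq sq cq]] := hq t tr.
  have [|||q' [? ? ? ? cq']] := ext q [:: l1; l2; l3; b; c] pq lq uq sq.
  - exact: (cat_subseq (subseq_refl [:: l1; l2; l3; b]) (subseq_cons [:: c] w)).
  - by rewrite /= yl1 l12 l23 l3b bc.
  - by [].
  exists q'; split=> //; rewrite cq' cq /=; clear; lia.
have [q [pq lq uq sq cq]] := hq r.+1 (leqnn _).
have [|||q' [? ? ? ? cq']] := ext q N pq lq uq sq.
- exact: subseq_refl.
- by rewrite /= yl1 l12 l23 l3b gsym wb wc.
- by [].
exists q'; split=> //; rewrite cq' cq /N /=; move: ht rt; clear; lia.
Qed.

(** A ladder of [m = r.+1] triangles closed by one more link gives every length from [5 * m] to
    [6 * m]. The choice [m = (l + 5) %/ 6] puts [l] in this range as soon as [25 <= l]. *)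
Lemma closed_ladder_cycle (l : nat) : 25 <= l -> l + 15 <= s -> cycle_of_length g l.
Proof.
move=> l25 ls; pose r := (l + 5) %/ 6 - 1.
have [|x [y [D [xZ yZ _ cD hq]]]] := ladder (r := r) (F := set0).
  by rewrite cards0 /r; move: ls l25; clear; lia.
have [|q [pq lq uq sq cq]] := hq (l - 5 * r.+1); first by rewrite /r; move: l25; clear; lia.
have xy : y != x.
  apply: contraTneq uq => yx; move: pq lq cq; case: (q) => [|z q'] /=.
    by rewrite /r; move: l25; clear; lia.
  by move=> _ lz _; have -> : x \in z :: q' by rewrite -yx -lz mem_last.
have Ds : #|D| <= s by rewrite cD /r; move: ls l25; clear; lia.
have [l1 [l2 [l3 [lu lsub lp]]]] := (proj2 hZ) D Ds y x yZ xZ xy.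
exists (x :: q ++ [:: l1; l2; l3]); split.
- rewrite /cycle rcons_cat cat_path pq lq.
  exact: lp.
- rewrite -cat_cons cat_uniq uq; apply/and3P; split=> //.
    apply/hasPn => z /lsub; rewrite inE => /andP[zD _]; by apply: contra zD => /sq.
  by move: lu; rewrite /= !inE !negb_or => /andP[_ /andP[/and3P[-> -> _]]] /andP[/andP[-> _] _].
- move: cq; rewrite /= size_cat /= /r; move: l25; clear; lia.
Qed.

End InHub.

End Ladders.

(** * Extending and shortening cycles through a ladder *)

Section Routes.
Variables (T : finType) (g h : rel T).
Hypotheses (gsym : symmetric g) (girr : irreflexive g).
Hypotheses (hsym : symmetric h) (gh : subrel g h).
Variables (D : {set T}) (b d : T).
Local Notation nbr := (nbr g).

(* Together with any path from [d] to [b] inside [D], a route closes up to a cycle. *)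
Definition route (c : seq T) : Prop :=
  [/\ path h b (rcons c d), uniq c & {in c, forall z, z \notin D}].

(** Two consecutive vertices are asked for because the step between them is what a detour through
    [Q] replaces. *)
Definition touches (Q : {set T}) (c : seq T) : Prop :=
  exists c1 u v c2, [/\ c = c1 ++ u :: v :: c2, u \in Q & v \in Q].

Lemma path_subrel x q : path g x q -> path h x q.
Proof. exact: sub_path. Qed.

Section Extend.
Variables (P : {set {set T}}) (a s : nat).
Hypotheses (tP : trivIset P) (covP : cover P = [set: T]).
Hypotheses (robP : forall Q, Q \in P -> robust g s Q).
Hypothesis (Das : #|D| + a + 2 <= s).

(** If a longest route touching every piece met [Q] in at most [a + 1] vertices, robustness would
    join a neighbour of [u] to a neighbour of [v] inside [Q], off [D] and off the route, and
    inserting this path between [u] and [v] would lengthen the route. *)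
Lemma thicken_route c0 :
  (forall Q u, Q \in P -> u \in Q -> s < #|nbr u :&: Q|) ->
  route c0 -> (forall Q, Q \in P -> touches Q c0) ->
  exists2 c, route c & forall Q, Q \in P -> a + 2 <= #|[set z in c] :&: Q|.
Proof.
move=> degP rc0 tc0.
pose ok c := route c /\ forall Q, Q \in P -> touches Q c.
have [||c [rc tc] cmax] := @exists_longest _ ok.
- by move=> c [[]].
- by exists c0.
exists c => // Q QP; rewrite leqNgt; apply/negP => cQ.
pose F := D :|: ([set z in c] :&: Q).
have Fs : #|F| <= s by rewrite /F cardsU; move: cQ Das; clear; lia.
have [c1 [u [v [c2 [cE uQ vQ]]]]] := tc Q QP.
have out x : x \in Q -> exists2 w, g x w & w \in Q :\: F.
  move=> xQ; have [w /setIP[xw wQ] wF] : exists2 w, w \in nbr x :&: Q & w \notin F.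
    by apply/subsetPn/negP => /subset_leq_card; have := degP Q x QP xQ; move: Fs; clear; lia.
  by exists w; rewrite -?in_nbr // inE wF.
have [w uw wW] := out u uQ; have [w' vw' w'W] := out v vQ.
have [p [pp lp up sp]] := connect_within_path wW (robP QP Fs wW w'W).
have pQ z : z \in w :: p -> [&& z \in Q, z \notin D & z \notin c].
  by move=> /sp; rewrite !inE; case: (z \in D) (z \in c) (z \in Q) => -[] [].
have [pc uc Dc] := rc.
suff /cmax : ok (c1 ++ u :: (w :: p) ++ v :: c2).
  by rewrite cE !size_cat /= !size_cat /=; clear; lia.
split.
  split.
  - move: pc; rewrite cE !rcons_cat /= !cat_path /= rcons_cat cat_path /=.
    case/and3P=> -> -> /andP[uv ->]; rewrite (gh uw) (path_subrel pp) lp /= hsym (gh vw') //.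
  - have Pm : perm_eq (c1 ++ u :: (w :: p) ++ v :: c2) (c ++ w :: p).
      by rewrite cE -catA perm_cat2l /= perm_cons; exact: permEl (perm_catC (w :: p) (v :: c2)).
    rewrite (perm_uniq Pm) cat_uniq uc up andbT andTb.
    by apply/hasPn => z /pQ/and3P[].
  - move=> z; rewrite mem_cat inE mem_cat => /or3P[zc1|zu|/orP[/pQ/and3P[]//|zc2]]; apply: Dc.
    + by rewrite cE mem_cat zc1.
    + by rewrite cE mem_cat !inE zu orbT.
    + by rewrite cE mem_cat inE zc2 !orbT.
move=> Q' Q'P; have [QQ'|QQ'] := eqVneq Q' Q.
  exists c1, u, w, (p ++ v :: c2); split=> //; rewrite QQ' //.
  by have /and3P[] := pQ w (mem_head _ _).
have [d1 [x [y [d2 [dE xQ yQ]]]]] := tc Q' Q'P.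
have nQ z : z \in Q -> z \in Q' -> False.
  move=> zQ zQ'; have := (trivIsetP tP) _ _ Q'P QP QQ'.
  by move=> /disjointFr /(_ zQ'); rewrite zQ.
(* the pair (x, y) sits entirely before or entirely after the replaced edge (u, v) *)
have [sz|sz] := leqP (size d1).+2 (size c1).+1.
  have : take (size d1).+2 (c1 ++ [:: u]) = d1 ++ [:: x; y].
    have := congr1 (take (size d1).+2) dE; rewrite cE.
    rewrite -[u :: v :: c2]/([:: u] ++ v :: c2) catA takel_cat ?size_cat ?addn1 // => ->.
    by rewrite -[x :: y :: d2]/([:: x; y] ++ d2) catA take_size_cat // size_cat addn2.
  move=> tk; exists d1, x, y, (drop (size d1).+2 (c1 ++ [:: u]) ++ (w :: p) ++ v :: c2); split=> //.
  rewrite -[x :: y :: _]/([:: x; y] ++ _) catA -tk catA cat_take_drop.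
  by rewrite -catA.
have [sz'|sz'] := leqP (size c1).+1 (size d1).
  have : drop (size c1).+1 (d1 ++ x :: y :: d2) = v :: c2.
    by rewrite -dE cE -cat_rcons drop_size_cat // size_rcons.
  rewrite drop_cat; case: ltnP => [lt|ge].
    move=> dd; exists (c1 ++ u :: (w :: p) ++ drop (size c1).+1 d1), x, y, d2; split=> //.
    by rewrite -dd -!catA /= -!catA.
  have -> : (size c1).+1 - size d1 = 0 by move: sz' ge; clear; lia.
  rewrite drop0 => dd; exists (c1 ++ u :: (w :: p)), x, y, d2; split=> //.
  by rewrite -dd -!catA.
have sd : size d1 = size c1 by move: sz sz'; clear; lia.
have := congr1 (fun c => nth x c (size c1)) dE.
by rewrite cE nth_cat ltnn subnn /= -sd nth_cat ltnn subnn /= => ux; case: (nQ u uQ); rewrite ux.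
Qed.

(** Isolates the steps after positions [i] and [j], the two that a rerouting removes; [i < j] makes
    the segment in between nonempty. *)
Lemma split_at (z0 : T) (c : seq T) i j : i < j -> j.+1 < size c ->
  exists c1 M c2, [/\ c = c1 ++ nth z0 c i :: (nth z0 c i.+1 :: M) ++ nth z0 c j.+1 :: c2 &
    last (nth z0 c i.+1) M = nth z0 c j].
Proof.
move=> ij jc; exists (take i c), (take (j - i.+1) (drop i.+2 c)), (drop j.+2 c).
have e1 : nth z0 c i.+1 :: take (j - i.+1) (drop i.+2 c) = take (j - i) (drop i.+1 c).
  rewrite [in RHS](drop_nth z0); last by move: ij jc; clear; lia.
  by have -> : j - i = (j - i.+1).+1 by move: ij; clear; lia.
split.
  have e2 : take (j - i) (drop i.+1 c) ++ drop j.+1 c = drop i.+1 c.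
    rewrite -[RHS](cat_take_drop (j - i)) drop_drop; congr (_ ++ drop _ _).
    by move: ij; clear; lia.
  rewrite e1 -(drop_nth z0) // e2 -drop_nth ?cat_take_drop //; move: ij jc; clear; lia.
have := congr1 (last z0) e1; rewrite /= => ->.
rewrite (last_nth z0); case E : (take (j - i) (drop i.+1 c)) => [|y l]; first by rewrite E in e1.
have sz : size (take (j - i) (drop i.+1 c)) = j - i.
  by rewrite size_takel // size_drop; move: ij jc; clear; lia.
rewrite /= in sz *; rewrite E /= in sz.
have -> : nth z0 (y :: l) (size l) = nth z0 (take (j - i) (drop i.+1 c)) (size l) by rewrite E.
rewrite nth_take; last by rewrite -sz.
by rewrite nth_drop; congr nth; move: sz ij; clear; lia.
Qed.

Hypothesis ha : alpha_le g a.

(* Chvatal-Erdos: the successors on [c] of the attachment points of a component avoiding [c]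
   contain an edge, along which [c] is rerouted through the component. *)
Lemma spanning_route c0 : route c0 ->
  (forall Q, Q \in P -> a + 2 <= #|[set z in c0] :&: Q|) ->
  exists2 c, route c & forall z, z \notin D -> z \in c.
Proof.
move=> rc0 tc0.
pose ok c := route c /\ forall Q, Q \in P -> a + 2 <= #|[set z in c] :&: Q|.
have [||c [rc tc] cmax] := @exists_longest _ ok.
- by move=> c [[]].
- by exists c0.
exists c => // v vD; apply: contraT => vc.
have [Q QP vQ] : exists2 Q, Q \in P & v \in Q.
  by apply/bigcupP; rewrite -/(cover P) covP inE.
pose W := Q :\: (D :|: [set z in c]).
have vW : v \in W by rewrite !inE (negPf vD) (negPf vc).
pose H := [set z | connect (within g W) v z].
have HW z : z \in H -> z \in W by rewrite inE; exact: connect_within_in.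
have Hc z z' : z \in H -> z' \in W -> g z z' -> z' \in H.
  move=> zH z'W zz'; move: (zH); rewrite [z \in H]inE [z' \in H]inE => vz.
  by apply: connect_trans vz (connect1 _); rewrite /within /= z'W zz' HW.
pose X := [set x in [set z in c] :&: Q | [exists y in H, g y x]].
(* With at most [a + 1] attachment points, [D :|: X] would have size at most [s] and separate [v]
   from a vertex of the route in [Q] outside [X], against robustness. *)
have cX : a + 2 <= #|X|.
  rewrite leqNgt; apply/negP => Xs.
  pose F := D :|: X.
  have Fs : #|F| <= s by rewrite /F cardsU; move: Xs Das; clear; lia.
  have [y yc yX] : exists2 y, y \in [set z in c] :&: Q & y \notin X.
    by apply/subsetPn/negP => /subset_leq_card; have := tc Q QP; move: Xs; clear; lia.
  have vF : v \in Q :\: F by rewrite !inE vQ (negPf vD) (negPf vc).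
  have yF : y \in Q :\: F.
    rewrite in_setD in_setU negb_or yX andbT; move: yc; rewrite !inE => /andP[yc ->].
    by rewrite andbT; have [_ _] := rc; apply.
  have [p [pp lp _ sp]] := connect_within_path vF (robP QP Fs vF yF).
  have inH : {subset v :: p <= H}.
    have vH : v \in H by rewrite inE connect0.
    elim: p (v) vH pp {lp} sp => [|z p IH] u uH /=.
      by move=> _ _ w; rewrite inE => /eqP->.
    case/andP=> uz pp sp.
    have zH : z \in H.
      have zp : z \in u :: z :: p by rewrite !inE eqxx orbT.
      have /setDP[zQ] := sp _ zp; rewrite in_setU negb_or => /andP[zD zX].
      apply: (Hc _ _ uH _ uz); rewrite !inE (negPf zD) zQ andbT /=.
      apply: contra zX => zc; rewrite !inE zc zQ /=.
      by apply/exists_inP; exists u.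
    move=> w; rewrite inE => /predU1P[->//|]; apply: IH => // w' w'p; apply: sp.
    by rewrite inE w'p orbT.
  have yH : y \in H by apply: inH; rewrite -lp mem_last.
  by move: (HW _ yH) yc; rewrite !inE => /andP[/norP[_ /negPf->]].
pose n := size c.
(* The last vertex of [c] is left out, its successor being the fixed end [d]; hence [a + 2]
   attachment points, not [a + 1]. *)
pose I := [set i : 'I_n | (i.+1 < n) && (nth b c i \in X)].
have cI : a < #|I|.
  pose J := [set i : 'I_n | nth b c i \in X].
  have XJ : #|X| <= #|J|.
    apply: leq_trans (leq_imset_card (fun i : 'I_n => nth b c i) J).
    apply/subset_leq_card/subsetP => x xX.
    have xc : x \in c by move: xX; rewrite !inE => /andP[/andP[]].
    have xi : index x c < n by rewrite index_mem.
    apply/imsetP; exists (Ordinal xi); last by rewrite /= nth_index.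
    by rewrite inE /= nth_index.
  have JI : #|J :\: I| <= 1.
    apply/card_le1_eqP => i j; rewrite !inE.
    case/andP=> hi hJ /andP[hj hK]; apply/val_inj => /=; move: hi hj; rewrite hJ hK !andbT.
    by have := ltn_ord i; have := ltn_ord j; clear; lia.
  have := cardsID I J; have := subset_leq_card (subsetIr J I).
  by move: cX XJ JI; clear; lia.
have uc : uniq c by have [] := rc.
have inj : {in I &, injective (fun i : 'I_n => nth b c i.+1)}.
  move=> i j; rewrite !inE => /andP[hi _] /andP[hj _] /eqP; rewrite nth_uniq // => /eqP [] ?.
  exact: val_inj.
have [|x' [y' [/imsetP[i iI ->] /imsetP[j jI ->] xy]]] :=
  ha (S := [set nth b c (i : 'I_n).+1 | i in I]).
  by rewrite card_in_imset.
wlog ij : i j iI jI xy / i < j.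
  move=> W1; case: (ltngtP i j) => [ij|ji|ij]; first exact: (W1 i j).
    by apply: (W1 j i) => //; rewrite gsym.
  by move: xy; rewrite ij girr.
move: iI jI; rewrite !inE => /and3P[hi /andP[_ xQ] /exists_inP[hx hxH xhx]].
case/and3P=> hj /andP[_ yQ] /exists_inP[hy hyH yhy].
have [c1 [M [c2 [cE lM]]]] := split_at b ij hj.
set x := nth b c i in cE xQ xhx; set y := nth b c j in yQ yhy lM.
set x1 := nth b c i.+1 in cE xy lM; set y1 := nth b c j.+1 in cE xy.
have hh : connect (within g W) hx hy.
  apply: connect_trans (_ : connect _ _ v) _; last by rewrite inE in hyH.
  by rewrite (sym_connect_sym (within_sym gsym _)); rewrite inE in hxH.
have [p [pp lp up sp]] := connect_within_path (HW _ hxH) hh.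
have pW z : z \in hx :: p -> [&& z \in Q, z \notin D & z \notin c].
  by move=> /sp; rewrite !inE; case: (z \in D) (z \in c) (z \in Q) => -[] [].
have [pc _ Dc] := rc.
(* From [x] through the component to [y], back along [c] to [x1], then over the chord to [y1]. *)
pose c' := c1 ++ x :: (hx :: p) ++ rev (x1 :: M) ++ y1 :: c2.
have Pm : perm_eq c' (c ++ hx :: p).
  rewrite cE /c' -catA perm_cat2l /= perm_cons.
  apply: perm_trans (permEl (perm_catC (hx :: p) (rev (x1 :: M) ++ y1 :: c2))) _.
  rewrite -[X in perm_eq _ X]/(((x1 :: M) ++ y1 :: c2) ++ hx :: p).
  by rewrite perm_cat2r perm_cat2r perm_rev.
suff /cmax : ok c' by rewrite (perm_size Pm) size_cat /=; clear; lia.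
split; last first.
  move=> Q' Q'P; apply: leq_trans (tc Q' Q'P) _; apply/subset_leq_card/setSI.
  by apply/subsetP => z; rewrite !in_set (perm_mem Pm) mem_cat => ->.
split; last first.
- move=> z; rewrite (perm_mem Pm) mem_cat => /orP[|/pW/and3P[]//]; exact: Dc.
- by rewrite (perm_uniq Pm) cat_uniq uc up andbT andTb; apply/hasPn => z /pW/and3P[].
move: pc; rewrite cE /c' !rcons_cat /= !cat_path /= !rcons_cat !cat_path /=.
case/and5P=> -> -> xx1 pM /andP[yy1 ->].
have hx' : h x hx by rewrite hsym; exact: gh.
rewrite hx' (path_subrel pp) lp /= rev_cons.
have prev : path h hy (rcons (rev M) x1).
  have : path h x1 (rcons M hy) by rewrite rcons_path pM lM hsym; exact: gh.
  rewrite -rev_path; rewrite -(eq_path (e := h)); last by move=> ? ?; rewrite /= hsym.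
  by rewrite last_rcons belast_rcons rev_cons.
by rewrite prev last_rcons gh.
Qed.

End Extend.

(** Two of the [a.+1] vertices at positions [0, 2, ..., 2 * a] are adjacent. Even positions are
    never consecutive, so the chord skips at least one vertex. *)
Lemma shorten_route (a : nat) c : alpha_le g a -> route c -> 2 * a + 2 < size c ->
  exists c', [/\ route c', size c' < size c & size c <= size c' + (2 * a + 1)].
Proof.
move=> ha [pc uc Dc] sc.
pose f (i : 'I_a.+1) := nth b c (2 * i).
have hi (i : 'I_a.+1) : 2 * i < size c by have := ltn_ord i; move: sc; clear; lia.
have inj : injective f.
  by move=> i j /eqP; rewrite nth_uniq // => /eqP h2; apply: val_inj => /=; move: h2; clear; lia.
have [|x' [y' [/imsetP[i _ ->] /imsetP[j _ ->] xy]]] := ha [set f i | i in 'I_a.+1].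
  by rewrite card_imset // card_ord.
wlog ij : i j xy / i < j.
  move=> W1; case: (ltngtP i j) => [ij|ji|ij]; first exact: (W1 i j).
    by apply: (W1 j i) => //; rewrite gsym.
  by move: xy; rewrite (val_inj ij) girr.
(* The second cut falls just before position [2 * j], so the removed segment ends at
   [(2 * j).-1]. *)
have [||c1 [M [c2 [cE lM]]]] := split_at b (i := 2 * i) (j := (2 * j).-1) _ _ (c := c).
- by move: ij; clear; lia.
- by have := ltn_ord j; move: sc ij; clear; lia.
have jj : (2 * j).-1.+1 = 2 * j by move: ij; clear; lia.
rewrite jj in cE.
have sM : (size M).+1 = 2 * j - 2 * i - 1.
  have : index (f i) c = 2 * i by rewrite index_uniq.
  have : index (f j) c = 2 * j by rewrite index_uniq.
  move: uc; rewrite cE -/(f i) -/(f j) -cat_rcons => U.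
  have s1 : index (f i) (rcons c1 (f i) ++ (nth b c (2 * i).+1 :: M) ++ f j :: c2) = size c1.
    move: U; rewrite cat_rcons cat_uniq => /and3P[_ /norP[fi _] _].
    by rewrite index_cat (negPf fi) /= eqxx addn0.
  have s2 : index (f j) (rcons c1 (f i) ++ (nth b c (2 * i).+1 :: M) ++ f j :: c2) =
      (size c1).+1 + (size M).+1.
    move: U; rewrite catA cat_uniq => /and3P[_ /norP[fj _] _].
    by rewrite index_cat (negPf fj) /= eqxx addn0 size_cat size_rcons.
  by rewrite s1 s2; move: ij; clear; lia.
exists (c1 ++ f i :: f j :: c2); split.
- have sub : subseq (c1 ++ f i :: f j :: c2) c.
    rewrite [X in subseq _ X]cE; apply: cat_subseq (subseq_refl _) _.
    exact: (cat_subseq (subseq_refl [:: f i]) (suffix_subseq (nth b c (2 * i).+1 :: M) (f j :: c2))).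
  split.
  + move: pc; rewrite [in path _ _ _]cE !rcons_cat /= !cat_path /= !rcons_cat !cat_path /=.
    by case/and5P=> -> -> _ _ /andP[_ ->]; rewrite gh.
  + exact: subseq_uniq sub uc.
  + by move=> z /(mem_subseq sub); exact: Dc.
- by rewrite [X in _ < size X]cE !size_cat /= !size_cat /=; clear; lia.
- rewrite [X in size X <= _]cE !size_cat /= !size_cat /=; have := ltn_ord j.
  by move: sM ij; clear; lia.
Qed.

End Routes.

(** * Euler tours along a matching *)

Section PortTrails.
Variables (T I : finType) (mu : T -> T) (phi : T -> I).
Hypothesis muK : involutive mu.

Definition mu_closed (A : {set T}) : Prop := forall z, z \in A -> mu z \in A.

(** For [A] closed under [mu], the pairs [z], [mu z] are the edges of a multigraph on the hubs,
    [phi] giving the hub at which a port sits; the cardinality of a fiber is a degree. *)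
Definition fiber (A : {set T}) (k : I) : {set T} := [set z in A | phi z == k].

Definition crossing (A : {set T}) (Hs : {set I}) : Prop :=
  forall W : {set I}, W \subset Hs -> W != set0 -> W != Hs ->
  exists u, [/\ u \in A, mu u \in A, phi u \in Hs :\: W & phi (mu u) \in W].

(* The most recently attached port comes first; each one attaches a new hub to an older one. *)
Fixpoint tree (root : I) (L : seq T) : bool :=
  if L is u :: L' then
    [&& phi u \notin root :: map phi L', phi (mu u) \in root :: map phi L' & tree root L']
  else true.

Definition ports (L : seq T) : {set T} := [set z | (z \in L) || (mu z \in L)].

Lemma ports_closed L : mu_closed (ports L).
Proof. by move=> z; rewrite !inE muK orbC. Qed.

Lemma card_ports L : #|ports L| <= 2 * size L.
Proof.
have : ports L \subset [set z in L ++ map mu L].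
  apply/subsetP => z; rewrite !inE mem_cat => /orP[->//|zL].
  by rewrite -[z]muK map_f ?orbT.
by move/subset_leq_card/leq_trans; apply; rewrite cardsE (leq_trans (card_size _)) // size_cat size_map; clear; lia.
Qed.

Lemma tree_uniq root L : tree root L -> uniq (root :: map phi L).
Proof.
elim: L => //= u L IH /and3P[ul _ /IH /andP[rl ->]].
by move: ul; rewrite !inE !negb_or eq_sym => /andP[-> ->]; rewrite rl.
Qed.

Lemma tree_ports root L z : tree root L -> z \in ports L -> phi z \in root :: map phi L.
Proof.
elim: L => [|u L IH] /=; first by rewrite inE.
case/and3P=> _ ml tl; rewrite !inE => /orP[/predU1P[->|zL]|/predU1P[mz|mzL]].
- by rewrite eqxx !orbT.
- by rewrite map_f ?orbT.
- by rewrite -[z]muK mz; move: ml; rewrite inE => /orP[->|->]; rewrite ?orbT.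
- have := IH tl; rewrite !inE mzL orbT => /(_ isT) /orP[->|->]; by rewrite ?orbT.
Qed.

(** Take a largest tree. If it missed a hub, [crossing] applied to the hubs reached would attach one
    more. *)
Lemma spanning_tree (A : {set T}) (Hs : {set I}) root :
  root \in Hs -> crossing A Hs ->
  exists L, [/\ tree root L, {subset ports L <= A}, [set k in root :: map phi L] = Hs &
    size L < #|Hs|].
Proof.
move=> rH cr.
pose ok m := `[< exists L, [/\ tree root L, {subset ports L <= A},
  {subset root :: map phi L <= Hs} & size L = m] >].
have okB m : ok m -> m <= #|Hs|.
  case/asboolP=> L [tL _ sL <-]; have := tree_uniq tL => /card_uniqP/= cL.
  rewrite -(size_map phi); apply: ltnW; rewrite -cL -[X in X <= _]cardsE.
  by apply/subset_leq_card/subsetP => k; rewrite inE; exact: sL.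
have ok0 : exists m, ok m.
  exists 0; apply/asboolP; exists [::]; split=> // z; first by rewrite inE.
  by rewrite inE => /eqP->.
case: (ex_maxnP ok0 okB) => m /asboolP[L [tL LA LH sL]] mmax.
set W := [set k in root :: map phi L].
have WH : W \subset Hs by apply/subsetP => k; rewrite inE; exact: LH.
have cW : #|W| = (size L).+1.
  by rewrite cardsE; have /card_uniqP -> := tree_uniq tL; rewrite /= size_map.
have [WE|WE] := eqVneq W Hs; first by exists L; split=> //; rewrite -WE cW.
have W0 : W != set0 by apply/set0Pn; exists root; rewrite inE mem_head.
have [u [uA muA]] := cr W WH W0 WE; rewrite in_setD => /andP[uW uH] muW.
suff /mmax : ok m.+1 by rewrite ltnn.
apply/asboolP; exists (u :: L); split=> //.
- by move: uW muW; rewrite !in_set /= => -> ->.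
- move=> z; rewrite !inE => /orP[/predU1P[->//|zL]|/predU1P[mz|mzL]].
  + by apply: LA; rewrite inE zL.
  + by rewrite -[z]muK mz.
  + by apply: LA; rewrite inE mzL orbT.
- move=> k; rewrite /= !inE => /or3P[/eqP->//|/eqP->//|kL].
  by apply: LH; rewrite inE kL orbT.
- by rewrite /= sL.
Qed.

(** Connectivity of the tree, in the form that [euler_trail] asks for. Either the edge of the newest
    hub crosses, or its older end lies on the same side and can replace it. *)
Lemma tree_crossing root L (W : {set I}) k k' : tree root L ->
  k \in root :: map phi L -> k' \in root :: map phi L -> k \in W -> k' \notin W ->
  exists u, [/\ u \in ports L, phi u \in W & phi (mu u) \notin W].
Proof.
elim: L k k' => [|u L IH] k k' /=.
  by move=> _; rewrite !inE => /eqP-> /eqP-> ->.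
case/and3P=> _ ml tl hk hk' kW k'W.
have mono v : v \in ports L -> v \in ports (u :: L).
  by rewrite !inE => /orP[->|->]; rewrite ?orbT.
have ext l l' : l \in root :: map phi L -> l' \in root :: map phi L -> l \in W -> l' \notin W ->
    exists v, [/\ v \in ports (u :: L), phi v \in W & phi (mu v) \notin W].
  move=> hl hl' lW l'W; have [v [vL vW mvW]] := IH l l' tl hl hl' lW l'W.
  by exists v; split=> //; exact: mono.
have u1 : u \in ports (u :: L) by rewrite !inE eqxx.
have u2 : mu u \in ports (u :: L) by rewrite !inE muK eqxx !orbT.
have spl l : l \in [:: root, phi u & map phi L] -> l = phi u \/ l \in root :: map phi L.
  by rewrite !inE => /or3P[->|/eqP->|->]; [right | left | right; rewrite orbT].
case: (spl k hk) (spl k' hk') => [ku|hk0] [ku'|hk0'].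
- by rewrite ku ku' in kW k'W; rewrite kW in k'W.
- case mW: (phi (mu u) \in W); first exact: (ext _ _ ml hk0').
  by exists u; rewrite u1 -ku kW mW.
- case mW: (phi (mu u) \in W); last by apply: (ext _ _ hk0 ml); rewrite ?mW.
  by exists (mu u); rewrite u2 muK mW -ku'.
- exact: (ext _ _ hk0 hk0').
Qed.

(** A join in a tree for prescribed parities. The newest hub is a leaf, so its edge is taken exactly
    when [t (phi u)] holds, and then the demand at its other end flips; the total demand stays
    even. *)
Lemma parity_join root L (t : I -> bool) : {in ports L, forall z, mu z != z} ->
  tree root L -> ~~ odd (count t (root :: map phi L)) ->
  exists J : {set T}, [/\ mu_closed J, J \subset ports L &
    {in root :: map phi L, forall k, odd #|fiber J k| = t k}].
Proof.
elim: L t => [|u L IH] t fpf.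
  move=> _ /=; rewrite addn0 => rt; exists set0; split=> //.
  - by move=> z; rewrite inE.
  - move=> k; rewrite inE => /eqP->; rewrite (_ : fiber set0 root = set0) ?cards0.
      by move: rt; case: (t root).
    by apply/setP => z; rewrite !inE.
move=> /[dup] tuL /= /and3P[ul ml tl] ct.
have sub : ports L \subset ports (u :: L).
  by apply/subsetP => z; rewrite !inE => /orP[->|->]; rewrite ?orbT.
have fpL : {in ports L, forall z, mu z != z} by move=> z /(subsetP sub); exact: fpf.
pose t' k := if t (phi u) && (k == phi (mu u)) then ~~ t k else t k.
have cE : odd (count t' (root :: map phi L)) = odd (count t (root :: map phi L)) (+) t (phi u).
  have := tree_uniq tl; move: ml; move: (root :: map phi L) => l.
  rewrite /t'; case: (t (phi u)); last by rewrite addbF.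
  elim: l => // x l IHl; rewrite inE /= => hm /andP[xl ul']; rewrite !oddD.
  have [xE|xE] := eqVneq x (phi (mu u)).
    rewrite (@eq_in_count _ _ t) => [|y yl]; first by rewrite !oddb; case: (t x); case: (odd _).
    by case: eqP => // yE; move: xl; rewrite xE -yE yl.
  move: hm; rewrite eq_sym (negPf xE) /= => hm; rewrite IHl //.
  by rewrite !oddb; case: (t x); case: (odd _).
have [|J [Jc JL Jt]] := IH t' fpL tl.
  rewrite cE; move: ct; rewrite /= !oddD !oddb.
  by case: (t root); case: (t (phi u)); case: (odd _).
have Ju k : k \notin root :: map phi L -> fiber J k = set0.
  move=> kL; apply/setP => z; rewrite [RHS]inE; apply/negP; rewrite inE => /andP[zJ /eqP zk].
  by move: kL; rewrite -zk (tree_ports tl) // (subsetP JL).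
have uJ : u \notin J.
  apply/negP => uJ; have : u \in fiber J (phi u) by rewrite inE uJ eqxx.
  by rewrite Ju // inE.
have muJ : mu u \notin J by apply: contra uJ => /Jc; rewrite muK.
have uL : u \in ports (u :: L) by rewrite !inE eqxx.
have mm : phi u != phi (mu u) by apply: contraNneq ul => ->.
case tu : (t (phi u)) (erefl (t (phi u))) => tuE; last first.
  exists J; split=> //; first exact: subset_trans JL sub.
  move=> k; rewrite -[_ \in _]/(k \in [:: root, phi u & map phi L]) => kL.
  have [->|ku] := eqVneq k (phi u); first by rewrite Ju // cards0 tu.
  rewrite Jt /t' ?tu //; move: kL; rewrite !inE (negPf ku) /=; by [].
exists (u |: (mu u |: J)); split.
- by move=> z; rewrite !inE => /or3P[/eqP->|/eqP->|/Jc->]; rewrite ?muK ?eqxx ?orbT.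
- rewrite !subUset !sub1set uL (ports_closed uL) /=; exact: subset_trans JL sub.
- have fE k : #|fiber (u |: (mu u |: J)) k| = (phi u == k) + (phi (mu u) == k) + #|fiber J k|.
    have uf x (X : {set T}) : x \notin X -> #|fiber (x |: X) k| = (phi x == k) + #|fiber X k|.
      move=> xX; case: (eqVneq (phi x) k) => xk.
        have -> : fiber (x |: X) k = x |: fiber X k.
          by apply/setP => z; rewrite !inE andb_orl; case: eqP => [->|//]; rewrite xk eqxx.
        by rewrite cardsU1 inE (negPf xX).
      congr #|pred_of_set _|; apply/setP => z; rewrite !inE andb_orl.
      by case: eqP => [->|//]; rewrite (negPf xk) andbF.
    rewrite uf ?uf ?addnA // !inE negb_or uJ andbT.
    by rewrite eq_sym; exact: fpf.
  move=> k; rewrite -[_ \in _]/(k \in [:: root, phi u & map phi L]) => kL.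
  rewrite fE !oddD !oddb.
  have [<-|ku] := eqVneq (phi u) k; first by rewrite (negPf (_ : phi (mu u) != phi u)) 1?eq_sym // Ju // cards0 tu.
  rewrite Jt; last by move: kL; rewrite !inE (negPf (_ : k != phi u)) 1?eq_sym.
  by rewrite /t' tu eq_sym; case: eqP; case: (t k).
Qed.

Lemma closed_even (A : {set T}) : mu_closed A -> {in A, forall z, mu z != z} -> ~~ odd #|A|.
Proof.
have [m] := ubnP #|A|; elim: m A => // m IH A Am Ac Af.
have [->|[z zA]] := set_0Vmem A; first by rewrite cards0.
have mzA : mu z \in A :\ z by rewrite !inE Af //= Ac.
have cA : #|A| = #|A :\ z :\ mu z|.+2 by rewrite (cardsD1 z) zA (cardsD1 (mu z)) mzA.
rewrite cA /= negbK; apply: IH; first by move: Am; rewrite cA; clear; lia.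
  move=> x; rewrite !inE => /and3P[xm xz xA]; rewrite Ac // andbT.
  by rewrite (can_eq muK) xz /= (inv_eq muK) xm.
by move=> x; rewrite !inE => /and3P[_ _]; exact: Af.
Qed.

(** A trail lists ports of departure: leaving through [u] it arrives at [mu u], and it departs next
    from the same hub through [v]. *)
Let linked : rel T := [rel u v | phi (mu u) == phi v].

(** Arrivals and departures at [k] pair up along the trail, except for the first departure and the
    last arrival. *)
Lemma trail_count k u s : path linked u s ->
  count (fun z => phi z == k) (u :: s) + (phi (mu (last u s)) == k) =
  (phi u == k) + count (fun z => phi z == k) (map mu (u :: s)).
Proof.
elim: s u => [|v s IH] u /=; first by clear; lia.
case/andP=> /eqP uv /IH /= h; rewrite uv; move: h; clear; lia.
Qed.

(** Take a longest trail using no edge twice. If it ended at a hub other than its first, it would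
    use an odd number of the ports there, and the degree being even it could go on. Once it is
    closed, a port leading out of the visited hubs would extend a rotation of it. This exhausts the
    hubs, though perhaps not the edges. *)
Lemma euler_trail (A : {set T}) (Hs : {set I}) root :
  root \in Hs -> mu_closed A -> {in A, forall z, mu z != z} ->
  (forall k, ~~ odd #|fiber A k|) -> {in A, forall z, phi z \in Hs} ->
  (forall W : {set I}, W \subset Hs -> W != set0 -> W != Hs ->
     exists u, [/\ u \in A, phi u \in W & phi (mu u) \notin W]) ->
  exists s, [/\ uniq (s ++ map mu s), {subset s <= A}, cycle linked s,
    forall k, k \in Hs -> k = root \/ k \in map phi s & if s is u :: _ then phi u = root else True].
Proof.
move=> rH Ac Af Aev AH cr.
have [HE|HE] := eqVneq Hs [set root].
  by exists [::]; split=> // k; rewrite HE inE => /eqP->; left.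
pose ok s := [/\ sorted linked s, uniq (s ++ map mu s) & {subset s <= A}].
have [||s [ps us sA] smax] := @exists_longest _ ok.
- by move=> s [_]; rewrite cat_uniq => /and3P[].
- by exists [::].
pose U := [set z in s ++ map mu s].
have Uc : mu_closed U.
  move=> z; rewrite !inE !mem_cat => /orP[zs|/mapP[y ys ->]].
    by rewrite (map_f mu zs) orbT.
  by rewrite muK ys.
have UA : U \subset A.
  apply/subsetP => z; rewrite inE mem_cat => /orP[/sA//|/mapP[y /sA yA ->]]; exact: Ac.
have ext s' z : sorted linked s' -> perm_eq s' s -> z \in A -> z \notin U ->
    (if s' is u :: s1 then phi (mu (last u s1)) = phi z else True) -> False.
  move=> ps' Pm zA zU lz; suff /smax : ok (rcons s' z).
    by rewrite size_rcons (perm_size Pm) ltnn.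
  have Pm2 : perm_eq (rcons s' z ++ map mu (rcons s' z)) ((s ++ map mu s) ++ [:: z; mu z]).
    rewrite map_rcons -!cats1 -!catA.
    apply: perm_trans (_ : perm_eq _ (s' ++ [seq mu i | i <- s'] ++ [:: z; mu z])) _.
      rewrite perm_cat2l -[X in perm_eq _ X]/(_ ++ ([:: z] ++ [:: mu z])) !catA perm_cat2r.
      exact: permEl (perm_catC _ _).
    by rewrite !catA perm_cat2r; apply: perm_cat => //; exact: perm_map.
  split.
  - case: s' ps' lz {Pm Pm2} => //= u s1; rewrite rcons_path => -> lz.
    by rewrite /linked /= lz.
  - rewrite (perm_uniq Pm2) cat_uniq us /= orbF andbT negb_or !inE.
    rewrite -![_ \in s ++ _]in_set -/U zU (contra _ zU) 1?eq_sym ?Af //.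
    by move=> /Uc; rewrite muK.
  - by move=> y; rewrite mem_rcons inE (perm_mem Pm) => /predU1P[->//|/sA].
have [k0 k0H k0r] : exists2 k, k \in Hs & k != root.
  apply/exists_inP; apply: contraNT HE; rewrite negb_exists_in => /forall_inP h.
  rewrite eqEsubset sub1set rH andbT; apply/subsetP => k /h; by rewrite negbK inE.
have sn : s != [::].
  apply/eqP => s0; have [|||u [uA _ _]] := cr [set root]; rewrite ?sub1set //.
  - by apply/set0Pn; exists root; rewrite inE.
  - by rewrite eq_sym.
  by apply: (ext [::] u) => //; rewrite ?s0 // /U s0 inE.
case: s sn => // u0 s0 _ in ps us sA smax U Uc UA ext *.
have cyc : cycle linked (u0 :: s0).
  rewrite /cycle rcons_path [path _ _ _]ps /=; apply: contraT => nk.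
  pose k := phi (mu (last u0 s0)).
  have {}nk : k != phi u0 by [].
  have fU : #|fiber U k| = count (fun z => phi z == k) ((u0 :: s0) ++ map mu (u0 :: s0)).
    have -> : fiber U k = [set z in filter (fun z => phi z == k) ((u0 :: s0) ++ map mu (u0 :: s0))].
      by apply/setP => z; rewrite !in_set mem_filter andbC.
    by rewrite cardsE (card_uniqP (filter_uniq _ us)) size_filter.
  have oU : odd #|fiber U k|.
    have := trail_count k ps; rewrite fU count_cat -/k eqxx eq_sym (negPf nk) /=.
    by clear; lia.
  have [z zA zU] : exists2 z, z \in fiber A k & z \notin fiber U k.
    apply/subsetPn; apply: contraL oU => sub; rewrite (_ : fiber U k = fiber A k) ?Aev //.
    apply/eqP; rewrite eqEsubset sub andbT; apply/subsetP => z; rewrite !inE => /andP[zU ->].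
    by rewrite (subsetP UA) // inE.
  move: zA; rewrite inE => /andP[zA zk].
  case: (ext (u0 :: s0) z) => //; last by rewrite -/k (eqP zk).
  by apply: contra zU => zU; rewrite inE zU.
pose W := [set k in map phi (u0 :: s0)].
have UW z : z \in U -> phi z \in W.
  rewrite inE mem_cat => /orP[zs|/mapP[y ys ->]]; first by rewrite inE map_f.
  have := next_cycle cyc ys => /eqP ->; rewrite inE map_f // mem_next.
  by [].
have WH : W \subset Hs.
  by apply/subsetP => k; rewrite inE => /mapP[z /sA zA ->]; exact: AH.
have WE : W = Hs.
  apply/eqP; apply: contraT => WE.
  have [|u [uA uW muW]] := cr W WH _ WE.
    by apply/set0Pn; exists (phi u0); rewrite inE mem_head.
  have uU : u \notin U by apply: contra muW => /Uc/UW.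
  move: uW; rewrite inE => /mapP[v vs uv].
  case: (rot_to vs) => i s' rE.
  have cyc' : cycle linked (v :: s') by rewrite -rE rot_cycle.
  case: (ext (v :: s') u) => //.
  - by move: cyc'; rewrite /cycle rcons_path => /andP[].
  - by rewrite -rE perm_rot.
  - by move: cyc'; rewrite /cycle rcons_path => /andP[_ /eqP->].
have : root \in W by rewrite WE.
rewrite inE => /mapP[v vs rv]; case: (rot_to vs) => i s' rE.
have Pm : perm_eq (v :: s') (u0 :: s0) by rewrite -rE perm_rot.
exists (v :: s'); split=> //.
- rewrite (@perm_uniq _ _ ((u0 :: s0) ++ map mu (u0 :: s0))) //.
  by apply: perm_cat => //; exact: perm_map.
- by move=> z; rewrite (perm_mem Pm); exact: sA.
- by rewrite -rE rot_cycle.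
- by move=> k; rewrite -WE inE (perm_mem (perm_map phi Pm)); right.
Qed.

(** A tree in [A1] provides connectivity. A join in a tree in [A2], for the parities of the first
    tree, makes all degrees even; as [A1] and [A2] are disjoint, degrees add up. *)
Lemma spanning_trail (A1 A2 : {set T}) (Hs : {set I}) root :
  root \in Hs -> [disjoint A1 & A2] ->
  {in A1 :|: A2, forall z, mu z != z} -> {in A1 :|: A2, forall z, phi z \in Hs} ->
  crossing A1 Hs -> crossing A2 Hs ->
  exists s, [/\ uniq (s ++ map mu s), {subset s ++ map mu s <= A1 :|: A2}, cycle linked s,
    forall k, k \in Hs -> k = root \/ k \in map phi s &
    size s <= 2 * #|Hs| /\ if s is u :: _ then phi u = root else True].
Proof.
move=> rH dis fpf phiH cr1 cr2.
have [L1 [t1 L1A H1 s1]] := spanning_tree rH cr1.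
have [L2 [t2 L2A H2 s2]] := spanning_tree rH cr2.
have fp1 : {in ports L1, forall z, mu z != z} by move=> z /L1A zA; apply: fpf; rewrite inE zA.
have fp2 : {in ports L2, forall z, mu z != z} by move=> z /L2A zA; apply: fpf; rewrite inE zA orbT.
pose t k := odd #|fiber (ports L1) k|.
have even_t : ~~ odd (count t (root :: map phi L2)).
  have -> : odd (count t (root :: map phi L2)) = odd #|ports L1|; last first.
    by apply: closed_even => //; exact: ports_closed.
  have -> : #|ports L1| = \sum_(k <- root :: map phi L2) #|fiber (ports L1) k|.
    rewrite (big_uniq _ (tree_uniq t2)) /= -sum1_card (partition_big phi (mem Hs)) /=; last first.
      by move=> z zL; rewrite -H1 inE (tree_ports t1).
    rewrite (eq_bigl (fun k => k \in root :: map phi L2)); last by move=> k; rewrite -H2 /= in_set.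
    by apply: eq_bigr => k _; rewrite -sum1dep_card; apply: eq_bigl => z; rewrite !inE.
  by elim: (root :: _) => [|k l IHl]; rewrite ?big_nil // big_cons /= !oddD oddb IHl.
have [J [Jc JL Jt]] := parity_join fp2 t2 even_t.
pose A := ports L1 :|: J.
have AA : {subset A <= A1 :|: A2}.
  move=> z; rewrite !in_setU => /orP[/L1A->//|/(subsetP JL)/L2A->]; by rewrite orbT.
(* Each tree has fewer than [#|Hs|] edges, each with two ports; this bounds the length of the
   tour. *)
have cA : #|A| <= 4 * #|Hs|.
  have := card_ports L1; have := card_ports L2; have := subset_leq_card JL.
  by rewrite /A cardsU; move: s1 s2; clear; lia.
have [|||||s [us sA cs sH s0]] := @euler_trail A Hs root rH.
- by move=> z; rewrite !in_setU => /orP[/ports_closed->//|/Jc->]; rewrite orbT.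
- by move=> z /AA; exact: fpf.
- move=> k; have -> : #|fiber A k| = #|fiber (ports L1) k| + #|fiber J k|.
    have -> : fiber A k = fiber (ports L1) k :|: fiber J k.
      by apply/setP => z; rewrite !inE andb_orl.
    rewrite cardsU (_ : _ :&: _ = set0) ?cards0 ?subn0 //.
    apply/setP => z; rewrite [RHS]inE; apply/negP; rewrite !in_setI ![z \in fiber _ _]inE.
    case/andP=> /andP[/L1A z1 _] /andP[/(subsetP JL)/L2A z2 _].
    by rewrite (disjointFr dis z1) in z2.
  rewrite oddD; have [kH|kH] := boolP (k \in Hs).
    by rewrite Jt /t ?addbb //; move: kH; rewrite -H2 inE.
  have f0 (X : {set T}) : {subset X <= A1 :|: A2} -> fiber X k = set0.
    move=> XA; apply/setP => z; rewrite [RHS]inE; apply/negP; rewrite inE => /andP[/XA/phiH zH /eqP zk].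
    by rewrite -zk zH in kH.
  rewrite !f0 ?cards0 // => z zX; apply: AA; by rewrite in_setU zX ?orbT.
- by move=> z /AA; exact: phiH.
- move=> W WH /set0Pn[k kW] WE.
  have [k' k'H k'W] : exists2 k', k' \in Hs & k' \notin W.
    by apply/subsetPn; apply: contra WE => HW; rewrite eqEsubset WH.
  have [||u [uL uW muW]] := tree_crossing t1 _ _ kW k'W.
  + by have := subsetP WH _ kW; rewrite -H1 inE.
  + by move: k'H; rewrite -H1 inE.
  by exists u; rewrite in_setU uL.
have sA' : {subset s ++ map mu s <= A}.
  move=> z; rewrite mem_cat => /orP[/sA//|/mapP[y /sA yA ->]].
  by move: yA; rewrite !in_setU => /orP[/ports_closed->//|/Jc->]; rewrite orbT.
exists s; split=> //; first by move=> z /sA'/AA.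
split=> //; have := card_uniqP us; rewrite size_cat size_map => h.
suff : #|s ++ map mu s| <= #|A| by move: cA; rewrite h; clear; lia.
by apply/subset_leq_card/subsetP => z; exact: sA'.
Qed.

End PortTrails.

(** * Pancyclicity from crossing edges *)

Section Deterministic.
Variables (T : finType) (g r : rel T).
Hypotheses (gsym : symmetric g) (girr : irreflexive g) (rsym : symmetric r).
Hypothesis rmatch : forall x y z, r x y -> r x z -> y = z.

(** An unmatched vertex is its own partner, which makes this a total involution; ports satisfy
    [partner z != z]. *)
Definition partner (x : T) : T := odflt x [pick y | r x y].

Definition union_rel : rel T := [rel x y | g x y || r x y].

Lemma partnerE x y : r x y -> partner x = y.
Proof.
rewrite /partner => xy; case: pickP => [z xz|]; first exact: rmatch xz xy.
by move/(_ y); rewrite xy.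
Qed.

Lemma partner_rel x : partner x != x -> r x (partner x).
Proof. by rewrite /partner; case: pickP => //= _; rewrite eqxx. Qed.

Lemma partnerK : involutive partner.
Proof.
move=> x; have [xE|/partner_rel xy] := eqVneq (partner x) x; first by rewrite !xE.
by apply: partnerE; rewrite rsym; exact: xy.
Qed.

Lemma union_rel_sym : symmetric union_rel.
Proof. by move=> x y; rewrite /union_rel /= gsym rsym. Qed.

Lemma sub_union_rel : subrel g union_rel.
Proof. by move=> x y xy; rewrite /union_rel /= xy. Qed.

Definition ports_in (Y : {set T}) : {set T} :=
  [set z in Y | (partner z \in Y) && (partner z != z)].

Lemma touches_cat (Q : {set T}) p c : touches Q c -> touches Q (p ++ c).
Proof.
by case=> c1 [u [v [c2 [-> uQ vQ]]]]; exists (p ++ c1), u, v, c2; rewrite catA.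
Qed.

Variables (H : {set {set T}}) (reg : {set T} -> {set T}) (s : nat).
Hypothesis tH : trivIset H.
Hypothesis regP : forall Z, Z \in H -> hub g s (reg Z) Z.
Local Notation phi := (pblock H).
Local Notation mu := partner.

Lemma hub_link (F : {set T}) z u : #|F| <= s -> z \in cover H -> phi z = phi u ->
  u \in cover H -> z != u -> exists w m w', [/\ uniq [:: w; m; w'],
    {in [:: w; m; w'], forall v, v \notin F}, path g z [:: w; m; w'; u] &
    [/\ w \in reg (phi z) & m \in reg (phi z)]].
Proof.
move=> Fs zH zu uH nzu.
have kH : phi z \in H by rewrite pblock_mem.
have zZ : z \in phi z by rewrite mem_pblock.
have uZ : u \in phi z by rewrite zu mem_pblock.
have [w [m [w' [U sub p]]]] := (proj2 (regP kH)) F Fs z u zZ uZ nzu.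
exists w, m, w'; split=> //.
- by move: U; rewrite /= !inE !negb_or => /andP[_ /andP[/and3P[-> -> _]]] /andP[/andP[-> _] _].
- by move=> v /sub /setDP[].
- by split; have := sub w; have := sub m; rewrite !inE !eqxx ?orbT => /(_ isT)/andP[_ ?] /(_ isT)/andP[_ ?].
Qed.

(** Induction on the trail: link the current vertex [z] to the port [u], cross to [mu u], continue.
    [F] collects what later links must avoid: the ports of the trail from the start and three more
    vertices per link, whence [3 * (size ss).+1]. The first two interior vertices of a link witness
    [touches]. *)
Lemma link_trail (x : T) (ss : seq T) (z : T) (F : {set T}) :
  #|F| + 3 * (size ss).+1 <= s -> uniq (ss ++ map mu ss) ->
  {subset ss ++ map mu ss <= F} -> {in ss, forall u, mu u != u} ->
  {subset ss ++ map mu ss <= cover H} -> x \in cover H -> z \in cover H ->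
  x \in F -> x \notin map mu ss -> z \notin ss -> z != x ->
  (if ss is u :: ss' then
     [/\ phi z = phi u, path [rel u v | phi (mu u) == phi v] u ss' &
         phi (mu (last u ss')) = phi x]
   else phi z = phi x) ->
  exists c, [/\ path union_rel z (rcons c x), uniq c,
    {in c, forall v, (v \notin F) || (v \in ss ++ map mu ss)},
    {in ss, forall u, touches (reg (phi u)) c} & touches (reg (phi x)) c].
Proof.
elim: ss z F => [|u ss IH] z F hF us sF fpf sH xH zH xF xs zs zx.
  move=> zxE; have [|w [m [w' [U nF p [wR mR]]]]] := @hub_link F z x _ zH zxE xH zx.
    by move: hF; clear; lia.
  exists [:: w; m; w']; split=> //.
  - exact: sub_path sub_union_rel _ _ p.
  - by move=> v /nF ->.
  - by rewrite -zxE; exists [::], w, m, [:: w'].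
case=> zu pu lu.
have umem : u \in (u :: ss) ++ map mu (u :: ss) by rewrite mem_cat mem_head.
have mumem : mu u \in (u :: ss) ++ map mu (u :: ss) by rewrite mem_cat mem_head orbT.
have nzu : z != u by move: zs; rewrite inE negb_or => /andP[].
have [|w [m [w' [U nF p [wR mR]]]]] := @hub_link F z u _ zH zu (sH _ umem) nzu.
  by move: hF; clear; lia.
pose F' := F :|: [set v in [:: w; m; w']].
have FF' v : v \in F -> v \in F' by rewrite in_setU => ->.
have subs v : v \in ss ++ map mu ss -> v \in (u :: ss) ++ map mu (u :: ss).
  by rewrite !mem_cat /= !inE => /orP[->|->]; rewrite ?orbT.
have us2 : perm_eq ((u :: ss) ++ map mu (u :: ss)) ([:: u; mu u] ++ ss ++ map mu ss).
  by rewrite /= perm_cons; exact: permEl (perm_catCA ss [:: mu u] (map mu ss)).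
move: (us); rewrite (perm_uniq us2) cat_uniq => /and3P[uu nuu us'].
have nss v : v \in [:: u; mu u] -> v \notin ss ++ map mu ss.
  by move=> hv; apply: contra nuu => hv'; apply/hasP; exists v.
have h1 : #|F'| + 3 * (size ss).+1 <= s.
  have : #|F'| <= #|F| + 3.
    rewrite /F' cardsU; have : #|[set v in [:: w; m; w']]| <= 3 by rewrite cardsE card_size.
    by clear; lia.
  by move: hF => /=; clear; lia.
have h2 : {subset ss ++ map mu ss <= F'} by move=> v /subs/sF/FF'.
have h3 : {in ss, forall v, mu v != v} by move=> v vs; apply: fpf; rewrite inE vs orbT.
have h4 : {subset ss ++ map mu ss <= cover H} by move=> v /subs/sH.
have h5 : x \notin map mu ss by move: xs; rewrite /= inE negb_or => /andP[].
have h6 : mu u \notin ss.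
  have := nss (mu u); rewrite !inE eqxx orbT => /(_ isT).
  by rewrite mem_cat negb_or => /andP[].
have h7 : mu u != x by move: xs; rewrite /= inE negb_or eq_sym => /andP[].
have [|c [pc uc cF ct cx]] := IH (mu u) F' h1 us' h2 h3 h4 xH (sH _ mumem) (FF' _ xF) h5 h6 h7.
  by case: (ss) pu lu => [|v ss'] /=; [move=> _ -> | case/andP=> /eqP-> -> ->].
exists ([:: w; m; w'; u; mu u] ++ c); split.
- rewrite rcons_cat cat_path; apply/andP; split=> //.
  rewrite -[[:: w; m; w'; u; mu u]]/([:: w; m; w'; u] ++ [:: mu u]) cat_path.
  rewrite (sub_path sub_union_rel p) /= andbT /union_rel /= partner_rel ?orbT //.
  by apply: fpf; rewrite mem_head.
- have nc v : v \in c -> (v \notin [:: w; m; w']) && (v \notin [:: u; mu u]).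
    move=> vc; case/orP: (cF v vc) => [|vs].
      rewrite in_setU negb_or in_set => /andP[vF ->] /=.
      by apply: contra vF => h; apply: sF; rewrite (perm_mem us2) mem_cat h.
    apply/andP; split; last by apply: contraL vs => /nss.
    by apply: contraL vs => /nF; apply: contra => /subs/sF.
  rewrite -[[:: w; m; w'; u; mu u]]/([:: w; m; w'] ++ [:: u; mu u]) -catA cat_uniq U.
  rewrite cat_uniq uu uc; apply/and3P; split=> //.
    apply/hasPn => v; rewrite mem_cat => /orP[vu|/nc/andP[]//].
    by apply: contraL vu => /nF; apply: contra => h; apply: sF; rewrite (perm_mem us2) mem_cat h.
  by rewrite andbT andTb; apply/hasPn => v /nc/andP[].
- move=> v; rewrite mem_cat => /orP[|/cF/orP[|/subs->]]; last by rewrite orbT.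
    rewrite -[[:: w; m; w'; u; mu u]]/([:: w; m; w'] ++ [:: u; mu u]) mem_cat => /orP[/nF->//|h].
    by rewrite (perm_mem us2) mem_cat h orbT.
  by rewrite in_setU negb_or => /andP[->].
- move=> v; rewrite inE => /predU1P[->|/ct]; last exact: touches_cat.
  by rewrite -zu; exists [::], w, m, [:: w', u, mu u & c].
- exact: touches_cat.
Qed.

End Deterministic.

(** Lengths up to [24] come from fans and those up to [12 * a + 12] from closed ladders. For longer
    ones, a ladder in the hub [Z0] is closed up by a route through all other vertices, which is then
    shortened until the ladder can make up the exact length. *)
Theorem pancyclic_union (T : finType) (g r : rel T) (a e s : nat)
    (P H : {set {set T}}) (Y1 Y2 : {set T}) (l : nat) :
  symmetric g -> irreflexive g -> symmetric r ->
  (forall x y z, r x y -> r x z -> y = z) ->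
  0 < e -> alpha_le g a -> (forall u, 4 * e <= #|nbr g u|) ->
  32 * (s + 4) * #|T| <= e * e ->
  10 * #|H| + 20 * a + 30 <= s ->
  trivIset P -> cover P = [set: T] ->
  (forall Q, Q \in P -> robust g s Q /\ core_in g e Q) ->
  trivIset H -> (forall Z, Z \in H -> hub g s setT Z /\ e <= 8 * #|Z|) ->
  (forall Q, Q \in P -> exists2 Z, Z \in H & hub g s Q Z) ->
  #|T| <= 2 * #|cover H| ->
  [disjoint Y1 & Y2] -> Y1 \subset cover H -> Y2 \subset cover H ->
  crossing (partner r) (pblock H) (ports_in r Y1) H ->
  crossing (partner r) (pblock H) (ports_in r Y2) H ->
  3 <= l <= #|T| -> cycle_of_length (union_rel g r) l.
Proof.
move=> gsym girr rsym rmatch e0 ha hdeg he hs tP covP gP tH gH PH cH dis Y1H Y2H cr1 cr2 /andP[l3 lT].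
have T0 : 0 < #|T| by move: l3 lT; clear; lia.
have eT : e <= #|T|.
  case/card_gt0P: T0 => u _; apply: leq_trans (_ : #|nbr g u| <= _); last exact: max_card.
  by move: (hdeg u); clear; lia.
have se : 32 * (s + 4) <= e.
  by rewrite -(leq_pmul2r T0); apply: leq_trans he _; rewrite leq_mul2l eT orbT.
have as_ : a <= s by move: hs; clear; lia.
have glob : forall l', cycle_of_length g l' -> cycle_of_length (union_rel g r) l'.
  move=> l' [c [cc uc sc]]; exists c; split=> //; case: c cc {uc sc} => //= x c.
  exact/sub_path/sub_union_rel.
have /card_gt0P[x0] : 0 < #|cover H| by move: T0 cH; clear; lia.
case/bigcupP=> Z0 Z0H _; have [hZ0 cZ0] := gH _ Z0H.
have [l24|l25] := leqP l 24.
  apply: glob; have := @fan_cycle _ g gsym girr a (l - 2) x0 ha.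
  have -> : (l - 2).+2 = l by move: l3; clear; lia.
  apply; have : (l - 2) * a <= 22 * a by rewrite leq_mul2r; move: l24; clear; lia.
  by have := hdeg x0; move: se as_ e0; clear; lia.
have [lsmall|lbig] := leqP l (12 * a + 12).
  apply: glob; apply: (closed_ladder_cycle gsym girr ha e0 as_ he hdeg hZ0 cZ0) => //.
  by move: lsmall hs; clear; lia.
pose mu := partner r.
have muK : involutive mu := partnerK rsym rmatch.
have inH (Y : {set T}) z : Y \subset cover H -> z \in ports_in r Y -> z \in cover H.
  by move=> YH; rewrite inE => /andP[zY _]; exact: (subsetP YH).
(* The tour is rooted at [Z0], so that the ladder can take part in its passage through that hub. *)
have [|||ss [us ssA cyc ssH [sz ss0]]] := spanning_trail muK Z0H (A1 := ports_in r Y1) (A2 := ports_in r Y2) _ _ _ cr1 cr2.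
- apply: disjointWl (_ : _ \subset Y1) _; first by apply/subsetP => z; rewrite inE => /andP[].
  by apply: disjointWr dis; apply/subsetP => z; rewrite inE => /andP[].
- by move=> z; rewrite in_setU => /orP[]; rewrite inE => /and3P[].
- move=> z; rewrite in_setU => /orP[/(inH _ _ Y1H)|/(inH _ _ Y2H)]; exact: pblock_mem.
pose F0 := [set z in ss ++ map mu ss].
have F0c : #|F0| <= 4 * #|H|.
  by rewrite cardsE (leq_trans (card_size _)) // size_cat size_map; move: sz; clear; lia.
have [|x [y [D [xZ yZ DF cD hq]]]] :=
  ladder gsym girr ha e0 as_ he hdeg hZ0 cZ0 (r := (2 * a).+1) (F := F0).
  by move: hs F0c; clear; lia.
have [//|q0 [pq0 lq0 uq0 sq0 cq0]] := hq 0.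
have xD : x \in D by apply: sq0; rewrite mem_head.
have yD : y \in D by apply: sq0; rewrite -lq0 mem_last.
have xy : y != x.
  apply: contraTneq uq0 => yx; move: lq0 cq0; case: (q0) => [|z q'] /=; first by clear; lia.
  by move=> lz _; have -> : x \in z :: q' by rewrite -yx -lz mem_last.
have bx z : z \in Z0 -> pblock H z = Z0 by move=> zZ; exact: def_pblock.
have cov z : z \in Z0 -> z \in cover H by move=> zZ; apply/bigcupP; exists Z0.
(* A hub that is a hub of some piece gets its links inside that piece; the other hubs may use all
   vertices. *)
pose reg Z := odflt setT [pick Q in P | `[< hub g s Q Z >] ].
have regP Z : Z \in H -> hub g s (reg Z) Z.
  by move=> ZH; rewrite /reg; case: pickP => [Q /andP[_ /asboolP]//|_]; have [] := gH _ ZH.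
have nD z : z \in ss ++ map mu ss -> z \notin D.
  by move=> zs; apply/negP => /(disjointFr DF); rewrite in_set zs.
have k1 : #|D :|: F0| + 3 * (size ss).+1 <= s.
  by rewrite cardsU cD; move: F0c sz hs; clear; lia.
have k2 : {subset ss ++ map mu ss <= D :|: F0}.
  by move=> z zs; rewrite in_setU [z \in F0]in_set zs orbT.
have k3 : {in ss, forall u, mu u != u}.
  move=> u us'; have := ssA u; rewrite mem_cat us' => /(_ isT).
  by rewrite in_setU => /orP[]; rewrite inE => /and3P[].
have k4 : {subset ss ++ map mu ss <= cover H}.
  by move=> z /ssA; rewrite in_setU => /orP[/(inH _ _ Y1H)|/(inH _ _ Y2H)].
have k5 : x \in D :|: F0 by rewrite in_setU xD.
have k6 : x \notin map mu ss by apply: contraL xD => xs; apply: nD; rewrite mem_cat xs orbT.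
have k7 : y \notin ss by apply: contraL yD => ys; apply: nD; rewrite mem_cat ys.
have [|c0 [pc0 uc0 c0F c0t c0x]] :=
  link_trail regP k1 us k2 k3 k4 (cov _ xZ) (cov _ yZ) k5 k6 k7 xy.
  case: (ss) ss0 cyc => [_ _|u ss' u0 /=]; first by rewrite !bx.
  by rewrite rcons_path => /andP[-> /eqP lu]; split; [rewrite bx | | rewrite (bx x) // -u0].
have rc0 : route (union_rel g r) D y x c0.
  split=> // z /c0F; rewrite in_setU negb_or => /orP[/andP[]//|]; exact: nD.
have tc0 Q : Q \in P -> touches Q c0.
  move=> QP; have [Z ZH hZ] := PH _ QP.
  have regZ : reg Z = Q.
    rewrite /reg; case: pickP => [Q' /andP[Q'P /asboolP hQ']|/(_ Q)]; last first.
      by rewrite QP; have -> : `[< hub g s Q Z >] by apply/asboolP.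
    apply/eqP/negPn/negP => QQ'; have [_ cZ] := gH _ ZH.
    have /card_gt0P[z zZ] : 0 < #|Z| by move: e0 cZ; clear; lia.
    have := (trivIsetP tP) _ _ Q'P QP QQ' => /disjointFr /(_ (subsetP (proj1 hQ') _ zZ)).
    by rewrite (subsetP (proj1 hZ) _ zZ).
  rewrite -regZ; case: (ssH Z ZH) => [->|/mapP[u us' ->]]; last exact: c0t.
  by move: c0x; rewrite bx.
have Das : #|D| + a + 2 <= s by rewrite cD; move: hs; clear; lia.
have robP Q : Q \in P -> robust g s Q by move=> /gP[].
have degP Q u : Q \in P -> u \in Q -> s < #|nbr g u :&: Q|.
  move=> QP uQ; apply: robust_deg => //; first exact: robP.
  by have := core_in_card (proj2 (gP _ QP)); move: se; clear; lia.
have gsub := @sub_union_rel _ g r.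
have hsym := union_rel_sym gsym rsym.
have [c1 rc1 tc1] := thicken_route hsym gsub tP robP Das degP rc0 tc0.
have [c rc cD'] := spanning_route gsym girr hsym gsub covP robP Das ha rc1 tc1.
have cc : size c + #|D| = #|T|.
  have [_ uc Dc] := rc.
  have <- : #|[set z in c]| = size c by rewrite cardsE; exact/card_uniqP.
  have -> : [set z in c] = ~: D.
    by apply/setP => z; rewrite !inE; apply/idP/idP => [/Dc|/cD'].
  by rewrite addnC cardsC.
(* The ladder has [12 * a + 9] vertices, and its paths have every number of vertices from
   [10 * a + 7] to [12 * a + 9]. At the least [m] still in reach of [l], one more shortening, by at
   most [2 * a + 1], would fall out of reach; so [l - m] lies in this interval. *)
pose long m := `[< exists c', [/\ route (union_rel g r) D y x c', size c' = m & l <= m + (12 * a + 9)] >].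
have exl : exists m, long m.
  exists (size c); apply/asboolP; exists c; split=> //.
  by move: cc cD lT; clear; lia.
case: (ex_minnP exl) => m /asboolP[c' [rc' sc' lc']] mmin.
have lm : m + (10 * a + 7) <= l.
  have [h|h] := leqP m (2 * a + 2); first by move: h lbig; clear; lia.
  rewrite -sc' in h; have [c2 [rc2 s2 s2']] := shorten_route gsym girr gsub ha rc' h.
  have [h2|h2] := leqP l (size c2 + (12 * a + 9)).
    have /mmin : long (size c2) by apply/asboolP; exists c2.
    by rewrite leqNgt -sc' s2.
  by move: h2 s2'; rewrite sc'; clear; lia.
have [|q [pq lq uq sq cq]] := hq (l - m - (10 * a + 7)).
  by move: lc' lm; clear; lia.
have [pc' uc' Dc'] := rc'.
exists (x :: q ++ c'); split.
- rewrite /cycle rcons_cat cat_path lq pc' andbT; exact: sub_path gsub _ _ pq.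
- rewrite -cat_cons cat_uniq uq uc' andbT; apply/hasPn => z /Dc'; by apply: contra => /sq.
- rewrite /= size_cat -addSn; move: cq => /= ->; rewrite sc'; move: lm; clear; lia.
Qed.

(** * Random subsets *)

Section RandomSubsets.
Variables (R : realDomainType) (X : finType).
Implicit Types (p : R) (s : seq X) (f : {set X} -> R) (E S : {set X}).
Local Open Scope ring_scope.

(** Expectation over a random subset whose elements are exposed one after another; [expect_sum]
    equates it with the explicit weighted sum. The recursive form turns most rules into inductions
    on [s]. *)
Fixpoint expect p s f : R :=
  if s is x :: s' then p * expect p s' (fun E => f (x |: E)) + (1 - p) * expect p s' f
  else f set0.

Lemma set_in_cons x s : [set y in x :: s] = x |: [set y in s].
Proof. by apply/setP => y; rewrite !inE. Qed.

Lemma set_in_nil : [set y in [::]] = set0 :> {set X}.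
Proof. by apply/setP => y; rewrite !inE. Qed.

Lemma subset_setU1 x (A B : {set X}) : x \notin A -> (A \subset x |: B) = (A \subset B).
Proof.
move=> xA; apply/subsetP/subsetP => h y /[dup] yA /h; last by rewrite in_setU1 => ->; rewrite orbT.
by rewrite in_setU1 => /predU1P[yx|//]; rewrite yx (negPf xA) in yA.
Qed.

Lemma expect_sum p s f : uniq s ->
  \sum_(E : {set X} | E \subset [set x in s])
    p ^+ #|E| * (1 - p) ^+ (size s - #|E|) * f E = expect p s f.
Proof.
elim: s f => [|x s IH] f /=.
  move=> _; rewrite (big_pred1 set0) => [|E]; last by rewrite set_in_nil subset0.
  by rewrite cards0 sub0n !expr0 !mul1r.
case/andP=> xs us; rewrite -!IH // set_in_cons (bigID (fun E : {set X} => x \in E)) /=.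
have leE E : E \subset [set y in s] -> (#|E| <= size s)%N.
  by move=> /subset_leq_card/leq_trans; apply; rewrite cardsE card_size.
congr (_ + _).
  rewrite big_distrr /= (reindex_onto (fun E : {set X} => x |: E) (fun E => E :\ x)) /=; last first.
    by move=> E /andP[_ xE]; rewrite setD1K.
  apply: eq_big => [E|E /andP[/andP[_ _] /eqP EE]].
    rewrite setU11 andbT subUset sub1set setU11 /=.
    have [xE|xE] := boolP (x \in E); last by rewrite setU1K // eqxx andbT subset_setU1.
    have -> : ((x |: E) :\ x == E) = false.
      by apply/negP => /eqP EE; move: xE; rewrite -EE !inE eqxx.
    rewrite andbF; apply/esym/negP => /subsetP/(_ _ xE); by rewrite inE (negPf xs).
  have xE : x \notin E by rewrite -EE !inE eqxx.
  by rewrite cardsU1 xE /= subSS exprS !mulrA.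
rewrite big_distrr /=; apply: eq_big => [E|E /andP[ES xE]].
  have [xE|xE] := boolP (x \in E); last by rewrite andbT subset_setU1.
  rewrite andbF; apply/esym/negP => /subsetP/(_ _ xE); by rewrite inE (negPf xs).
have {}ES : E \subset [set y in s] by rewrite -(subset_setU1 _ xE).
by rewrite subSn ?leE // exprS mulrCA !mulrA.
Qed.

Lemma expect_ext p s f f' :
  (forall E, E \subset [set x in s] -> f E = f' E) -> expect p s f = expect p s f'.
Proof.
elim: s f f' => [|x s IH] f f' ff' /=; first by apply: ff'; rewrite sub0set.
rewrite (IH _ (fun E => f' (x |: E))) ?(IH f f') // => E ES; apply: ff'; rewrite set_in_cons.
  exact: subset_trans ES (subsetUr _ _).
exact: setUS.
Qed.

Lemma expect_cst p s (c : R) : expect p s (fun=> c) = c.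
Proof. by elim: s => //= x s ->; rewrite -mulrDl addrC subrK mul1r. Qed.

Lemma expectD p s f f' : expect p s (fun E => f E + f' E) = expect p s f + expect p s f'.
Proof. by elim: s f f' => //= x s IH f f'; rewrite !IH; ring. Qed.

Lemma expectZ p s c f : expect p s (fun E => c * f E) = c * expect p s f.
Proof. by elim: s f => //= x s IH f; rewrite !IH; ring. Qed.

Lemma expect_bigsum p s (I : Type) (r : seq I) (P : pred I) (F : I -> {set X} -> R) :
  expect p s (fun E => \sum_(i <- r | P i) F i E) = \sum_(i <- r | P i) expect p s (F i).
Proof.
elim: r => [|i r IH].
  by rewrite big_nil -[RHS](expect_cst p s); apply: expect_ext => E _; rewrite big_nil.
rewrite big_cons -IH; case: ifP => Pi.
  by rewrite -expectD; apply: expect_ext => E _; rewrite big_cons Pi.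
by apply: expect_ext => E _; rewrite big_cons Pi.
Qed.

Lemma expect_le p s f f' : 0 <= p <= 1 ->
  (forall E, E \subset [set x in s] -> f E <= f' E) -> expect p s f <= expect p s f'.
Proof.
move=> /andP[p0 p1]; elim: s f f' => [|x s IH] f f' ff' /=; first by apply: ff'; rewrite sub0set.
apply: lerD; apply: ler_wpM2l; rewrite ?subr_ge0 //; apply: IH => E ES; apply: ff'; rewrite set_in_cons.
  exact: setUS.
exact: subset_trans ES (subsetUr _ _).
Qed.

(** For a monotone [f] the branch in which [x] is chosen has the larger expectation, so shifting the
    weight [q - p] to it can only increase the total. *)
Lemma expect_mono p q s f : 0 <= p -> p <= q -> q <= 1 ->
  (forall E E' : {set X}, E \subset E' -> f E <= f E') -> expect p s f <= expect q s f.
Proof.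
move=> p0 pq q1; elim: s f => [|x s IH] f fm //=.
have h1 : expect p s (fun E => f (x |: E)) <= expect q s (fun E => f (x |: E)).
  by apply: IH => E E' EE'; apply: fm; exact: setUS.
have h2 := IH f fm.
have h3 : expect p s f <= expect p s (fun E => f (x |: E)).
  apply: expect_le => [|E _]; last by apply: fm; exact: subsetUr.
  by rewrite p0 (le_trans pq q1).
move: h1 h2 h3; set A := expect p s _; set B := expect q s _.
set C := expect p s f; set D := expect q s f => h1 h2 h3.
have : 0 <= q * (B - A) + (1 - q) * (D - C) + (q - p) * (A - C).
  by rewrite !addr_ge0 // mulr_ge0 ?subr_ge0 // (le_trans p0 pq).
lra.
Qed.

Lemma expect_avoid p s (S : {set X}) :
  expect p s (fun E => [disjoint S & E]%:R) = (1 - p) ^+ count (mem S) s.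
Proof.
elim: s => [|x s IH] /=; first by rewrite -setI_eq0 setI0 eqxx.
rewrite IH; case xS: (x \in S) => /=.
  rewrite [expect _ _ _](@expect_ext _ _ _ (fun=> 0)) ?expect_cst => [|E _].
    by rewrite mulr0 add0r add1n exprS.
  rewrite -setI_eq0; have -> : (S :&: (x |: E) == set0) = false => //.
  by apply/negP => /eqP/setP/(_ x); rewrite !inE xS eqxx.
rewrite [expect _ _ _](@expect_ext _ _ _ (fun E => [disjoint S & E]%:R)) ?IH => [|E _].
  by rewrite add0n -mulrDl addrC subrK mul1r.
by rewrite -!setI_eq0 setIUr setU_eq0 setI_eq0 disjoint_sym disjoints1 xS.
Qed.

Lemma expect_contain p s (S : {set X}) : uniq s ->
  expect p s (fun E => (S \subset E)%:R) =
    if S \subset [set x in s] then p ^+ #|S| else 0.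
Proof.
elim: s S => [|x s IH] S /=.
  by rewrite set_in_nil subset0; case: eqP => // ->; rewrite cards0 expr0.
case/andP=> xs us; rewrite IH // set_in_cons.
have xS' : x \notin [set y in s] by rewrite inE.
have [xS|xS] := boolP (x \in S).
  rewrite [expect _ _ _](@expect_ext _ _ _ (fun E => (S :\ x \subset E)%:R)) => [|E _]; last first.
    by rewrite subDset.
  rewrite IH // subDset.
  have -> : (S \subset [set y in s]) = false.
    by apply/negP => /subsetP/(_ _ xS); rewrite (negPf xS').
  by rewrite mulr0 addr0 (cardsD1 x S) xS add1n exprS; case: ifP => _ //; rewrite mulr0.
rewrite [expect _ _ _](@expect_ext _ _ _ (fun E => (S \subset E)%:R)) => [|E _]; last first.
  by rewrite subset_setU1.
by rewrite IH // subset_setU1 // -mulrDl addrC subrK mul1r.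
Qed.

End RandomSubsets.

(** * Events of the randomly perturbed graph *)

Section Union.
Variables (R : realType) (n : nat) (G : {set {set 'I_n}}).
Local Open Scope ring_scope.

Lemma prob_unionE (p : R) (P : {set {set 'I_n}} -> bool) :
  prob_union G p P = expect p (enum (pairs n)) (fun E => (P (G :|: E))%:R).
Proof.
rewrite -expect_sum ?enum_uniq // -cardE.
by rewrite (_ : [set x in enum (pairs n)] = pairs n) //; apply/setP => x; rewrite inE mem_enum.
Qed.

Lemma prob_unionC (p : R) (P : {set {set 'I_n}} -> bool) :
  prob_union G p (fun E => ~~ P E) = 1 - prob_union G p P.
Proof.
rewrite !prob_unionE -[X in X - _](expect_cst p (enum (pairs n)) 1) -mulN1r -expectZ -expectD.
by apply: expect_ext => E _; case: (P _); rewrite ?mulr1 ?mulr0 ?subrr ?addr0.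
Qed.

Lemma prob_union_le1 (p : R) (P : {set {set 'I_n}} -> bool) :
  0 <= p <= 1 -> prob_union G p P <= 1.
Proof.
move=> p01; rewrite prob_unionE -[X in _ <= X](expect_cst p (enum (pairs n)) 1).
by apply: expect_le => // E _; case: (P _).
Qed.

Lemma prob_union_ge0 (p : R) (P : {set {set 'I_n}} -> bool) :
  0 <= p <= 1 -> 0 <= prob_union G p P.
Proof.
move=> p01; rewrite prob_unionE -[X in X <= _](expect_cst p (enum (pairs n)) 0).
by apply: expect_le => // E _; case: (P _).
Qed.

Lemma expect_avoid_pairs (p : R) (S : {set {set 'I_n}}) : S \subset pairs n ->
  expect p (enum (pairs n)) (fun E => [disjoint S & E]%:R) = (1 - p) ^+ #|S|.
Proof.
move=> SP; rewrite expect_avoid; congr (_ ^+ _); rewrite -size_filter cardE.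
apply/perm_size/uniq_perm => [||x].
- exact/filter_uniq/enum_uniq.
- exact: enum_uniq.
rewrite mem_filter !mem_enum /=; have [xS|//] := boolP (x \in S).
by rewrite (subsetP SP).
Qed.

End Union.

(** * Random edges across cuts *)

Section GraphFacts.
Variable n : nat.
Implicit Types (G E : {set {set 'I_n}}).

Lemma adj_sym E : symmetric (adj E).
Proof. by move=> u v; rewrite /adj setUC. Qed.

Lemma adj_irr E : is_graph E -> irreflexive (adj E).
Proof.
move=> /subsetP gE u; apply/negP => /gE; by rewrite inE setUid cards1.
Qed.

Lemma adjU G E u v : adj (G :|: E) u v = adj G u v || adj E u v.
Proof. by rewrite /adj in_setU. Qed.

Lemma mindeg_le E v : mindeg E <= deg E v.
Proof.
rewrite /mindeg; have : v \in index_enum 'I_n by rewrite mem_index_enum.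
elim: (index_enum _) => // u r IH; rewrite inE big_cons => /predU1P[<-|/IH h].
  exact: geq_minl.
exact: leq_trans (geq_minr _ _) h.
Qed.

Lemma alpha_leP E a : alpha E <= a -> alpha_le (adj E) a.
Proof.
move=> Ea S aS; have : ~~ independent E S.
  apply: contraL aS => iS; rewrite -leqNgt; apply: leq_trans Ea.
  exact: (@leq_bigmax_cond _ (independent E) (fun S : {set 'I_n} => #|S|)).
rewrite negb_forall_in => /exists_inP[x xS]; rewrite negb_forall_in => /exists_inP[y yS].
by rewrite negbK => xy; exists x, y.
Qed.

Lemma has_cycle_of_length E l : 0 < l -> cycle_of_length (adj E) l -> has_cycle E l.
Proof.
move=> l0 [[|x c] [cc uc sz]]; first by rewrite -sz in l0.
subst l; apply/existsP; exists [ffun i : 'I_(size (x :: c)) => nth x (x :: c) i].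
apply/andP; split.
  apply/injectiveP => i j; rewrite !ffunE => /eqP; rewrite nth_uniq // => /eqP.
  exact: val_inj.
apply/forallP => i; rewrite !ffunE.
have il : i < (size c).+1 := ltn_ord i.
move: cc => /= /(pathP x)/(_ i); rewrite size_rcons => /(_ il).
rewrite -rcons_cons !nth_rcons [size (x :: c)]/= il.
have [ic|ic] := ltnP i (size c); first by rewrite modn_small.
have {}ic : i = size c :> nat by move: ic il; clear; lia.
by rewrite ic eqxx modnn.
Qed.

Lemma has_cycleS E E' l : E \subset E' -> has_cycle E l -> has_cycle E' l.
Proof.
move=> EE' /existsP[f /andP[fi /forallP fa]]; apply/existsP; exists f; rewrite fi /=.
by apply/forallP => i; apply: (subsetP EE'); exact: fa.
Qed.

Lemma pancyclicS E E' : E \subset E' -> pancyclic E -> pancyclic E'.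
Proof.
move=> EE' /forallP h; apply/forallP => l; apply/implyP => l3.
by apply: has_cycleS EE' _; exact: (implyP (h l)).
Qed.

End GraphFacts.

(** * Sizes of cuts between hubs and the probability of avoiding them *)

Section Cuts.
Variables (R : realType) (n : nat) (H : {set {set 'I_n}}) (Y : {set 'I_n}).
Hypotheses (tH : trivIset H) (YH : Y \subset cover H).
Implicit Types W : {set {set 'I_n}}.

Definition side W : {set 'I_n} := [set x in Y | pblock H x \in W].

Definition cut W : {set {set 'I_n}} :=
  [set [set xy.1; xy.2] | xy in setX (side W) (side (H :\: W))].

Lemma sideP W x y : x \in side W -> y \in side (H :\: W) -> x != y.
Proof.
rewrite !inE => /andP[_ xW] /and3P[_ yW _].
by apply: contraNneq yW => <-.
Qed.

Lemma cut_pairs W : cut W \subset pairs n.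
Proof.
apply/subsetP => e /imsetP[[x y] /setXP[/= xW yW] ->].
by rewrite inE cards2 (sideP xW yW).
Qed.

Lemma card_cut W : #|cut W| = #|side W| * #|side (H :\: W)|.
Proof.
rewrite -cardsX card_in_imset // => -[x y] [x' y'] /setXP[/= xW yW] /setXP[/= xW' yW'] E.
have : x \in [set x'; y'] by rewrite -E !inE eqxx.
rewrite !inE (negPf (sideP xW yW')) orbF => /eqP xx.
have : y \in [set x'; y'] by rewrite -E !inE eqxx orbT.
by rewrite !inE -xx eq_sym (negPf (sideP xW yW)) /= => /eqP ->; rewrite xx.
Qed.

Lemma card_sideE W : W \subset H -> #|side W| = \sum_(Z in W) #|Y :&: Z|.
Proof.
move=> WH; rewrite -sum1_card (partition_big (pblock H) (mem W)) /=; last first.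
  by move=> x; rewrite inE => /andP[].
apply: eq_bigr => Z ZW; have ZH := subsetP WH _ ZW.
rewrite -sum1_card; apply: eq_bigl => x.
rewrite !inE; case xY: (x \in Y) => //=; have xH := subsetP YH _ xY.
apply/andP/idP => [[_ /eqP <-]|xZ]; first by rewrite mem_pblock.
by rewrite (def_pblock tH ZH xZ).
Qed.

Lemma card_side W m : W \subset H -> (forall Z, Z \in H -> m <= #|Y :&: Z|) ->
  #|W| * m <= #|side W|.
Proof.
move=> WH hm; rewrite card_sideE // -sum_nat_const; apply: leq_sum => Z ZW.
by apply: hm; exact: (subsetP WH).
Qed.

Lemma card_zone : #|Y| = \sum_(Z in H) #|Y :&: Z|.
Proof.
rewrite -card_sideE //; apply: eq_card => x; rewrite inE.
by case xY: (x \in Y) => //=; rewrite pblock_mem // (subsetP YH).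
Qed.

Lemma card_side_compl W : W \subset H -> #|side W| + #|side (H :\: W)| = #|Y|.
Proof.
move=> WH; rewrite -(cardsID [set x | pblock H x \in W] Y); congr (_ + _); apply: eq_card => x.
  by rewrite !inE.
rewrite !inE; case xY: (x \in Y) => /=; last by rewrite andbF.
by rewrite pblock_mem ?(subsetP YH) // !andbT.
Qed.

(** The larger side contains half of [Y] and the smaller one at least [m] vertices per hub, so the
    cut has at least [M] pairs for every hub on the smaller side. *)
Lemma card_cut_ge W m M : W \subset H -> (forall Z, Z \in H -> m <= #|Y :&: Z|) ->
  2 * M <= m * #|Y| ->
  (#|W| * M <= #|cut W|) || (#|H :\: W| * M <= #|cut W|).
Proof.
move=> WH hm hM; rewrite card_cut.
have h1 := card_side WH hm; have h2 := card_side (subsetDl H W) hm.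
have := card_side_compl WH; move: h1 h2; move: #|W| #|H :\: W| #|side W| #|side (H :\: W)| #|Y| hM.
clear => w w' x y N hM h1 h2 xyN.
have aux u v b : u * m <= v -> N <= 2 * b -> u * M <= v * b.
  move=> h3 h4.
  have h5 : m * N <= m * (2 * b) by rewrite leq_mul2l h4 orbT.
  have h6 : M <= m * b by move: hM h5; clear; lia.
  have h7 : u * M <= u * (m * b) by rewrite leq_mul2l h6 orbT.
  have h8 : u * m * b <= v * b by rewrite leq_mul2r h3 orbT.
  by move: h7 h8; clear; lia.
have [xy|yx] := leqP x y.
  by rewrite aux //; move: xyN xy; clear; lia.
apply/orP; right; rewrite [x * y]mulnC; apply: aux => //; move: xyN yx; clear; lia.
Qed.

Local Open Scope ring_scope.

Lemma sum_subset_pow (I : finType) (A : {set I}) (q : R) :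
  \sum_(W : {set I} | W \subset A) q ^+ #|W| = (1 + q) ^+ #|A|.
Proof.
rewrite exprDn (partition_big (fun W : {set I} => inord #|W| : 'I_#|A|.+1) xpredT) //=.
apply: eq_bigr => k _; rewrite expr1n mul1r -cards_draws -sumr_const.
apply: eq_big => [W|W /andP[WA /eqP <-]].
  rewrite inE; case WA: (W \subset A) => //=.
  by rewrite -val_eqE /= inordK // ltnS subset_leq_card.
by rewrite inordK // ltnS subset_leq_card.
Qed.

(** A cut is avoided with probability at most [q ^+ #|W| + q ^+ #|H :\: W|], where
    [q = (1 - p) ^+ M]. Complementation reduces the second sum to the first, which is at most the
    binomial expansion of [(1 + q) ^+ #|H|] without its term at [set0]. *)
Lemma expect_no_crossing (p : R) (m M : nat) : 0 <= p <= 1 ->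
  (forall Z, Z \in H -> m <= #|Y :&: Z|)%N -> (2 * M <= m * #|Y|)%N ->
  expect p (enum (pairs n)) (fun E =>
    \sum_(W : {set {set 'I_n}} | [&& W \subset H, W != set0 & W != H]) [disjoint cut W & E]%:R)
  <= 2 * ((1 + (1 - p) ^+ M) ^+ #|H| - 1).
Proof.
move=> /andP[p0 p1] hm hM; rewrite expect_bigsum.
set q := (1 - p) ^+ M.
have q0 : 0 <= q by rewrite exprn_ge0 // subr_ge0.
have r1 : 0 <= 1 - p <= 1 by rewrite subr_ge0 p1 lerBlDr lerDl.
have total : \sum_(W : {set {set 'I_n}} | (W \subset H) && (W != set0)) q ^+ #|W| = (1 + q) ^+ #|H| - 1.
  rewrite -sum_subset_pow [in RHS](bigD1 (set0 : {set {set 'I_n}})) ?sub0set //= cards0 expr0.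
  by rewrite addrC addrK.
apply: le_trans (_ : \sum_(W : {set {set 'I_n}} | [&& W \subset H, W != set0 & W != H])
    (q ^+ #|W| + q ^+ #|H :\: W|) <= _).
  apply: ler_sum => W /and3P[WH _ _]; rewrite expect_avoid_pairs ?cut_pairs //.
  have /orP[h|h] := card_cut_ge WH hm hM.
    apply: le_trans (_ : q ^+ #|W| <= _); last by rewrite lerDl exprn_ge0.
    rewrite /q -exprM mulnC; apply: ler_wiXn2l; rewrite ?(andP r1) //; by case/andP: r1.
  apply: le_trans (_ : q ^+ #|H :\: W| <= _); last by rewrite lerDr exprn_ge0.
  by rewrite /q -exprM mulnC; apply: ler_wiXn2l => //; case/andP: r1.
rewrite big_split /= mulr_natl mulr2n -total; apply: lerD.
  rewrite [X in X <= _]big_mkcond [X in _ <= X]big_mkcond /=; apply: ler_sum => W _.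
  by case: (W \subset H); case: (W != set0); case: (W != H) => //=; rewrite exprn_ge0.
rewrite [X in _ <= X](reindex_onto (fun W => H :\: W) (fun W => H :\: W)) /=; last first.
  by move=> W /andP[WH _]; rewrite setDDr setDv set0U (setIidPr WH).
rewrite [X in X <= _]big_mkcond [X in _ <= X]big_mkcond /=; apply: ler_sum => W _.
case: ifP => [/and3P[WH W0 WnH]|_]; last first.
  by case: ifP => _ //; exact: exprn_ge0.
rewrite subsetDl setD_eq0 setDDr setDv set0U (setIidPr WH) eqxx andbT /=.
by rewrite ifT //; apply: contra WnH => HW; rewrite eqEsubset WH.
Qed.

End Cuts.

(** * Two disjoint zones meeting every hub *)

Section Halves.
Variables (T : finType) (H : {set {set T}}).
Hypothesis tH : trivIset H.

Definition half (Z : {set T}) : {set T} := [set z in take #|Z|./2 (enum Z)].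

Definition zone1 : {set T} := \bigcup_(Z in H) half Z.
Definition zone2 : {set T} := cover H :\: zone1.

Lemma half_sub Z : half Z \subset Z.
Proof. by apply/subsetP => z; rewrite inE => /mem_take; rewrite mem_enum. Qed.

Lemma card_half Z : #|half Z| = #|Z|./2.
Proof.
rewrite cardsE (card_uniqP (take_uniq _ (enum_uniq _))) size_takel // -cardE.
by clear; lia.
Qed.

Lemma zone1_sub : zone1 \subset cover H.
Proof.
apply/bigcupsP => Z ZH; apply: subset_trans (half_sub Z) _; exact: bigcup_sup.
Qed.

Lemma zone1I Z : Z \in H -> zone1 :&: Z = half Z.
Proof.
move=> ZH; apply/setP => z; rewrite in_setI; apply/andP/idP => [[/bigcupP[Z' Z'H zZ'] zZ]|zZ].
  have zZ0 := subsetP (half_sub Z') _ zZ'.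
  by rewrite -(def_pblock tH ZH zZ) (def_pblock tH Z'H zZ0).
by rewrite (subsetP (half_sub Z)) //; split=> //; apply/bigcupP; exists Z.
Qed.

(** The factor [3] instead of [2] absorbs the rounding in [#|Z|./2]. *)
Lemma card_zoneI Z : Z \in H -> 1 < #|Z| ->
  #|Z| <= 3 * #|zone1 :&: Z| /\ #|Z| <= 3 * #|zone2 :&: Z|.
Proof.
move=> ZH Z2; have c1 := card_half Z; rewrite -(zone1I ZH) in c1.
have -> : zone2 :&: Z = Z :\: zone1.
  apply/setP => z; rewrite in_setI !in_setD.
  case zZ: (z \in Z); last by rewrite !andbF.
  have -> : z \in cover H by apply/bigcupP; exists Z.
  by rewrite !andbT.
by have := cardsID zone1 Z; rewrite setIC c1; move: Z2; clear; lia.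
Qed.

End Halves.

(** * Probability of failure for a fixed number of vertices *)

Section FiniteBound.
Local Open Scope ring_scope.

Lemma sum_indicator_ge1 (R : numDomainType) (I : finType) (P F : pred I) i :
  P i -> F i -> 1 <= \sum_(j | P j) (F j)%:R :> R.
Proof.
by move=> Pi Fi; rewrite (bigD1 i) //= Fi lerDl; apply: sumr_ge0 => j _; rewrite ler0n.
Qed.

Variables (R : realType) (n : nat) (G : {set {set 'I_n}}).

Lemma crossing_cut (H : {set {set 'I_n}}) (Y : {set 'I_n}) (E : {set {set 'I_n}}) :
  E \subset pairs n -> (forall x y z, adj E x y -> adj E x z -> y = z) ->
  (forall W : {set {set 'I_n}}, [&& W \subset H, W != set0 & W != H] -> ~~ [disjoint cut H Y W & E]) ->
  crossing (partner (adj E)) (pblock H) (ports_in (adj E) Y) H.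
Proof.
move=> EP match_ hcut W WH W0 WnH.
have := hcut W; rewrite WH W0 WnH => /(_ isT); rewrite -setI_eq0 => /set0Pn[e].
case/setIP=> /imsetP[[x y] /setXP[/= xW yW] ->] xyE.
have xy : x != y := sideP xW yW.
have axy : adj E x y by []. have ayx : adj E y x by rewrite adj_sym.
move: xW yW; rewrite !inE => /andP[xY xW] /and3P[yY yW yH].
exists y; rewrite !inE (partnerE match_ ayx) (partnerE match_ axy) xY yY yW yH xW.
by rewrite xy eq_sym xy.
Qed.

(** [h] is the number of hubs, and [M] bounds the pairs in a cut from below, per hub on its smaller
    side. Failure requires two random edges sharing a vertex, or an uncrossed cut in one of the two
    zones; each zone contributes one half of the last term. *)
Lemma pancyclic_failure (p : R) (a e : nat) :
  is_graph G -> 0 <= p <= 1 -> (4 * e <= mindeg G)%N -> (alpha G <= a)%N -> (0 < n)%N ->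
  (30 * 1024 * (n * n) <= e * e * e)%N -> (60 * 128 * (n * a) <= e * e)%N ->
  exists h M : nat, [/\ (h * e <= 8 * n)%N, (e * n <= 2304 * M)%N &
    1 - prob_union G p (@pancyclic n) <=
      n%:R ^+ 3 * p ^+ 2 + 4 * ((1 + (1 - p) ^+ M) ^+ h - 1)].
Proof.
move=> gG p01 hmin halpha n0 he3 he2.
have hdeg u : (4 * e <= #|nbr (adj G) u|)%N by apply: leq_trans hmin (mindeg_le G u).
have en : (e <= n)%N.
  apply: leq_trans (_ : #|nbr (adj G) (Ordinal n0)| <= _)%N; last by rewrite -[X in (_ <= X)%N]card_ord max_card.
  by apply: leq_trans (hdeg _); clear; lia.
have e1 : (30 * 1024 * n <= e * e)%N.
  rewrite -(leq_pmul2r n0) -[X in (X <= _)%N]mulnA; apply: leq_trans he3 _; by rewrite leq_mul2l en orbT.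
have e0 : (0 < e)%N by move: e1 n0; clear; case: e => //; lia.
have e2 : (30 * 1024 <= e)%N.
  rewrite -(leq_pmul2r n0); apply: leq_trans e1 _; by rewrite leq_mul2l en orbT.
(* Of order [e ^ 2 / n], with [64] in place of [32] to leave room for the [4] in
   [32 * (s + 4) * n <= e * e]. *)
pose s := ((e * e) %/ (64 * n))%N.
have s1 : (64 * n * s <= e * e)%N by rewrite mulnC leq_divM.
have s2 : (e * e <= 128 * (n * s))%N.
  have : (e * e < (s.+1) * (64 * n))%N by rewrite ltn_ceil // muln_gt0.
  by move: s1 e1; clear; lia.
clearbody s.
have s3 : (32 * (s + 4) * n <= e * e)%N by move: s1 e1; clear; lia.
have s4 : (s * n <= e * e)%N by move: s1; clear; lia.
have [P [tP covP gP]] : exists P : {set {set 'I_n}}, [/\ trivIset P, cover P = [set: 'I_n] &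
    forall Q, Q \in P -> robust (adj G) s Q /\ core_in (adj G) e Q].
  by apply: (robust_partition (adj_sym G)) => //; rewrite card_ord.
have [||H [tH gH PH cH]] := hub_family (adj_sym G) (adj_irr gG) e0 (s := s) (P := P) _ _ tP (fun Q QP => proj2 (gP Q QP)).
- by rewrite card_ord.
- by move=> u; apply: leq_trans (hdeg u); clear; lia.
rewrite card_ord in cH.
have cHn : (#|cover H| <= n)%N by rewrite -[X in (_ <= X)%N]card_ord max_card.
have hH : (#|H| * e <= 8 * n)%N.
  apply: leq_trans (_ : 8 * #|cover H| <= _)%N; last by rewrite leq_mul2l cHn orbT.
  rewrite -(eqP tH) big_distrr /= -sum_nat_const; apply: leq_sum => Z ZH.
  by have [_] := gH _ ZH.
(* Each of the three terms is at most a third of [s]. *)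
have hs : (10 * #|H| + 20 * a + 30 <= s)%N.
  have k0 : (0 < 128 * n)%N by rewrite muln_gt0.
  have k1 : (30 * #|H| <= s)%N.
    have k0' : (0 < 128 * n * e)%N by rewrite muln_gt0 k0.
    rewrite -(leq_pmul2r k0').
    have h1 : (e * e * e <= 128 * (n * s) * e)%N by rewrite leq_mul2r s2 orbT.
    have h2 : (30 * 128 * n * (#|H| * e) <= 30 * 128 * n * (8 * n))%N by rewrite leq_mul2l hH orbT.
    by move: h1 h2 he3; clear; lia.
  have k2 : (60 * a <= s)%N by rewrite -(leq_pmul2r k0); move: s2 he2; clear; lia.
  have k3 : (90 <= s)%N by rewrite -(leq_pmul2r k0); move: s2 e1; clear; lia.
  by move: k1 k2 k3; clear; lia.
pose Y1 := zone1 H; pose Y2 := zone2 H.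
have Y1H : Y1 \subset cover H := zone1_sub H.
have Y2H : Y2 \subset cover H := subsetDl _ _.
have dis : [disjoint Y1 & Y2].
  by rewrite disjoint_sym disjoints_subset; apply/subsetP => z; rewrite in_setC in_setD => /andP[].
have zI Z : Z \in H -> (#|Z| <= 3 * #|Y1 :&: Z|)%N /\ (#|Z| <= 3 * #|Y2 :&: Z|)%N.
  move=> ZH; apply: card_zoneI => //; have [_] := gH _ ZH; by move: e2; clear; lia.
(* A hub has at least [e / 8] vertices and the hubs cover at least [n / 2]; a zone holds at least a
   third of either, and [M] is half the product. *)
pose m := (e %/ 24)%N; pose N0 := (n %/ 6)%N; pose M := ((m * N0) %/ 2)%N.
have hm Z : Z \in H -> (m <= #|Y1 :&: Z|)%N /\ (m <= #|Y2 :&: Z|)%N.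
  by move=> ZH; have [_] := gH _ ZH; have [] := zI _ ZH; rewrite /m; clear; lia.
have cov3 (Y : {set 'I_n}) : Y \subset cover H -> (forall Z, Z \in H -> #|Z| <= 3 * #|Y :&: Z|)%N -> (2 * M <= m * #|Y|)%N.
  move=> YH hY; apply: leq_trans (_ : m * N0 <= _)%N; first by rewrite /M mulnC leq_divM.
  rewrite leq_mul2l; apply/orP; right.
  have : (#|cover H| <= 3 * #|Y|)%N.
    by rewrite (card_zone tH YH) -(eqP tH) big_distrr /=; apply: leq_sum => Z; exact: hY.
  by move: cH; rewrite /N0; clear; lia.
have n2 : (30 * 1024 <= n)%N := leq_trans e2 en.
exists #|H|, M; split=> //.
  have h1 : (e <= 48 * m)%N by rewrite /m; move: e2; clear; lia.
  have h2 : (n <= 12 * N0)%N by rewrite /N0; move: n2; clear; lia.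
  have h3 : (e * n <= 576 * (m * N0))%N.
    by have := leq_mul h1 h2; move: (m) (N0) => x y; clear; lia.
  have h4 : (2 <= m * N0)%N.
    have : (2 <= m)%N by rewrite /m; move: e2; clear; lia.
    have : (1 <= N0)%N by rewrite /N0; move: n2; clear; lia.
    by move=> h5 h6; exact: (leq_mul h6 h5).
  by rewrite /M; move: h3 h4; move: (m * N0)%N => x; clear; lia.
rewrite -prob_unionC prob_unionE.
(* Without cherries the random edges form a matching. A triple that repeats its centre [t.1.1] names
   a singleton, which is never a random edge, so it contributes nothing to the expectation. *)
pose cherry (t : 'I_n * 'I_n * 'I_n) : {set {set 'I_n}} := [set [set t.1.1; t.1.2]; [set t.1.1; t.2]].
pose B1 (E : {set {set 'I_n}}) : R := \sum_(t : 'I_n * 'I_n * 'I_n | t.1.2 != t.2) (cherry t \subset E)%:R.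
pose B2 Y (E : {set {set 'I_n}}) : R :=
  \sum_(W : {set {set 'I_n}} | [&& W \subset H, W != set0 & W != H]) [disjoint cut H Y W & E]%:R.
have B1p E : 0 <= B1 E by apply: sumr_ge0 => ? _; rewrite ler0n.
have B2p Y E : 0 <= B2 Y E by apply: sumr_ge0 => ? _; rewrite ler0n.
apply: le_trans (_ : expect p (enum (pairs n)) (fun E => B1 E + (B2 Y1 E + B2 Y2 E)) <= _).
  apply: expect_le => // E; rewrite (_ : [set x in enum (pairs n)] = pairs n); last first.
    by apply/setP => x; rewrite inE mem_enum.
  move=> EP; case pan: (pancyclic _) => /=; first by rewrite !addr_ge0.
  have [/existsP[t /andP[t1 t2]]|nb1] := boolP [exists t, (t.1.2 != t.2) && (cherry t \subset E)].
    have h := @sum_indicator_ge1 R _ (fun t : 'I_n * 'I_n * 'I_n => t.1.2 != t.2) (fun t => cherry t \subset E) t t1 t2.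
    by apply: le_trans h _; rewrite lerDl addr_ge0.
  have match_ x y z : adj E x y -> adj E x z -> y = z.
    move=> xy xz; apply/eqP; apply: contraNT nb1 => yz; apply/existsP; exists (x, y, z).
    rewrite /= yz /cherry subUset !sub1set; exact/and3P.
  have cutP Y : (1 <= B2 Y E) \/ crossing (partner (adj E)) (pblock H) (ports_in (adj E) Y) H.
    have [/existsP[W /andP[W1 W2]]|nb2] := boolP [exists W : {set {set 'I_n}}, [&& W \subset H, W != set0 & W != H] && [disjoint cut H Y W & E] ].
      by left; exact: (@sum_indicator_ge1 R _ (fun W : {set {set 'I_n}} => [&& W \subset H, W != set0 & W != H])
        (fun W : {set {set 'I_n}} => [disjoint cut H Y W & E]) W W1 W2).
    right; apply: crossing_cut => // W hW; apply: contraNN nb2 => hd.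
    by apply/existsP; exists W; rewrite hW.
  have [h|cr1] := cutP Y1; first by apply: le_trans h _; have := B1p E; have := B2p Y2 E; lra.
  have [h|cr2] := cutP Y2; first by apply: le_trans h _; have := B1p E; have := B2p Y1 E; lra.
  move/negP: pan; case; apply/forallP => l; apply/implyP => l3.
  apply: has_cycle_of_length; first exact: leq_trans l3.
  have [|||c [cc uc sz]] := pancyclic_union (adj_sym G) (adj_irr gG) (adj_sym E) match_ e0 (alpha_leP halpha) hdeg _ hs tP covP gP tH gH PH _ dis Y1H Y2H cr1 cr2 (l := l).
  - by rewrite card_ord.
  - by rewrite card_ord.
  - by rewrite l3 card_ord -ltnS ltn_ord.
  exists c; split=> //; case: c cc {uc sz} => //= x c.
  by apply: sub_path => u v; rewrite adjU.
rewrite !expectD; apply: lerD.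
  rewrite expect_bigsum.
  apply: le_trans (_ : \sum_(t : 'I_n * 'I_n * 'I_n | t.1.2 != t.2) p ^+ 2 <= _).
    apply: ler_sum => -[[x y] z] /= yz; rewrite expect_contain ?enum_uniq //.
    rewrite (_ : [set x in enum (pairs n)] = pairs n); last by apply/setP => w; rewrite inE mem_enum.
    case: ifP => [|_]; last by apply: exprn_ge0; case/andP: p01.
    rewrite /cherry /= subUset !sub1set !inE !cards2 => /andP[xy xz].
    rewrite (_ : ([set x; y] != [set x; z]) = true) //.
    apply/eqP => E; have : y \in [set x; z] by rewrite -E !inE eqxx orbT.
    by rewrite !inE (negPf yz) orbF => /eqP yx; rewrite yx eqxx in xy.
  apply: le_trans (_ : \sum_(t : 'I_n * 'I_n * 'I_n) p ^+ 2 <= _).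
    rewrite [X in _ <= X](bigID (fun t : 'I_n * 'I_n * 'I_n => t.1.2 != t.2)) /= lerDl.
    by apply: sumr_ge0 => t _; apply: exprn_ge0; case/andP: p01.
  have c3 : #|{: 'I_n * 'I_n * 'I_n}| = (n * n * n)%N by rewrite !card_prod !card_ord.
  have -> : n%:R ^+ 3 * p ^+ 2 = (n * n * n)%:R * p ^+ 2 by rewrite !natrM; ring.
  by rewrite sumr_const c3 mulr_natl.
have four (x : R) : 4 * x = 2 * x + 2 * x by ring.
rewrite four; apply: lerD; apply: expect_no_crossing => //.
- by move=> Z ZH; have [h _] := hm Z ZH; exact: h.
- by apply: cov3 => // Z ZH; have [] := zI Z ZH.
- by move=> Z ZH; have [_ h] := hm Z ZH; exact: h.
- by apply: cov3 => // Z ZH; have [] := zI Z ZH.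
Qed.

End FiniteBound.

(** * Upper bound on the threshold *)

Section Asymptotics.
Local Open Scope ring_scope.
Local Open Scope classical_set_scope.
Variable R : realType.

Lemma expR_le_1D2x (x : R) : 0 <= x <= 2^-1 -> expR x - 1 <= 2 * x.
Proof.
move=> /andP[x0 x1]; have h := expR_ge1Dx (- x); have e0 := expR_gt0 x.
rewrite expRN in h.
have h2 : expR x * (1 - x) <= 1.
  by have := ler_wpM2l (ltW e0) h; rewrite mulfV // lt0r_neq0.
nra.
Qed.

Lemma expRN_le_inv (x : R) : 0 < x -> expR (- x) <= x^-1.
Proof.
move=> x0; rewrite expRN lef_pV2 ?posrE ?expR_gt0 //.
by apply: le_trans (expR_ge1Dx x); rewrite lerDr.
Qed.

Lemma one_sub_pow_le (p : R) (M : nat) : 0 <= p <= 1 -> (1 - p) ^+ M <= expR (- (p * M%:R)).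
Proof.
move=> /andP[p0 p1]; rewrite -mulNr expRM_natr; apply: lerXn2r; rewrite ?nnegrE ?subr_ge0 ?expR_ge0 //.
exact: expR_ge1Dx.
Qed.

(** The last bound writes [n ^ (1/3)] as [expR (ln n / 3)], ready for comparison with powers of
    [ln n]. *)
Lemma density_bounds (n : nat) (c delta : R) : (0 < n)%N -> 0 < c ->
  c * (n%:R `^ (- (1 / 3)) : R) <= delta ->
  [/\ 0 < delta, c ^+ 3 <= delta ^+ 3 * n%:R &
      c ^+ 2 * expR (ln n%:R / 3) <= delta ^+ 2 * n%:R].
Proof.
move=> n0 c0; have nR : 0 < n%:R :> R by rewrite ltr0n.
have nR0 := ltW nR.
rewrite /powR (negPf (lt0r_neq0 nR)).
set L := ln n%:R; have nE : n%:R = expR L :> R by rewrite lnK.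
set w := expR _ => hw; have w0 : 0 < w := expR_gt0 _.
have w3 : w ^+ 3 * n%:R = 1.
  have e3 : 3%:R * (- (1 / 3) * L) + L = 0 by field.
  by rewrite nE -expRM_natl -expRD e3 expR0.
have w2 : w ^+ 2 * n%:R = expR (L / 3).
  by rewrite nE -expRM_natl -expRD; congr expR; field.
have cw : 0 < c * w by rewrite mulr_gt0.
have d0 : 0 < delta by exact: lt_le_trans hw.
split=> //.
  apply: le_trans (_ : (c * w) ^+ 3 * n%:R <= _); first by rewrite exprMn -mulrA w3 mulr1.
  by apply: ler_wpM2r => //; apply: lerXn2r => //; rewrite nnegrE ltW.
apply: le_trans (_ : (c * w) ^+ 2 * n%:R <= _); first by rewrite -w2 mulrA -exprMn.
by apply: ler_wpM2r => //; apply: lerXn2r => //; rewrite nnegrE ltW.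
Qed.

(** The first term comes from the cherries, at most [(ln n) ^ 4 / n ^ (1/3)] after thinning, and the
    second from the uncrossed cuts. *)
Lemma pancyclic_bound (n : nat) (G : {set {set 'I_n}}) (p delta A : R) :
  let K := 256 * 256 in
  (0 < n)%N -> is_graph G -> 0 <= p <= 1 ->
  256 * (n%:R `^ (- (1 / 3)) : R) <= delta ->
  delta * n%:R <= (mindeg G)%:R ->
  ((alpha G)%:R : R) <= (1000 * 1000)^-1 * delta ^+ 2 * n%:R ->
  K * ln delta^-1 / (delta * n%:R ^+ 2) <= p ->
  K <= ln n%:R -> 128 * K <= A -> A <= p * delta * n%:R ^+ 2 -> A <= ln n%:R ^+ 2 ->
  1 - prob_union G p (@pancyclic n) <= 243 * 120 / ln n%:R + 512 * K / A.
Proof.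
move=> K n0 gG p01 hd hmin halp hp KL KA Ay AL.
have nR : 0 < n%:R :> R by rewrite ltr0n.
have nR0 := ltW nR.
have c0 : 0 < 256 :> R by rewrite ltr0n.
have [d0 d3 d2] := density_bounds n0 c0 hd.
set L := ln n%:R in KL AL d2 *.
have K0 : 0 < K by rewrite mulr_gt0.
have L0 : 0 < L by exact: lt_le_trans KL.
have A0 : 0 < A by apply: lt_le_trans KA; rewrite mulr_gt0.
set D := mindeg G in hmin; have Dn : (D <= n)%N.
  have := mindeg_le G (Ordinal n0); move=> /leq_trans; apply.
  by rewrite -[X in (_ <= X)%N]card_ord max_card.
have DnR : D%:R <= n%:R :> R by rewrite ler_nat.
have d1 : delta <= 1.
  by rewrite -(ler_pM2r nR) mul1r; apply: le_trans hmin DnR.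
have dn : 256 ^+ 3 <= delta * n%:R.
  apply: le_trans d3 _; apply: ler_wpM2r => //; rewrite exprS.
  by apply: ler_piMr; [exact: ltW | apply: exprn_ile1 => //; exact: ltW].
pose e := (D %/ 4)%N.
have D6 : (6 <= D)%N.
  by rewrite -(ler_nat R); apply: le_trans hmin; apply: le_trans dn; lra.
have De : (D <= 8 * e)%N by rewrite /e; move: D6; clear; lia.
have de : delta * n%:R <= 8 * e%:R.
  by apply: le_trans hmin _; rewrite -natrM ler_nat.
have e0 : 0 < e%:R :> R by move: dn de; clear; lra.
(* Here [256] enters: [(256 / 8) ^ 3 = 32 * 1024] exceeds [30 * 1024], where [8] is the loss in
   [de]. *)
have he3 : (30 * 1024 * (n * n) <= e * e * e)%N.
  rewrite -(ler_nat R) !natrM.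
  have h1 : (delta * n%:R) ^+ 3 <= (8 * e%:R) ^+ 3.
    by apply: lerXn2r => //; rewrite nnegrE mulr_ge0 // ltW.
  have h2 : 256 ^+ 3 * n%:R ^+ 2 <= (delta * n%:R) ^+ 3.
    have -> : (delta * n%:R) ^+ 3 = (delta ^+ 3 * n%:R) * n%:R ^+ 2 by ring.
    by apply: ler_wpM2r => //; exact: exprn_ge0.
  have h3 : 256 ^+ 3 * n%:R ^+ 2 <= (8 * e%:R) ^+ 3 :> R := le_trans h2 h1.
  have h4 : 0 <= n%:R ^+ 2 :> R by rewrite exprn_ge0 // ltW.
  have -> : e%:R * e%:R * e%:R = (8 * e%:R) ^+ 3 / 512 :> R by field.
  have -> : n%:R * n%:R = n%:R ^+ 2 :> R by ring.
  by move: h3 h4; clear; lra.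
(* The constant [(1000 * 1000)^-1] is below [1 / (60 * 128 * 64)]. *)
have he2 : (60 * 128 * (n * alpha G) <= e * e)%N.
  rewrite -(ler_nat R) !natrM.
  have h1 : (delta * n%:R) ^+ 2 <= (8 * e%:R) ^+ 2.
    by apply: lerXn2r => //; rewrite nnegrE mulr_ge0 // ltW.
  have h2 : n%:R * (alpha G)%:R <= n%:R * ((1000 * 1000)^-1 * delta ^+ 2 * n%:R) :> R.
    by apply: ler_wpM2l.
  have h3 : n%:R * ((1000 * 1000)^-1 * delta ^+ 2 * n%:R) = (1000 * 1000)^-1 * (delta * n%:R) ^+ 2 by field.
  have -> : e%:R * e%:R = (8 * e%:R) ^+ 2 / 64 :> R by field.
  have h4 : 0 <= (delta * n%:R) ^+ 2 by rewrite exprn_ge0 // mulr_ge0 // ltW.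
  rewrite h3 in h2; move: h1 h2 h4; clear; lra.
have X0 : 0 < delta * n%:R ^+ 2 by rewrite mulr_gt0 // exprn_gt0.
(* Thinning the random edges down to [(ln n)^2 / delta] of them makes cherries unlikely. *)
pose y := Num.min (p * delta * n%:R ^+ 2) (L ^+ 2).
have Ay' : A <= y by rewrite /y le_min Ay AL.
have y0 : 0 < y := lt_le_trans A0 Ay'.
pose p' := y / (delta * n%:R ^+ 2).
have p'0 : 0 <= p' by rewrite divr_ge0 // ltW.
have p'p : p' <= p by rewrite ler_pdivrMr // mulrA /y ge_min lexx.
have p'1 : 0 <= p' <= 1 by rewrite p'0 (le_trans p'p) //; case/andP: p01.
have p'y : p' * (delta * n%:R ^+ 2) = y by rewrite divfK // lt0r_neq0.
have De4 : (4 * e <= D)%N by rewrite /e mulnC leq_divM.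
have [h [M [hh hM hb]]] := pancyclic_failure gG p'1 De4 (leqnn (alpha G)) n0 he3 he2.
have hmono : prob_union G p' (@pancyclic n) <= prob_union G p (@pancyclic n).
  rewrite !prob_unionE; apply: expect_mono => //; first by case/andP: p01.
  move=> E E' EE'; rewrite ler_nat; case pE: (pancyclic (G :|: E)) => //.
  by rewrite (pancyclicS _ pE) // setUS.
move: hh hM; rewrite -(ler_nat R) natrM (natrM _ 8) => hh.
rewrite -(ler_nat R) natrM (natrM _ 2304) => hM.

apply: le_trans (_ : 1 - prob_union G p' (@pancyclic n) <= _); first by rewrite lerD2l lerN2.
apply: le_trans hb _; apply: lerD.
  have Ly : y <= L ^+ 2 by rewrite /y ge_min lexx orbT.
  have -> : n%:R ^+ 3 * p' ^+ 2 = y ^+ 2 / (delta ^+ 2 * n%:R).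
    by rewrite /p'; field; rewrite !lt0r_neq0.
  have X1 : 0 < delta ^+ 2 * n%:R by rewrite mulr_gt0 // exprn_gt0.
  rewrite ler_pdivrMr //; apply: le_trans (_ : L ^+ 4 <= _).
    have -> : L ^+ 4 = (L ^+ 2) ^+ 2 by ring.
    by apply: lerXn2r => //; rewrite nnegrE ?exprn_ge0 // ltW.
  have L3 : 0 <= L / 3 by rewrite divr_ge0 // ltW.
  (* The exponential term of degree five, one more than in [L ^+ 4], leaves a factor [1 / L]. *)
  have hE : (L / 3) ^+ 5 / 120 <= expR (L / 3).
    apply: le_trans (expR_ge1Dxn 4 L3); by rewrite lerDr ler01.
  have hE2 : expR (L / 3) <= delta ^+ 2 * n%:R.
    apply: le_trans d2; apply: ler_peMl; first exact: expR_ge0.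
    by apply: exprn_ege1; rewrite ler1n.
  apply: le_trans (_ : 243 * 120 / L * ((L / 3) ^+ 5 / 120) <= _).
    by rewrite le_eqVlt; apply/orP; left; apply/eqP; field; rewrite lt0r_neq0.
  by apply: ler_wpM2l; [rewrite divr_ge0 ?mulr_ge0 // ltW | exact: le_trans hE hE2].
set q := (1 - p') ^+ M.
have q0 : 0 <= q by rewrite exprn_ge0 // subr_ge0; case/andP: p'1.
(* Against [L ^+ 2], use [ln (1 / delta) <= ln n = L] and [K <= L]. *)
have lnd : ln delta^-1 <= y / K.
  rewrite ler_pdivlMr // mulrC /y le_min; apply/andP; split.
    by move: hp; rewrite ler_pdivrMr // mulrA.
  rewrite expr2; apply: ler_pM => //; first exact: ltW.
    by rewrite ln_ge0 // invf_ge1.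
  rewrite ler_ln ?posrE ?invr_gt0 // -[delta^-1]mul1r ler_pdivrMr //.
  by apply: le_trans (_ : 256 ^+ 3 <= _); [apply: exprn_ege1; rewrite ler1n | rewrite mulrC].
(* [8] comes from [de] and [2304] from [pancyclic_failure]. As [K] exceeds [2 * c],
   [expR (- (y / c))] beats the factor [1 / delta <= expR (y / K)] from the number of hubs, with
   [expR (- (y / K))] to spare. *)
have [c [cp cK cM]] : exists c : R, [/\ 0 < c, 2 * c <= K & delta * n%:R ^+ 2 <= c * M%:R].
  exists (8 * 2304); split.
  - by rewrite mulr_gt0 ?ltr0n.
  - by rewrite /K -!natrM ler_nat.
  - have : delta * n%:R * n%:R <= 8 * e%:R * n%:R by apply: ler_wpM2r.
    by move: hM; rewrite expr2; clear; lra.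
have p'M : y / c <= p' * M%:R.
  have := ler_wpM2l p'0 cM; rewrite p'y => hy.
  by rewrite ler_pdivrMr // -mulrA [M%:R * c]mulrC.
have yK : 2 * (y / K) <= y / c.
  rewrite mulrCA; apply: ler_wpM2l; first exact: ltW.
  by rewrite ler_pdivrMr // mulrC ler_pdivlMr.
clearbody K.
have hq : h%:R * q <= 64 * (K / A).
  have hd64 : h%:R <= 64 / delta.
    rewrite ler_pdivlMr // -(ler_pM2r nR).
    have : h%:R * (delta * n%:R) <= h%:R * (8 * e%:R) by apply: ler_wpM2l.
    by move: hh; clear; lra.
  have qE : q <= expR (- (y / c)).
    by apply: le_trans (one_sub_pow_le M p'1) _; rewrite ler_expR lerN2.
  apply: le_trans (_ : 64 / delta * expR (- (y / c)) <= _).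
    by apply: ler_pM.
  rewrite -mulrA; apply: ler_wpM2l => //.
  have -> : delta^-1 = expR (ln delta^-1) by rewrite lnK // posrE invr_gt0.
  rewrite -expRD; apply: le_trans (_ : expR (- (y / K)) <= _).
    rewrite ler_expR; have : 0 <= y := ltW y0; move: lnd yK; clear; lra.
  apply: le_trans (expRN_le_inv _) _; first by rewrite divr_gt0.
  rewrite invf_div; apply: ler_wpM2l; first exact: ltW.
  by rewrite lef_pV2 ?posrE.
have hq0 : 0 <= h%:R * q by rewrite mulr_ge0.
have hq1 : h%:R * q <= 2^-1.
  apply: le_trans hq _; rewrite mulrA ler_pdivrMr //; move: KA; clear; lra.
have pow : (1 + q) ^+ h <= expR (h%:R * q).
  rewrite expRM_natl; apply: lerXn2r; rewrite ?nnegrE ?expR_ge0 ?addr_ge0 //.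
  exact: expR_ge1Dx.
have : expR (h%:R * q) - 1 <= 2 * (h%:R * q) by apply: expR_le_1D2x; rewrite hq0.
rewrite -mulrA; move: pow hq; clear; lra.
Qed.

Lemma ln_nat_near (B : R) : \forall n \near \oo, B <= ln n%:R.
Proof.
near=> n; rewrite -[B]expRK ler_ln ?posrE ?expR_gt0 //; last first.
  by apply: lt_le_trans (expR_gt0 B) _; near: n; exact: nbhs_infty_ger.
by near: n; exact: nbhs_infty_ger.
Unshelve. all: by end_near. Qed.

Lemma pancyclic_aas (delta p : nat -> R) (G : forall n : nat, {set {set 'I_n}}) :
  (forall n, is_graph (G n)) -> (forall n, 0 <= p n <= 1) ->
  (\forall n \near \oo,
     [/\ 256 * (n%:R `^ (- (1 / 3)) : R) <= delta n,
         delta n * n%:R <= (mindeg (G n))%:R,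
         ((alpha (G n))%:R : R) <= (1000 * 1000)^-1 * delta n ^+ 2 * n%:R &
         256 * 256 * ln (delta n)^-1 / (delta n * n%:R ^+ 2) <= p n]) ->
  (fun n => p n * n%:R ^+ 2) @ \oo --> +oo ->
  (fun n => prob_union (G n) (p n) (@pancyclic n)) @ \oo --> (1 : R).
Proof.
move=> gG p01 hyp hpn; apply/cvgrPdist_le => eps eps0.
pose K : R := 256 * 256.
have K0 : 0 < K by rewrite mulr_gt0 ?ltr0n.
pose A : R := Num.max (128 * K) (1024 * K / eps).
have A1 : 128 * K <= A by rewrite /A le_max lexx.
have A2 : 1024 * K / eps <= A by rewrite /A le_max lexx orbT.
have A0 : 0 < A by apply: lt_le_trans A1; rewrite mulr_gt0 ?ltr0n.
pose c : R := 2 * (243 * 120).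
have c0 : 0 < c by rewrite !mulr_gt0 ?ltr0n.
near=> n.
have [hd hmin ha hp] : [/\ 256 * (n%:R `^ (- (1 / 3)) : R) <= delta n,
         delta n * n%:R <= (mindeg (G n))%:R,
         ((alpha (G n))%:R : R) <= (1000 * 1000)^-1 * delta n ^+ 2 * n%:R &
         K * ln (delta n)^-1 / (delta n * n%:R ^+ 2) <= p n] by near: n.
have n0 : (0 < n)%N by near: n; exact: nbhs_infty_gt.
have L1 : K <= ln n%:R by near: n; exact: ln_nat_near.
have L2 : A <= ln n%:R by near: n; exact: ln_nat_near.
have L3 : 1 <= ln n%:R :> R by near: n; exact: ln_nat_near.
have L4 : c / eps <= ln n%:R by near: n; exact: ln_nat_near.
have pn : A * expR (A / K) <= p n * n%:R ^+ 2 by near: n; exact: cvgry_ge.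
have n2 : 0 < n%:R ^+ 2 :> R by rewrite exprn_gt0 // ltr0n.
have [d0 _ _] := density_bounds n0 (ltr0n _ 256 : 0 < 256) hd.
(* If [A <= K * ln (1 / delta)], the lower bound on [p] suffices. Otherwise [delta] is at least
   [expR (- (A / K))], and [p n ^ 2] is large. *)
have y : A <= p n * delta n * n%:R ^+ 2.
  have [h|h] := leP A (K * ln (delta n)^-1).
    apply: le_trans h _; move: hp; rewrite ler_pdivrMr; last exact: mulr_gt0.
    by rewrite mulrA.
  have dE : expR (- (A / K)) <= delta n.
    rewrite expRN -[delta n]invrK lef_pV2 ?posrE ?expR_gt0 ?invr_gt0 //.
    rewrite -[(delta n)^-1]lnK ?posrE ?invr_gt0 // ler_expR ler_pdivlMr // mulrC.
    exact: ltW.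
  have AE : 0 <= A * expR (A / K) by rewrite mulr_ge0 ?expR_ge0 // ltW.
  have := ler_pM (expR_ge0 _) AE dE pn.
  rewrite mulrCA -expRD addNr expR0 mulr1 => /le_trans; apply.
  by rewrite mulrA (mulrC (delta n)).
have AL : A <= ln n%:R ^+ 2.
  apply: le_trans L2 _; rewrite expr2; apply: ler_peMl => //.
  exact: le_trans ler01 L3.
have := pancyclic_bound n0 (gG n) (p01 n) hd hmin ha hp L1 A1 y AL.
have pr := prob_union_le1 (G n) (@pancyclic n) (p01 n).
rewrite ger0_norm ?subr_ge0 // => /le_trans; apply.
have L0 : 0 < ln n%:R :> R := lt_le_trans ltr01 L3.
have b1 : 243 * 120 / ln n%:R <= eps / 2.
  have -> : 243 * 120 / ln n%:R = c / ln n%:R / 2 :> R by rewrite /c; field; rewrite lt0r_neq0.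
  rewrite ler_pM2r ?invr_gt0 // ler_pdivrMr // mulrC.
  by move: L4; rewrite ler_pdivrMr.
have b2 : 512 * K / A <= eps / 2.
  have -> : 512 * K / A = 1024 * K / A / 2 by field; rewrite lt0r_neq0.
  rewrite ler_pM2r ?invr_gt0 // ler_pdivrMr // [eps * A]mulrC.
  by move: A2; rewrite ler_pdivrMr.
by move: b1 b2; rewrite -/K; clear; lra.
Unshelve. all: by end_near. Qed.

End Asymptotics.

(** * Disjoint cliques *)

Section ClassGraphs.
Variables (n k : nat).

Definition class (j : nat) : {set 'I_n} := [set u : 'I_n | u %% k == j].

Definition class_graph : {set {set 'I_n}} :=
  [set e in pairs n | [forall u in e, forall v in e, u %% k == v %% k]].

Lemma class_graph_is_graph : is_graph class_graph.
Proof. by apply/subsetP => e; rewrite inE => /andP[]. Qed.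

Lemma adj_class_graph u v : adj class_graph u v = (u != v) && (u %% k == v %% k).
Proof.
rewrite /adj !inE cards2; case: (u != v) => //=.
apply/forall_inP/idP => [h|/eqP uv x].
  by have /forall_inP/(_ v) := h u (set21 _ _); apply; rewrite set22.
by rewrite !inE => /orP[] /eqP->; apply/forall_inP => y; rewrite !inE => /orP[] /eqP->; rewrite ?uv.
Qed.

Lemma deg_class_graph u : deg class_graph u = #|class (u %% k)|.-1.
Proof.
rewrite (cardsD1 u (class _)) inE eqxx; apply: eq_card => v.
by rewrite !inE adj_class_graph (eq_sym v) (eq_sym (v %% k)).
Qed.

(** [m <= n] takes care of the default value [n] in [mindeg]. *)
Lemma mindeg_ge (E : {set {set 'I_n}}) m : m <= n -> (forall v, m <= deg E v) -> m <= mindeg E.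
Proof.
move=> mn h; rewrite /mindeg; elim/big_ind: _ => // x y mx my.
by rewrite leq_min mx.
Qed.

Hypothesis k0 : 0 < k.

Lemma card_class_le j : #|class j| <= (n %/ k).+1.
Proof.
pose f (u : 'I_n) : 'I_(n %/ k).+1 := inord (u %/ k).
rewrite -[X in _ <= X]card_ord -(@card_in_imset _ _ f) ?max_card // => u v.
rewrite !inE => /eqP uj /eqP vj /(congr1 val) /=.
have lt (w : 'I_n) : w %/ k < (n %/ k).+1 by rewrite ltnS leq_div2r //; exact: ltnW.
rewrite !inordK // => uv.
by apply: val_inj => /=; rewrite (divn_eq u k) (divn_eq v k) uv uj vj.
Qed.

Lemma card_class_ge j : j < k -> n %/ k <= #|class j|.
Proof.
move=> jk.
have lt (i : 'I_(n %/ k)) : i * k + j < n.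
  have h1 : i.+1 * k <= n %/ k * k by rewrite leq_mul2r ltn_ord orbT.
  have h2 := leq_divM n k; move: h1 h2 jk; rewrite mulSn; clear; lia.
pose f (i : 'I_(n %/ k)) : 'I_n := Ordinal (lt i).
have fi : injective f.
  move=> i i' /(congr1 val) /= /eqP; rewrite eqn_add2r eqn_pmul2r // => /eqP; exact: val_inj.
rewrite -[X in X <= _]card_ord -(card_imset _ fi); apply/subset_leq_card/subsetP => u.
by case/imsetP=> i _ ->; rewrite inE /= modnMDl modn_small.
Qed.

Lemma alpha_class_graph_le : alpha class_graph <= k.
Proof.
apply/bigmax_leqP => S /forall_inP iS.
pose f (u : 'I_n) : 'I_k := Ordinal (ltn_pmod u k0).
rewrite -[X in _ <= X]card_ord -(@card_in_imset _ _ f) ?max_card // => u v uS vS.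
move=> /(congr1 val) /= uv; apply: contraTeq isT => nuv.
by have /forall_inP/(_ v vS) := iS u uS; rewrite adj_class_graph nuv uv eqxx.
Qed.

Lemma iter_ordS (i : 'I_n) m : iter m (@ordS n) i = (i + m) %% n :> nat.
Proof.
elim: m => [|m IH]; first by rewrite addn0 modn_small.
by rewrite iterS /= IH addnS -addn1 modnDml addn1.
Qed.

(** Followed from a vertex of [C], a cycle never leaves [C], yet a Hamilton cycle visits every
    vertex. *)
Lemma not_hamiltonian (E : {set {set 'I_n}}) (C : {set 'I_n}) :
  (exists x, x \in C) -> (exists x, x \notin C) ->
  (forall x y, adj E x y -> x \in C -> y \in C) -> ~~ hamiltonian E.
Proof.
move=> [x xC] [y yC] cl; apply/negP => /andP[_ /existsP[f /andP[/injectiveP fi /forallP fa]]].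
have sur z : exists i, f i = z.
  by have [f' _ fK] := injF_bij fi; exists (f' z).
have [i fx] := sur x; have [j fy] := sur y.
have all_in m : f (iter m (@ordS n) i) \in C.
  by elim: m => [|m IH]; rewrite ?fx //= ; apply: cl (fa _) IH.
(* [n - i] steps lead from index [i] round to [0], and [j] more to index [j]. *)
have := all_in (j + (n - i)); rewrite (_ : iter _ _ i = j) ?fy ?(negPf yC) //.
apply: val_inj; rewrite /= iter_ordS; have li := ltn_ord i; have lj := ltn_ord j.
have -> : i + (j + (n - i)) = j + n by move: li; clear; lia.
by rewrite modnDr modn_small.
Qed.

Definition boundary (C : {set 'I_n}) : {set {set 'I_n}} :=
  [set [set xy.1; xy.2] | xy in setX C (~: C)].

Lemma boundary_pairs C : boundary C \subset pairs n.
Proof.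
apply/subsetP => e /imsetP[[x y] /setXP[/= xC]]; rewrite inE => yC ->.
by rewrite inE cards2 (_ : x != y) //; apply: contraNneq yC => <-.
Qed.

Lemma card_boundary C : #|boundary C| <= #|C| * n.
Proof.
apply: leq_trans (leq_imset_card _ _) _; rewrite cardsX leq_mul2l.
by rewrite -[X in _ <= X]card_ord max_card orbT.
Qed.

(** A pair leaving both of two disjoint sets joins one to the other. *)
Lemma card_boundaryI (C C' : {set 'I_n}) : [disjoint C & C'] ->
  #|boundary C :&: boundary C'| <= #|C| * #|C'|.
Proof.
move=> dis; rewrite -cardsX.
apply: leq_trans (leq_imset_card (fun xy : 'I_n * 'I_n => [set xy.1; xy.2]) _).
apply/subset_leq_card/subsetP => e /setIP[/imsetP[[x y] /setXP[/= xC yC] ->]].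
case/imsetP=> -[x' y'] /setXP[/= x'C' _] E.
apply/imsetP; exists (x, y) => //; apply/setXP; split=> //=.
have : x' \in [set x; y] by rewrite E !inE eqxx.
rewrite !inE => /orP[] /eqP E'; last by rewrite -E'.
by rewrite E' (disjointFr dis xC) in x'C'.
Qed.

Lemma class_isolated (E : {set {set 'I_n}}) j : j < k -> 1 < k -> k <= n ->
  [disjoint boundary (class j) & E] -> ~~ hamiltonian (class_graph :|: E).
Proof.
move=> jk k1 kn dis; apply: (@not_hamiltonian _ (class j)).
- have jn : j < n := leq_trans jk kn.
  by exists (Ordinal jn); rewrite inE /= modn_small.
- have jn : (j.+1 %% k) < n := leq_trans (ltn_pmod _ k0) kn.
  exists (Ordinal jn); rewrite inE /= modn_mod; apply/eqP => E'.
  have [h|h] := ltnP j.+1 k; first by move: E'; rewrite modn_small //; clear; lia.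
  have jE : j.+1 = k by move: jk h; clear; lia.
  by move: E'; rewrite jE modnn => j0; move: jE k1; rewrite -j0; clear; lia.
move=> x y; rewrite adjU => /orP[|xyE xC].
  by rewrite adj_class_graph !inE => /andP[_ /eqP->].
apply: contraT => yC; have : [set x; y] \in boundary (class j).
  by apply/imsetP; exists (x, y) => //; apply/setXP; rewrite in_setC.
by move=> /(disjointFr dis); rewrite -[_ \in E]/(adj E x y) xyE.
Qed.

End ClassGraphs.

(** * Probability that a clique receives no random edge from outside *)

Section ClassGraphProbability.
Local Open Scope ring_scope.
Variable R : realType.

(** From [(1 - p) * (1 + 2 * p) >= 1] on [[0, 1/2]]. *)
Lemma one_sub_pow_ge (p : R) (m : nat) : 0 <= p <= 1 -> p <= 2^-1 -> expR (- (2 * p * m%:R)) <= (1 - p) ^+ m.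
Proof.
move=> p01 p2; have [p0 _] := andP p01; rewrite -mulNr expRM_natr; apply: lerXn2r.
- by rewrite nnegrE expR_ge0.
- by rewrite nnegrE subr_ge0; case/andP: p01.
have h := expR_ge1Dx (2 * p); have e0 := expR_gt0 (2 * p).
rewrite expRN -[_^-1]mul1r ler_pdivrMr //.
apply: le_trans (_ : (1 - p) * (1 + 2 * p) <= _); last first.
  by apply: ler_wpM2l => //; rewrite subr_ge0; case/andP: p01.
by move: p0 p2; clear; nra.
Qed.

Lemma prob_hamiltonian_le (n k : nat) (p : R) :
  0 <= p <= 1 -> (1 < k)%N -> (k <= n)%N ->
  prob_union (class_graph n k) p (@hamiltonian n) <= 1 - (1 - p) ^+ #|boundary (class n k 0)|.
Proof.
move=> p01 k1 kn; have k0 : (0 < k)%N := ltnW k1.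
rewrite -(expect_avoid_pairs p (boundary_pairs _)) prob_unionE.
rewrite -[X in X - _](expect_cst p (enum (pairs n)) 1) -mulN1r -expectZ -expectD.
apply: expect_le => // E _; case dis : [disjoint _ & _]; last by rewrite mulr0 addr0; case: (hamiltonian _).
by rewrite (negPf (class_isolated k0 k0 k1 kn dis)) mulr1 subrr.
Qed.

(** Chebyshev's inequality for the number [X] of classes that no random edge leaves, which vanishes
    on Hamiltonian graphs. Two class boundaries share at most [b * b] pairs, so joint probabilities
    exceed products by a factor of at most [1 + 2 * c]. *)
Lemma prob_hamiltonian_second_moment (n k b : nat) (p : R) :
  0 <= p <= 1 -> (1 < k)%N -> (k <= n)%N ->
  (forall j, (#|class n k j| <= b)%N) -> p * (b * b)%:R <= 2^-1 -> (0 < b)%N ->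
  prob_union (class_graph n k) p (@hamiltonian n) <=
    (k%:R * expR (- (2 * p * (b * n)%:R)))^-1 + 2 * (p * (b * b)%:R).
Proof.
move=> p01 k1 kn hb pb b0; pose pr := expect p (enum (pairs n)); have k0 : (0 < k)%N := ltnW k1; have [p0 p1] := andP p01.
pose S (j : 'I_k) := boundary (class n k j).
pose X (E : {set {set 'I_n}}) : R := \sum_(j < k) [disjoint S j & E]%:R.
pose a j : R := (1 - p) ^+ #|S j|.
pose mu : R := \sum_(j < k) a j.
have q0 : 0 <= 1 - p by rewrite subr_ge0.
have q1 : 1 - p <= 1 by rewrite lerBlDr lerDl.
have a0 j : 0 <= a j by exact: exprn_ge0.
have EX : pr X = mu.
  by rewrite /pr /X expect_bigsum; apply: eq_bigr => j _; exact/expect_avoid_pairs/boundary_pairs.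
have p2 : p <= 2^-1.
  apply: le_trans pb; rewrite -[X in X <= _]mulr1; apply: ler_wpM2l => //.
  by rewrite ler1n muln_gt0 b0.
have mu_ge : k%:R * expR (- (2 * p * (b * n)%:R)) <= mu.
  rewrite -[k in k%:R]card_ord mulr_natl -sumr_const; apply: ler_sum => j _.
  apply: le_trans (one_sub_pow_ge _ p01 p2) _; apply: ler_wiXn2l => //.
  by apply: leq_trans (card_boundary _) _; rewrite leq_mul2r hb orbT.
have mu0 : 0 < mu by apply: lt_le_trans mu_ge; rewrite mulr_gt0 ?expR_gt0 ?ltr0n.
pose c : R := p * (b * b)%:R.
have c0 : 0 <= c by rewrite mulr_ge0.
have pair i j : i != j -> (1 - p) ^+ #|S i :|: S j| <= (1 + 2 * c) * (a i * a j).
  move=> ij; rewrite -exprD -cardsUI exprD; set u := _ ^+ _.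
  have u0 : 0 <= u by exact: exprn_ge0.
  have dis : [disjoint class n k i & class n k j].
    rewrite -setI_eq0; apply/eqP/setP => x; rewrite !inE; apply/negP => /andP[/eqP-> /eqP ij'].
    by move/eqP: ij; apply; exact: val_inj.
  have : 1 - c <= (1 - p) ^+ #|S i :&: S j|.
    apply: le_trans (_ : (1 - p) ^+ (b * b) <= _); last first.
      apply: ler_wiXn2l => //; apply: leq_trans (card_boundaryI dis) _; exact: leq_mul.
    rewrite /c; elim: (b * b)%N => [|m IH]; first by rewrite mulr0 subr0 expr0.
    rewrite exprS -natr1; have pm : 0 <= p * m%:R by rewrite mulr_ge0.
    by have := ler_wpM2l q0 IH; move: pm p0; clear; nra.
  set v := _ ^+ _ => hv; have h2 : 1 <= (1 + 2 * c) * v.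
    by move: hv c0 pb; rewrite -/c; clear; nra.
  by rewrite mulrCA; apply: ler_peMr.
have EX2 : pr (fun E => X E * X E) <= mu + (1 + 2 * c) * (mu * mu).
  have -> : pr (fun E => X E * X E) = \sum_(i < k) \sum_(j < k) (1 - p) ^+ #|S i :|: S j|.
    rewrite /pr (@expect_ext _ _ _ _ _ (fun E => \sum_(i < k) \sum_(j < k) [disjoint S i :|: S j & E]%:R)); last first.
      move=> E _; rewrite /X big_distrlr /=; apply: eq_bigr => i _; apply: eq_bigr => j _.
      rewrite -natrM mulnb; congr (nat_of_bool _)%:R.
      by rewrite -!setI_eq0 setIUl setU_eq0.
    rewrite expect_bigsum; apply: eq_bigr => i _; rewrite expect_bigsum; apply: eq_bigr => j _.
    by apply: expect_avoid_pairs; rewrite subUset !boundary_pairs.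
  rewrite [X in (1 + 2 * c) * X]big_distrlr /= big_distrr /= -big_split /=.
  apply: ler_sum => i _; rewrite big_distrr (bigD1 i) //= setUid; apply: lerD => //.
  rewrite [X in _ <= X](bigD1 i) //=; apply: ler_wpDl.
    by rewrite !mulr_ge0 // addr_ge0 // mulr_ge0.
  by apply: ler_sum => j ji; apply: pair; rewrite eq_sym.
have cheb : mu * mu * prob_union (class_graph n k) p (@hamiltonian n) <= pr (fun E => (X E - mu) ^+ 2).
  rewrite prob_unionE -expectZ; apply: expect_le => // E _.
  case ham : (hamiltonian _); last by rewrite mulr0 sqr_ge0.
  have -> : X E = 0.
    apply: big1 => j _; case dis : [disjoint _ & _] => //.
    by have := class_isolated k0 (ltn_ord j) k1 kn dis; rewrite ham.
  by rewrite mulr1 sub0r sqrrN expr2.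
have var : pr (fun E => (X E - mu) ^+ 2) = pr (fun E => X E * X E) - mu * mu.
  have -> : pr (fun E => (X E - mu) ^+ 2) = pr (fun E => X E * X E + ((- (2 * mu)) * X E + mu * mu)).
    by apply: expect_ext => E _; ring.
  rewrite /pr !expectD expectZ expect_cst -/pr EX; ring.
have fin : mu * mu * prob_union (class_graph n k) p (@hamiltonian n) <= mu * mu * (mu^-1 + 2 * c).
  apply: le_trans cheb _; rewrite var.
  have -> : mu * mu * (mu^-1 + 2 * c) = mu + 2 * c * (mu * mu) by field; rewrite lt0r_neq0.
  by move: EX2; clear; lra.
rewrite ler_pM2l ?mulr_gt0 // in fin; apply: le_trans fin _; rewrite lerD2r.
by rewrite lef_pV2 ?posrE // mulr_gt0 ?expR_gt0 ?ltr0n.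
Qed.

End ClassGraphProbability.

(** * Minimum degree and independence number of two cliques *)

Section TwoCliques.

(** One of the two classes has at most [n %/ 2] vertices, which caps the minimum degree; the
    vertices [0] and [1] lie in different classes. *)
Lemma class_graph2_mindeg_alpha (n : nat) : 2 <= n ->
  mindeg (class_graph n 2) = n./2 - 1 /\ alpha (class_graph n 2) = 2.
Proof.
move=> n2; have n2' : 1 <= n %/ 2 by rewrite divn_gt0.
split.
  rewrite -divn2; apply/eqP; rewrite eqn_leq; apply/andP; split; last first.
    apply: mindeg_ge => [|u]; first by move: n2; clear; lia.
    rewrite deg_class_graph -subn1 leq_sub2r // card_class_ge // ltn_pmod //.
  have [j j2 cj] : exists2 j, j < 2 & #|class n 2 j| <= n %/ 2.
    have csum : #|class n 2 0| + #|class n 2 1| = n.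
      have -> : class n 2 1 = ~: class n 2 0.
        by apply/setP => u; rewrite !inE !modn2; case: (odd u).
      by rewrite cardsC card_ord.
    have [h|h] := leqP #|class n 2 0| (n %/ 2); first by exists 0.
    by exists 1 => //; move: h csum; clear; lia.
  have /card_gt0P[u uj] : 0 < #|class n 2 j| by apply: leq_trans n2' (card_class_ge _ _ _).
  apply: leq_trans (mindeg_le _ u) _; rewrite deg_class_graph -subn1 leq_sub2r //.
  by move: uj; rewrite inE => /eqP->.
apply/eqP; rewrite eqn_leq alpha_class_graph_le //=.
have n0 : 0 < n by exact: leq_trans n2.
pose x : 'I_n := Ordinal n0; pose y : 'I_n := Ordinal n2.
have xy : x != y by [].
have c2 : #|[set x; y]| = 2 by rewrite cards2 xy.
rewrite -[X in X <= _]c2.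
apply: (@leq_bigmax_cond _ (independent (class_graph n 2)) (fun S : {set 'I_n} => #|S|)).
apply/forall_inP => u; rewrite !inE => /orP[] /eqP->; apply/forall_inP => v;
  rewrite !inE => /orP[] /eqP->; rewrite adj_class_graph ?eqxx //=; by rewrite andbF.
Qed.

End TwoCliques.

(** * Lower bounds on the edge probability *)

Section LowerBounds.
Local Open Scope ring_scope.
Local Open Scope classical_set_scope.
Variable R : realType.

(** If [p n ^ 2 < A] at a large [n], no random edge leaves a clique with probability at least
    [expR (- (2 * A))], which keeps the probability of a Hamilton cycle away from [1]. *)
Lemma hamiltonian_two_cliques (p : nat -> R) : (forall n, 0 <= p n <= 1) ->
  (fun n => prob_union (class_graph n 2) (p n) (@hamiltonian n)) @ \oo --> (1 : R) ->
  (fun n => p n * n%:R ^+ 2) @ \oo --> +oo.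
Proof.
move=> p01 /cvgrPdist_lt hP; apply/cvgryPge => A.
have hA := hP (expR (- (2 * A))) (expR_gt0 _).
near=> n.
have n2 : (2 <= n)%N by near: n; exact: nbhs_infty_ge.
have nA : 2 * A <= n%:R by near: n; exact: nbhs_infty_ger.
have hn : `|1 - prob_union (class_graph n 2) (p n) (@hamiltonian n)| < expR (- (2 * A)) by near: n.
rewrite leNgt; apply/negP => pA.
have n1 : 1 <= n%:R :> R by rewrite ler1n; exact: ltnW.
have nn : n%:R <= n%:R ^+ 2 :> R by rewrite expr2 ler_peMl // (le_trans ler01 n1).
have np : 0 < n%:R ^+ 2 :> R by apply: lt_le_trans nn; exact: lt_le_trans ltr01 n1.
have p2 : p n <= 2^-1.
  rewrite -(ler_pM2r np); apply: le_trans (ltW pA) _; move: nA nn; clear; lra.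
have h1 := prob_hamiltonian_le (p01 n) (isT : (1 < 2)%N) n2.
have h2 := one_sub_pow_ge #|boundary (class n 2 0)| (p01 n) p2.
have h3 : (#|boundary (class n 2 0)|%:R : R) <= n%:R ^+ 2.
  rewrite expr2 -natrM ler_nat; apply: leq_trans (card_boundary _) _.
  by rewrite leq_mul2r -[X in (_ <= X)%N]card_ord max_card orbT.
have h4 : expR (- (2 * A)) <= expR (- (2 * p n * #|boundary (class n 2 0)|%:R)).
  rewrite ler_expR lerN2 -mulrA ler_pM2l //; apply: le_trans (ltW pA).
  by apply: ler_wpM2l => //; case/andP: (p01 n).
have := le_lt_trans (ler_norm _) hn; rewrite ltNge => /negP; apply.
by apply: le_trans (le_trans h4 h2) _; rewrite lerBrDr addrC -lerBrDr.
Unshelve. all: by end_near. Qed.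

(** The two added vertices keep the degree in such a clique, one less than its size, at least [x]
    after truncation. *)
Definition clique_size (x : R) : nat := (Num.truncn x).+2.

(** The bounds by [20] absorb all rounding: [q] is at most [11 / 10] of [d * n], and [k] at least
    [10 / 12] of [1 / d]. *)
Lemma clique_parameters (n : nat) (d : R) : 0 < d -> 20 <= d * n%:R -> 20 <= d^-1 ->
  let q := clique_size (d * n%:R) in let k := (n %/ q)%N in
  [/\ (1 < k)%N, (k <= n)%N, (q <= n %/ k)%N, d * n%:R <= (q.-1)%:R &
   [/\ k%:R <= d^-1, d^-1 / 3 <= k%:R & ((n %/ k).+1)%:R <= 3 * (d * n%:R)]].
Proof.
move=> d0 x20 T20 q k; set x := d * n%:R in x20 q k *; set t := d^-1 in T20 *.
have nE : n%:R = x * t by rewrite /x /t mulrAC divff ?mul1r // lt0r_neq0.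
have x0 : 0 <= x by apply: le_trans x20.
have /andP[q1 q2] := Num.Theory.truncn_itv x0.
have qE : q%:R = (Num.truncn x)%:R + 2 :> R by rewrite /q /clique_size -addn2 natrD.
have q0 : (0 < q)%N by [].
have kq : k%:R * q%:R <= n%:R :> R by rewrite -natrM ler_nat leq_divM.
have kq1 : n%:R < (k%:R + 1) * q%:R :> R.
  by rewrite natr1 -natrM ltr_nat ltn_ceil.
have q2' : x + 1 < q%:R.
  by rewrite qE; move: q2; rewrite -natr1; clear; lra.
have q3 : q%:R <= x + 2 by rewrite qE lerD2r.
have q4 : q%:R <= x * (11 / 10) by move: q3 x20; clear; lra.
have k0R : 0 <= k%:R :> R by [].
have kT : t < (k%:R + 1) * (11 / 10).
  have xp : 0 < x by apply: lt_le_trans x20.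
  rewrite -(ltr_pM2l xp) -nE; apply: lt_le_trans kq1 _.
  by rewrite mulrCA mulrA -mulrA; apply: ler_wpM2l => //; rewrite addr_ge0.
have kT2 : t <= k%:R * (12 / 10) by move: kT T20; clear; lra.
have k1 : (1 < k)%N by rewrite -(ltr_nat R); move: kT2 T20; clear; lra.
have kn : (k <= n)%N by exact: leq_div.
have kp : 0 < k%:R :> R by rewrite ltr0n ltnW.
split=> //.
- by rewrite leq_divRL ?(ltnW k1) // mulnC leq_divM.
- by move: q2'; rewrite qE /q /clique_size /= -natr1; clear; lra.
split.
- have xp : 0 < x by apply: lt_le_trans x20.
  rewrite -(ler_pM2l xp) -nE; apply: le_trans kq; rewrite mulrC; apply: ler_wpM2l => //.
  by move: q2'; clear; lra.
- by move: kT2 T20; clear; lra.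
rewrite -natr1; have : (n %/ k)%:R * k%:R <= x * t by rewrite -nE -natrM ler_nat leq_divM.
have : x * t <= x * (k%:R * (12 / 10)) by apply: ler_wpM2l.
move=> h1 h2; have := le_trans h2 h1; rewrite mulrCA mulrC ler_pM2l // => h3.
by move: h3 x20; clear; lra.
Qed.

Lemma not_hamiltonian_cliques (delta : nat -> R) :
  (exists c : R, 0 < c /\ \forall n \near \oo, c * (n%:R `^ (- (1 / 3)) : R) <= delta n) ->
  delta @ \oo --> (0 : R) ->
  exists H : forall n : nat, {set {set 'I_n}},
    (forall n, is_graph (H n)) /\
    (\forall n \near \oo, delta n * n%:R <= (mindeg (H n))%:R) /\
    (exists C : R, 0 < C /\
       \forall n \near \oo, ((alpha (H n))%:R : R) <= C * delta n ^+ 2 * n%:R) /\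
    (forall p : nat -> R,
       (forall n, 0 <= p n <= 1) ->
       (\forall n \near \oo, p n <= 12^-1 * ln (delta n)^-1 / (delta n * n%:R ^+ 2)) ->
       (fun n => prob_union (H n) (p n) (fun E => ~~ hamiltonian E)) @ \oo --> (1 : R)).
Proof.
move=> [c [c0 hc]] hd0.
pose k n := (n %/ clique_size (delta n * n%:R))%N.
have small (B : R) : 0 < B -> \forall n \near \oo, delta n <= B.
  move=> B0; move/cvgrPdist_le: hd0 => /(_ B B0) hB; near=> n.
  have : `|0 - delta n| <= B by near: n.
  by rewrite sub0r normrN => h; exact: le_trans (ler_norm _) h.
have dpos : \forall n \near \oo, 0 < delta n /\ c ^+ 3 <= delta n ^+ 3 * n%:R.
  near=> n; have n0 : (0 < n)%N by near: n; exact: nbhs_infty_gt.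
  have hcn : c * (n%:R `^ (- (1 / 3)) : R) <= delta n by near: n.
  by have [? ? _] := density_bounds n0 c0 hcn.
have big : \forall n \near \oo, 20 <= delta n * n%:R.
  near=> n; have n0 : (0 < n)%N by near: n; exact: nbhs_infty_gt.
  have hcn : c * (n%:R `^ (- (1 / 3)) : R) <= delta n by near: n.
  have [d0 _ h2] := density_bounds n0 c0 hcn.
  have d1 : delta n <= 1 by near: n; exact: small.
  have L : 60 / c ^+ 2 <= ln n%:R by near: n; exact: ln_nat_near.
  apply: le_trans (_ : delta n ^+ 2 * n%:R <= _); last first.
    by apply: ler_wpM2r => //; rewrite expr2 ler_piMl // ltW.
  apply: le_trans h2; have c2 : 0 < c ^+ 2 by rewrite exprn_gt0.
  rewrite ler_pdivrMr // mulrC in L.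
  have := expR_ge1Dx (ln n%:R / 3 : R) => hE.
  apply: le_trans (_ : c ^+ 2 * (ln n%:R / 3) <= _).
    by move: L; clear; lra.
  by apply: ler_wpM2l; [exact: ltW | apply: le_trans hE; rewrite lerDr ler01].
have params : \forall n \near \oo,
    [/\ 0 < delta n, 20 <= delta n * n%:R & 20 <= (delta n)^-1].
  near=> n; have [d0 _] : 0 < delta n /\ c ^+ 3 <= delta n ^+ 3 * n%:R by near: n.
  split=> //; first by near: n.
  rewrite -[20]invrK lef_pV2 ?posrE ?invr_gt0 //.
  by near: n; apply: small; rewrite invr_gt0.
exists (fun n => class_graph n (k n)); split; first by move=> n; exact: class_graph_is_graph.
split.
  near=> n; have [d0 x20 T20] : [/\ 0 < delta n, 20 <= delta n * n%:R & 20 <= (delta n)^-1] by near: n.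
  have [k1 kn qk xq _] := clique_parameters d0 x20 T20; have k0 := ltnW k1.
  apply: le_trans xq _; rewrite ler_nat; apply: mindeg_ge.
    by apply: leq_trans (leq_pred _) _; apply: leq_trans qk _; exact: leq_div.
  move=> v; rewrite deg_class_graph -!subn1 leq_sub2r //; apply: leq_trans qk _.
  by apply: card_class_ge => //; exact: ltn_pmod.
split.
  (* [k <= 1 / delta], and [1 <= delta ^ 3 * n / c ^ 3]. *)
  exists (c ^- 3); split; first by rewrite invr_gt0 exprn_gt0.
  near=> n; have [d0 x20 T20] : [/\ 0 < delta n, 20 <= delta n * n%:R & 20 <= (delta n)^-1] by near: n.
  have [_ c3] : 0 < delta n /\ c ^+ 3 <= delta n ^+ 3 * n%:R by near: n.
  have [k1 kn qk xq [kT _ _]] := clique_parameters d0 x20 T20; have k0 := ltnW k1.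
  apply: le_trans (_ : (k n)%:R <= _); first by rewrite ler_nat; exact: alpha_class_graph_le.
  apply: le_trans kT _; have c3p : 0 < c ^+ 3 by rewrite exprn_gt0.
  rewrite -mulrA mulrC ler_pdivlMr // ler_pdivrMl //; apply: le_trans c3 _.
  by rewrite le_eqVlt; apply/orP; left; apply/eqP; ring.
move=> p p01 hp; apply/cvgrPdist_le => eps eps0.
(* [B] will be a lower bound for [t]: the [3] makes [p * b ^ 2] at most [1 / 2], and [6 / eps] makes
   the final error [6 / t] at most [eps]. *)
pose B : R := Num.max 3 (6 / eps).
have B0 : 0 < B by rewrite /B lt_max ltr0n.
near=> n; have [d0 x20 T20] : [/\ 0 < delta n, 20 <= delta n * n%:R & 20 <= (delta n)^-1] by near: n.
have [k1 kn qk xq [kT kT3 bx]] := clique_parameters d0 x20 T20; have k0 := ltnW k1.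
have hpn : p n <= 12^-1 * ln (delta n)^-1 / (delta n * n%:R ^+ 2) by near: n.
have dB : delta n <= B ^- 2 by near: n; apply: small; rewrite invr_gt0 exprn_gt0.
rewrite prob_unionC opprB addrCA subrr addr0 ger0_norm ?prob_union_ge0 //.
set d := delta n in d0 x20 T20 kT kT3 bx hpn dB.
(* [t] is [d ^ (-1/2)]. With [12^-1], [p * d * n ^ 2] is at most [u / 6], so a clique, on at most
   [3 * d * n] vertices, is isolated with probability at least [expR (- u) = 1 / t], and there are
   at least [t ^ 2 / 3] cliques. *)
pose u : R := ln d^-1 / 2; pose t := expR u.
have t0 : 0 < t := expR_gt0 _.
have tT : t ^+ 2 = d^-1.
  by rewrite /t -expRM_natl /u mulrC divfK ?pnatr_eq0 // lnK // posrE invr_gt0.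
have Bt : B <= t.
  rewrite -(ler_pXn2r (ltn0Sn 1)) ?nnegrE; [|exact: ltW|exact: ltW].
  by rewrite tT -[B ^+ 2]invrK lef_pV2 ?posrE ?invr_gt0 ?exprn_gt0.
have t3 : 3 <= t by apply: le_trans Bt; rewrite /B le_max lexx.
have t6 : 6 / eps <= t by apply: le_trans Bt; rewrite /B le_max lexx orbT.
have n0 : 0 < n%:R :> R by rewrite ltr0n; apply: leq_trans kn.
have X0 : 0 < d * n%:R ^+ 2 by rewrite mulr_gt0 // exprn_gt0.
have pn0 : 0 <= p n by case/andP: (p01 n).
have ut : u <= t by apply: le_trans (expR_ge1Dx u); rewrite lerDr ler01.
have pX : p n * (d * n%:R ^+ 2) <= u / 6.
  by move: hpn; rewrite ler_pdivlMr // => h; apply: le_trans h _; rewrite /u; lra.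
set b := (n %/ k n).+1.
have h1 : p n * (b * b)%:R <= 3 / 2 / t.
  apply: le_trans (_ : p n * (3 * (d * n%:R) * (3 * (d * n%:R))) <= _).
    by apply: ler_wpM2l => //; rewrite natrM; apply: ler_pM.
  have -> : p n * (3 * (d * n%:R) * (3 * (d * n%:R))) = 9 * d * (p n * (d * n%:R ^+ 2)) by ring.
  apply: le_trans (_ : 9 * d * (t / 6) <= _).
    by apply: ler_wpM2l; [rewrite mulr_ge0 // ltW | move: pX ut; clear; lra].
  have -> : d = t ^- 2 by rewrite tT invrK.
  by rewrite le_eqVlt; apply/orP; left; apply/eqP; field; rewrite lt0r_neq0.
have h2 : 2 * p n * (b * n)%:R <= u.
  apply: le_trans (_ : 2 * p n * (3 * (d * n%:R) * n%:R) <= _).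
    by apply: ler_wpM2l; [rewrite mulr_ge0 | rewrite natrM; apply: ler_wpM2r].
  by move: pX; rewrite expr2; clear; lra.
have h3 : p n * (b * b)%:R <= 2^-1.
  apply: le_trans h1 _; rewrite ler_pdivrMr //; move: t3; clear; lra.
have hcl j : (#|class n (k n) j| <= b)%N by exact: card_class_le.
apply: le_trans (prob_hamiltonian_second_moment (p01 n) k1 kn hcl h3 (ltn0Sn _)) _.
have h4 : ((k n)%:R * expR (- (2 * p n * (b * n)%:R)))^-1 <= 3 / t.
  rewrite -[3 / t]invf_div lef_pV2 ?posrE ?divr_gt0 ?mulr_gt0 ?expR_gt0 ?ltr0n //.
  apply: le_trans (_ : (k n)%:R * expR (- u) <= _); last first.
    by apply: ler_wpM2l => //; rewrite ler_expR lerN2.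
  rewrite expRN -/t ler_pdivlMr //; apply: le_trans kT3.
  by rewrite -tT; clear; lra.
have h5 : 6 / t <= eps.
  by move: t6; rewrite !ler_pdivrMr // mulrC.
by move: h1 h4 h5; clear; lra.
Unshelve. all: by end_near. Qed.

End LowerBounds.

Local Open Scope ring_scope.
Local Open Scope classical_set_scope.

Theorem theorem1p2 (R : realType) :
  exists c1 c2 c3 c4 : R, [/\ 0 < c1, 0 < c2, 0 < c3, 0 < c4 &
  [/\
  (* (a) *)
  (forall (delta p : nat -> R) (G : forall n : nat, {set {set 'I_n}}),
     (forall n, is_graph (G n)) ->
     (forall n, 0 <= p n <= 1) ->
     (\forall n \near \oo,
        [/\ c1 * (n%:R `^ (- (1 / 3)) : R) <= delta n,
            delta n * n%:R <= (mindeg (G n))%:R,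
            ((alpha (G n))%:R : R) <= c2 * delta n ^+ 2 * n%:R &
            c3 * ln (delta n)^-1 / (delta n * n%:R ^+ 2) <= p n]) ->
     (fun n => p n * n%:R ^+ 2) @ \oo --> +oo ->
     (fun n => prob_union (G n) (p n) (@pancyclic n)) @ \oo --> (1 : R)),
  (* (b) *)
  (exists H : forall n : nat, {set {set 'I_n}},
     (forall n, is_graph (H n)) /\
     (forall n, (2 <= n)%N -> mindeg (H n) = (n./2 - 1)%N /\ alpha (H n) = 2%N) /\
     (forall p : nat -> R,
        (forall n, 0 <= p n <= 1) ->
        (fun n => prob_union (H n) (p n) (@hamiltonian n)) @ \oo --> (1 : R) ->
        (fun n => p n * n%:R ^+ 2) @ \oo --> +oo)) &
  (* (c) *)
  (forall delta : nat -> R,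
     (exists c : R, 0 < c /\ \forall n \near \oo, c * (n%:R `^ (- (1 / 3)) : R) <= delta n) ->
     delta @ \oo --> (0 : R) ->
     exists H : forall n : nat, {set {set 'I_n}},
       (forall n, is_graph (H n)) /\
       (\forall n \near \oo, delta n * n%:R <= (mindeg (H n))%:R) /\
       (exists C : R, 0 < C /\
          \forall n \near \oo, ((alpha (H n))%:R : R) <= C * delta n ^+ 2 * n%:R) /\
       (forall p : nat -> R,
          (forall n, 0 <= p n <= 1) ->
          (\forall n \near \oo, p n <= c4 * ln (delta n)^-1 / (delta n * n%:R ^+ 2)) ->
          (fun n => prob_union (H n) (p n) (fun E => ~~ hamiltonian E)) @ \oo --> (1 : R)))
  ]].
Proof.
exists 256, ((1000 * 1000)^-1), (256 * 256), (12^-1).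
have pos : 0 < (1000 * 1000)^-1 :> R by rewrite invr_gt0 mulr_gt0 ?ltr0n.
split; [by rewrite ltr0n | exact: pos | by rewrite mulr_gt0 ?ltr0n |
  by rewrite invr_gt0 ltr0n |].
split; [exact: pancyclic_aas| |exact: not_hamiltonian_cliques].
exists (fun n => class_graph n 2); split; first by move=> n; exact: class_graph_is_graph.
split; first by move=> n; exact: class_graph2_mindeg_alpha.
exact: hamiltonian_two_cliques.
Qed.
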